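(* Let $n\ge 1$ be an integer. Let $\psi\in L^2(\mathbb{R}^{2n},\mathbb{H})$ be a nonzero admissible quaternion shearlet and let $f\in L^2(\mathbb{R}^{2n},\mathbb{H})$ with $f\neq 0$. Let $\Sigma$ be a measurable subset of $\mathbb{R}^*\times\mathbb{R}^{2n-1}\times\mathbb{R}^{2n}$ and let $\xi\ge 0$. If $\mathcal{SH}_\psi^Q(f)$ is $\xi$-concentrated on $\Sigma$, then for every $p>2$, $$\mu(\Sigma)\ \ge\ (1-\xi^2)^{\frac{p}{p-2}}\ \frac{C_\psi}{\|\psi\|_2^2}.$$
   Context: $\mathbb{H}$ is the real quaternion algebra with units $i,j,k$, conjugation $\overline{q}$ and modulus $|q|$. $\|f\|_2=(\int_{\mathbb{R}^{2n}}|f(x)|^2dx)^{1/2}$ for $f:\mathbb{R}^{2n}\to\mathbb{H}$, and $L^2(\mathbb{R}^{2n},\mathbb{H})$ is the corresponding space of square-integrable functions. $\mathbb{R}^*=\mathbb{R}\setminus\{0\}$. The (two-sided) quaternion Fourier transform of $f\in L^1\cap L^2(\mathbb{R}^{2n},\mathbb{H})$ is $\mathcal{F}_Q(f)(u,v)=\int_{\mathbb{R}^{2n}}e^{-2i\pi u\cdot x}f(x,y)e^{-2j\pi v\cdot y}\,dx\,dy$ with $x,y,u,v\in\mathbb{R}^n$; it extends to a norm-preserving operator on $L^2(\mathbb{R}^{2n},\mathbb{H})$. For $a\in\mathbb{R}^*$, $s\in\mathbb{R}^{2n-1}$: $A_a=\begin{pmatrix} a & 0^T\\ 0 & \mathrm{sg}(a)|a|^{\frac1{2n}}I_{2n-1}\end{pmatrix}$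 ($\mathrm{sg}$ is the sign) and $S_s=\begin{pmatrix}1 & s^T\\ 0 & I_{2n-1}\end{pmatrix}$, both $2n\times 2n$. For $t\in\mathbb{R}^{2n}$, $\psi_{a,s,t}(x)=|a|^{\frac1{4n}-1}\psi(A_a^{-1}S_s^{-1}(x-t))$. Put $\psi^*(x)=\overline{\psi(-x)}$. A function $\psi\in L^2(\mathbb{R}^{2n},\mathbb{H})$ is an admissible quaternion shearlet if and only if $C_\psi:=\int_{\mathbb{R}^{2n}}\frac{|\mathcal{F}_Q(\psi^* )(\lambda)|^2}{|\lambda_1|^{2n}}\,d\lambda<\infty$, where $\lambda=(\lambda_1,\dots,\lambda_{2n})$. The continuous quaternion shearlet transform is $\mathcal{SH}_\psi^Q(f)(a,s,t)=\int_{\mathbb{R}^{2n}}f(x)\overline{\psi_{a,s,t}(x)}\,dx$. $\mu$ is the measure $d\mu(a,s,t)=\frac{da\,ds\,dt}{|a|^{2n+1}}$ on $\mathbb{R}^*\times\mathbb{R}^{2n-1}\times\mathbb{R}^{2n}$, and $\|F\|_{2,\mu}=(\int|F|^2d\mu)^{1/2}$. A function $F$ in $L^2(d\mu)$ is said to be $\xi$-concentrated on a measurable set $\Sigma\subseteq\mathbb{R}^*\times\mathbb{R}^{2n-1}\times\mathbb{R}^{2n}$ if $\big(\int_{\Sigma^c}|F|^2\,d\mu\big)^{1/2}\le \xi\,\|F\|_{2,\mu}$, where $\Sigma^c$ is the complement of $\Sigma$.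
   Formalization: For ξ>1 the power (1−ξ²)^{p/(p−2)} has a negative base, is undefined in general, and the bound can fail (Σ empty, p=4, ξ=2); there the factor is read as max(0,1−ξ²)^{p/(p−2)}=0, while for ξ≤1 it is unchanged. *)

(* Defs.v *)
From HB Require Import structures.
From mathcomp Require Import all_boot all_order all_algebra.
From mathcomp Require Import ring.
From mathcomp Require Import all_classical all_reals all_analysis.
From mathcomp Require Import measurable_realfun.

Set Implicit Arguments.
Unset Strict Implicit.
Unset Printing Implicit Defensive.

Import Order.TTheory GRing.Theory Num.Theory.
Import numFieldNormedType.Exports.

Local Open Scope classical_set_scope.
Local Open Scope ring_scope.

Section quaternions.
Context {R : realType}.

Record quat := Quat { q_re : R ; q_i : R ; q_j : R ; q_k : R }.

HB.instance Definition _ := gen_eqMixin quat.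
HB.instance Definition _ := gen_choiceMixin quat.

Implicit Types (p q r : quat) (a b : R).

Definition addq p q :=
  Quat (q_re p + q_re q) (q_i p + q_i q) (q_j p + q_j q) (q_k p + q_k q).
Definition oppq q := Quat (- q_re q) (- q_i q) (- q_j q) (- q_k q).
Definition mulq p q := Quat
  (q_re p * q_re q - q_i p * q_i q - q_j p * q_j q - q_k p * q_k q)
  (q_re p * q_i q + q_i p * q_re q + q_j p * q_k q - q_k p * q_j q)
  (q_re p * q_j q - q_i p * q_k q + q_j p * q_re q + q_k p * q_i q)
  (q_re p * q_k q + q_i p * q_j q - q_j p * q_i q + q_k p * q_re q).
Definition scaleq a q := Quat (a * q_re q) (a * q_i q) (a * q_j q) (a * q_k q).

Fact addqA : associative addq.
Proof. by move=> [????] [????] [????]; congr Quat => /=; ring. Qed.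
Fact addqC : commutative addq.
Proof. by move=> [????] [????]; congr Quat => /=; ring. Qed.
Fact add0q : left_id (Quat 0 0 0 0) addq.
Proof. by move=> [????]; congr Quat => /=; ring. Qed.
Fact addNq : left_inverse (Quat 0 0 0 0) oppq addq.
Proof. by move=> [????]; congr Quat => /=; ring. Qed.

HB.instance Definition _ := GRing.isZmodule.Build quat addqA addqC add0q addNq.

Fact mulqA : associative mulq.
Proof. by move=> [????] [????] [????]; congr Quat => /=; ring. Qed.
Fact mul1q : left_id (Quat 1 0 0 0) mulq.
Proof. by move=> [????]; congr Quat => /=; ring. Qed.
Fact mulq1 : right_id (Quat 1 0 0 0) mulq.
Proof. by move=> [????]; congr Quat => /=; ring. Qed.
Fact mulqDl : left_distributive mulq +%R.
Proof. by move=> [????] [????] [????]; congr Quat => /=; ring. Qed.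
Fact mulqDr : right_distributive mulq +%R.
Proof. by move=> [????] [????] [????]; congr Quat => /=; ring. Qed.
Fact oneq_neq0 : Quat 1 0 0 0 != 0 :> quat.
Proof. by apply/eqP => -[/eqP]; rewrite oner_eq0. Qed.

HB.instance Definition _ := GRing.Zmodule_isNzRing.Build quat
  mulqA mul1q mulq1 mulqDl mulqDr oneq_neq0.

Fact scaleqA a b q : scaleq a (scaleq b q) = scaleq (a * b) q.
Proof. by congr Quat; rewrite /= mulrA. Qed.
Fact scale1q : left_id 1 scaleq.
Proof. by move=> [????]; congr Quat; rewrite /= mul1r. Qed.
Fact scaleqDr : right_distributive scaleq +%R.
Proof. by move=> a [????] [????]; congr Quat; rewrite /= mulrDr. Qed.
Fact scaleqDl q : {morph scaleq^~ q : a b / a + b}.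
Proof. by move=> a b; congr Quat; rewrite /= mulrDl. Qed.

HB.instance Definition _ := GRing.Zmodule_isLmodule.Build R quat
  scaleqA scale1q scaleqDr scaleqDl.

Definition qI : quat := Quat 0 1 0 0.
Definition qJ : quat := Quat 0 0 1 0.

Definition qconj q := Quat (q_re q) (- q_i q) (- q_j q) (- q_k q).
Definition qabs q : R :=
  Num.sqrt (q_re q ^+ 2 + q_i q ^+ 2 + q_j q ^+ 2 + q_k q ^+ 2).

(* e^{u theta} for a unit imaginary quaternion u *)
Definition qexp (u : quat) (theta : R) : quat := cos theta *: (1 : quat) + sin theta *: u.

End quaternions.
Arguments quat R : clear implicits.

(* The Borel sigma-algebra of R^n, generated by the n coordinates. *)
Section measurable_cV.
Context {R : realType} {n : nat}.

Let coord (i : 'I_n) (x : 'cV[R]_n) : measurableTypeR R := x i 0.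

Let cV0 : g_sigma_preimage coord set0.
Proof. exact: sigma_algebra0. Qed.
Let cVC A : g_sigma_preimage coord A -> g_sigma_preimage coord (~` A).
Proof. exact: sigma_algebraC. Qed.
Let cVU (F : (set 'cV[R]_n)^nat) : (forall i, g_sigma_preimage coord (F i)) ->
  g_sigma_preimage coord (\bigcup_i F i).
Proof. exact: sigma_algebra_bigcup. Qed.

HB.instance Definition _ := @isMeasurable.Build default_measure_display
  'cV[R]_n (g_sigma_preimage coord) cV0 cVC cVU.

End measurable_cV.

(* The sigma-finite instance of product measures in lebesgue_integral_fubini is
   shadowed by the one for subprobabilities, hence this lemma. *)
Lemma product_sigma_finite d1 d2 (T1 : measurableType d1)
    (T2 : measurableType d2) (R : realType)
    (m1 : {sigma_finite_measure set T1 -> \bar R})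
    (m2 : {sigma_finite_measure set T2 -> \bar R}) :
  sigma_finite setT (m1 \x m2)%E.
Proof.
have /sigma_finiteP[F [TF ndF Foo]] := sigma_finiteT m1.
have /sigma_finiteP[G [TG ndG Goo]] := sigma_finiteT m2.
exists (fun n => F n `*` G n).
  rewrite -setXTT TF TG predeqE => -[x y]; split.
    move=> [/= [n _ Fnx] [k _ Gky]]; exists (maxn n k) => //; split.
    - by move: x Fnx; exact/subsetPset/ndF/leq_maxl.
    - by move: y Gky; exact/subsetPset/ndG/leq_maxr.
  by move=> [n _ []/= ? ?]; split; exists n.
move=> k; have [? ?] := Foo k; have [? ?] := Goo k.
split; first exact: measurableX.
by rewrite product_measure1E// lte_mul_pinfty// ge0_fin_numE.
Qed.

Section lebesgue_cV.
Context {R : realType}.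

Definition vcons n (z : measurableTypeR R * 'cV[R]_n) : 'cV[R]_n.+1 :=
  col_mx (z.1%:M : 'M[R]_1) z.2.

Lemma measurable_vcoord n (i : 'I_n) :
  measurable_fun [set: 'cV[R]_n] (fun x => x i 0 : measurableTypeR R).
Proof.
move=> _ Y mY; rewrite setTI; apply: sub_sigma_algebra => /=.
rewrite -bigcup_seq/=; exists i => /=; first by rewrite mem_index_enum.
by exists Y => //; rewrite setTI.
Qed.

Lemma measurable_cVP d (T : measurableType d) n (g : T -> 'cV[R]_n) :
  (forall i, measurable_fun setT (fun x => g x i 0 : measurableTypeR R)) ->
  measurable_fun setT g.
Proof.
move=> mg _ Y; rewrite setTI.
pose G := [set A : set 'cV[R]_n | measurable (g @^-1` A)].
suff : g_sigma_preimage
    (fun (i : 'I_n) (x : 'cV[R]_n) => x i 0 : measurableTypeR R) `<=` G by exact.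
apply: smallest_sub.
  split; rewrite /G /=.
  - by rewrite preimage_set0.
  - by move=> A mA; rewrite setTD -preimage_setC; exact: measurableC.
  - by move=> F mF; rewrite preimage_bigcup; exact: bigcupT_measurable.
move=> A; rewrite -bigcup_seq/= => -[i _ [B mB <-]].
by rewrite /G/= setTI -[X in measurable X]setTI; exact: mg.
Qed.

Lemma measurable_vcons n : measurable_fun setT (@vcons n).
Proof.
apply: measurable_cVP => i.
case: (split_ordP (i : 'I_(1 + n))) => j ->.
- rewrite (_ : (fun _ => _) = fst) //; apply/funext => z /=.
  by rewrite /vcons (@col_mxEu R 1) (ord1 j) mxE eqxx.
- rewrite (_ : (fun _ => _) =
      (fun x : 'cV[R]_n => x j 0 : measurableTypeR R) \o snd).
    exact: measurableT_comp (measurable_vcoord j) measurable_snd.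
  by apply/funext => z /=; rewrite /vcons (@col_mxEd R 1).
Qed.

Definition vuncons n (x : 'cV[R]_n.+1) : measurableTypeR R * 'cV[R]_n :=
  (x ord0 0, \col_i x (lift ord0 i) 0).

Lemma vconsK n : cancel (@vcons n) (@vuncons n).
Proof.
move=> [a x]; rewrite /vuncons; congr pair.
  have -> : (ord0 : 'I_n.+1) = lshift n (ord0 : 'I_1) by exact: val_inj.
  by rewrite /vcons (@col_mxEu R 1) mxE eqxx.
apply/matrixP => i j; rewrite mxE (ord1 j).
have -> : lift ord0 i = rshift 1 i by exact: val_inj.
by rewrite /vcons (@col_mxEd R 1).
Qed.

Lemma measurable_vuncons n : measurable_fun setT (@vuncons n).
Proof.
apply/measurable_fun_pairP; split; first exact: measurable_vcoord.
apply: measurable_cVP => i.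
rewrite (_ : (fun _ => _) = fun x : 'cV[R]_n.+1 => x (lift ord0 i) 0).
  exact: measurable_vcoord.
by apply/funext => x /=; rewrite mxE.
Qed.

Definition lebesgue_vcons n (m : {sigma_finite_measure set 'cV[R]_n -> \bar R}) :=
  pushforward (@lebesgue_measure R \x m)%E (@vcons n).

Section instances.
Variables (n : nat) (m : {sigma_finite_measure set 'cV[R]_n -> \bar R}).

Fact lebesgue_vcons0 : lebesgue_vcons m set0 = 0%E.
Proof. by have mf := @measurable_vcons n; exact: measure0. Qed.
Fact lebesgue_vcons_ge0 A : (0 <= lebesgue_vcons m A)%E.
Proof. by have mf := @measurable_vcons n; exact: measure_ge0. Qed.
Fact lebesgue_vcons_sigma_additive : semi_sigma_additive (lebesgue_vcons m).
Proof. by have mf := @measurable_vcons n; exact: measure_semi_sigma_additive. Qed.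

HB.instance Definition _ := isMeasure.Build _ _ _ (lebesgue_vcons m)
  lebesgue_vcons0 lebesgue_vcons_ge0 lebesgue_vcons_sigma_additive.

Fact sigma_finite_vcons : sigma_finite setT (lebesgue_vcons m).
Proof.
have [F FT Foo] := product_sigma_finite (@lebesgue_measure R) m.
have preF i : @vcons n @^-1` (@vuncons n @^-1` F i) = F i.
  by apply/seteqP; split=> z /=; rewrite vconsK.
exists (fun i => @vuncons n @^-1` F i).
  by rewrite -preimage_bigcup -FT preimage_setT.
move=> i; split; last by rewrite /lebesgue_vcons /pushforward preF; apply: (Foo i).2.
by rewrite -[X in measurable X]setTI; apply: measurable_vuncons => //; exact: (Foo i).1.
Qed.

HB.instance Definition _ :=
  Measure_isSigmaFinite.Build _ _ _ (lebesgue_vcons m) sigma_finite_vcons.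

End instances.

Fixpoint lebesgue_cV n : {sigma_finite_measure set 'cV[R]_n -> \bar R} :=
  match n with
  | 0 => \d_(0 : 'cV[R]_0)
  | n'.+1 => lebesgue_vcons (lebesgue_cV n')
  end.

End lebesgue_cV.

Section shearlets.
Context {R : realType}.

Definition quat_measurable d (T : measurableType d) (F : T -> quat R) :=
  [/\ measurable_fun setT (q_re \o F), measurable_fun setT (q_i \o F),
      measurable_fun setT (q_j \o F) & measurable_fun setT (q_k \o F)].

Definition quat_integral d (T : measurableType d)
    (mu : {measure set T -> \bar R}) (F : T -> quat R) : quat R :=
  Quat (\int[mu]_x q_re (F x)) (\int[mu]_x q_i (F x))
       (\int[mu]_x q_j (F x)) (\int[mu]_x q_k (F x)).

Definition norm2 d (T : measurableType d) (mu : {measure set T -> \bar R})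
    (D : set T) (F : T -> quat R) : \bar R :=
  ((\int[mu]_(x in D) (qabs (F x) ^+ 2)%:E) `^ 2^-1)%E.

Definition L1 n (f : 'cV[R]_n -> quat R) :=
  quat_measurable f /\ (\int[lebesgue_cV n]_x (qabs (f x))%:E < +oo)%E.

Definition L2norm n (f : 'cV[R]_n -> quat R) : \bar R :=
  norm2 (lebesgue_cV n) setT f.

Definition L2 n (f : 'cV[R]_n -> quat R) :=
  quat_measurable f /\ (L2norm f < +oo)%E.

Definition ae_zero n (f : 'cV[R]_n -> quat R) :=
  {ae lebesgue_cV n, forall x, f x = 0}.

Definition dotv n (x y : 'cV[R]_n) : R := \sum_(i < n) x i 0 * y i 0.

(* A vector of R^{2n} is the stacking col_mx x y of x, y in R^n. *)
Definition QFT1 n (f : 'cV[R]_(n + n) -> quat R) (w : 'cV[R]_(n + n)) : quat R :=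
  quat_integral (lebesgue_cV (n + n)) (fun z =>
    qexp qI (- (2 * pi * dotv (usubmx w) (usubmx z))) * f z *
    qexp qJ (- (2 * pi * dotv (dsubmx w) (dsubmx z)))).

(* g is a value at f of the continuous extension to L2 of QFT1 on L1 n L2 *)
Definition is_QFT n (f g : 'cV[R]_(n + n) -> quat R) :=
  L2 g /\ exists h : nat -> 'cV[R]_(n + n) -> quat R,
    [/\ forall k, L1 (h k) /\ L2 (h k),
        (fun k => L2norm (fun x => h k x - f x)) @ \oo --> 0%E &
        (fun k => L2norm (fun w => QFT1 (h k) w - g w)) @ \oo --> 0%E].

(* An L2 function, determined up to a null set. *)
Definition QFT n (f : 'cV[R]_(n + n) -> quat R) : 'cV[R]_(n + n) -> quat R :=
  xget (fun _ => 0) [set g | is_QFT f g].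

(* From here on the dimension is 2n for the integer n.+1 >= 1: R^{2n} is
   'cV_(n.+1 + n.+1), and R^{2n-1} is 'cV_(n + n.+1). *)
Variable n : nat.
Local Notation V := 'cV[R]_(n.+1 + n.+1).
Local Notation W := 'cV[R]_(n + n.+1).
Local Notation N := (n.+1%:R : R).
Implicit Types (psi f : V -> quat R) (a : R) (s : W) (t : V).

Definition dilation_mx a : 'M[R]_(n.+1 + n.+1) :=
  block_mx (a%:M : 'M[R]_1) (0 : 'rV[R]_(n + n.+1)) (0 : W)
    ((Num.sg a * `|a| `^ (2 * N)^-1)%:M : 'M[R]_(n + n.+1)).

Definition shear_mx s : 'M[R]_(n.+1 + n.+1) :=
  block_mx (1%:M : 'M[R]_1) (s^T : 'rV[R]_(n + n.+1)) (0 : W)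
    (1%:M : 'M[R]_(n + n.+1)).

Definition shearlet psi a s t (x : V) : quat R :=
  `|a| `^ ((4 * N)^-1 - 1) *:
    psi (invmx (dilation_mx a) *m (invmx (shear_mx s) *m (x - t))).

Definition star psi (x : V) : quat R := qconj (psi (- x)).

(* The first coordinate of a vector of R^{2n}. *)
Definition fst_coord (w : V) : R := w (lshift n.+1 ord0) 0.

Definition Cpsi psi : \bar R :=
  (\int[lebesgue_cV (n.+1 + n.+1)]_w
     (qabs (QFT (star psi) w) ^+ 2 / `|fst_coord w| ^+ (2 * n.+1))%:E)%E.

Definition admissible psi := L2 psi /\ (Cpsi psi < +oo)%E.

Definition SH psi f (z : measurableTypeR R * W * V) : quat R :=
  quat_integral (lebesgue_cV (n.+1 + n.+1))
    (fun x => f x * qconj (shearlet psi z.1.1 z.1.2 z.2 x)).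

(* Triples (a, s, t) are taken in R x R^{2n-1} x R^{2n}; shear_dom is the actual
   parameter set R^* x R^{2n-1} x R^{2n}, and {a = 0} is null for shear_measure. *)
Definition shear_dom : set (measurableTypeR R * W * V) :=
  [set z | z.1.1 != 0 :> R].

Definition shear_density (z : measurableTypeR R * W * V) : R :=
  `|z.1.1 : R| ^- (2 * n.+1).+1.

(* Lebesgue measure da ds dt; its density for shear_measure is |a|^-(2n+1). *)
Definition lebesgue_params : {measure set (measurableTypeR R * W * V) -> \bar R} :=
  (@lebesgue_measure R \x lebesgue_cV (n + n.+1) \x lebesgue_cV (n.+1 + n.+1))%E.

Definition shear_measure (A : set (measurableTypeR R * W * V)) : \bar R :=
  (\int[lebesgue_params]_(z in A) (shear_density z)%:E)%E.

Fact density_measurable : measurable_fun setT (EFin \o shear_density).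
Proof.
apply/measurable_EFinP.
have -> : shear_density =
    (fun x : R => x `^ (- (2 * n.+1).+1%:R)) \o Num.norm \o fst \o fst.
  by apply/funext => z /=; rewrite /shear_density powRN powR_mulrn.
apply: measurableT_comp; last exact: measurable_fst.
apply: measurableT_comp; last exact: measurable_fst.
apply: measurableT_comp; last exact: normr_measurable.
exact: measurable_powR.
Qed.

Fact density_ge0 z : (0 <= (EFin \o shear_density) z)%E.
Proof. by rewrite lee_fin invr_ge0 exprn_ge0. Qed.

Fact shear_measure0 : shear_measure set0 = 0%E.
Proof. by rewrite /shear_measure integral_set0. Qed.
Fact shear_measure_ge0 A : (0 <= shear_measure A)%E.
Proof. by apply: integral_ge0 => z _; exact: density_ge0. Qed.
Fact shear_measure_sigma_additive : semi_sigma_additive shear_measure.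
Proof.
exact: (@semi_sigma_additive_nng_induced _ _ _ lebesgue_params
  (EFin \o shear_density) density_measurable density_ge0).
Qed.

HB.instance Definition _ := isMeasure.Build _ _ _ shear_measure
  shear_measure0 shear_measure_ge0 shear_measure_sigma_additive.

Definition concentrated (xi : R) (Sigma : set (measurableTypeR R * W * V))
    (F : measurableTypeR R * W * V -> quat R) :=
  (norm2 shear_measure (shear_dom `\` Sigma) F
    <= xi%:E * norm2 shear_measure shear_dom F)%E.

End shearlets.

(* Main.v *)
Require Import Defs.
From HB Require Import structures.
From mathcomp Require Import all_boot all_order all_algebra.
From mathcomp Require Import ring lra.
From mathcomp Require Import all_classical all_reals all_analysis.
From mathcomp Require Import measurable_realfun.

(** The transform satisfies an energy identity: for every [f] in L2, the integral
of [|SH psi f|^2] for the shear measure is [Cpsi psi * |f|^2]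
([energy_identity]).  By the Cauchy-Schwarz inequality [|SH psi f|^2] is bounded
pointwise by [|f|^2 |psi|^2] ([nq_SH_le]), so that concentration on [Sigma]
yields
[(1 - xi^2) Cpsi |f|^2 <= int_Sigma |SH psi f|^2 <= mu(Sigma) |f|^2 |psi|^2].
The exponent [p / (p - 2)] exceeds 1, hence [(1 - xi^2)^(p / (p - 2))] is at most
[1 - xi^2] when [xi <= 1], and the theorem follows on division by
[|f|^2 |psi|^2]; for [xi > 1] its left side is 0.  When no L2
function is a quaternion Fourier transform of [star psi], the value chosen for
this transform is 0, [Cpsi psi = 0], and the inequality is trivial.

The energy identity rests on the following ideas.

For fixed [a] and [s], the transform is, up to a power of [|a|], the convolution
in [t] of [f] with [k = star psi o M], where [M] inverts the shear-dilation
matrix ([SH_qconv]).  Since quaternions do not commute, the transform of a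
convolution is not a product.  The remedy is to add the contribution of [-a]:
the matrix changes sign with [a], so that [-a] yields the correlation of [f] and
[k], and in the sum of the two energies the products [f k] symmetrise
([qdot_mul_sym]).  Only the real autocorrelation of [f] survives, together with
[k] in the form of its cosine and sine transforms: if this autocorrelation is
the cosine transform of a density [m >= 0] (the predicate [bochner]), then
the two energies add up to [2 int m (|k_cos|^2 + |k_sin|^2)]
([convolution_energy]).

The cosine and sine transforms are recovered from the two-sided Fourier
transform by separating the even and odd parts in each half of the frequency
([parity_QFT1]), and summed over the four reflections of the halves their energy
is that of the Fourier transform itself ([parity_energy]).  Therefore they may be
replaced by the Fourier transform under an integral whose weight is even
([integral_penergy]), as is [1 / |lambda_1|^d] in dimension [d].  The identity
survives the passage from L1 to L2 ([conv_energy_limit]), as its left side depends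
continuously on [k], by Young's inequality, and its right side on the Fourier
transform of [k], because [m] is bounded.

Integrating over [s], then over [a], by Tonelli's theorem and linear changes of
variables, each frequency [l] contributes [m l] times the same integral [Cpsi]
([energy_bochner]).  Step functions have explicit densities [m], because the
Fourier transforms of boxes are explicit and their pairings reduce to integrals
of squared cardinal sines ([stepf_bochner]).  They are dense in L2
([step_functions_dense]), and the identity extends to L2 by Fatou's lemma and
continuity of the norms. *)

Set Implicit Arguments.
Unset Strict Implicit.
Unset Printing Implicit Defensive.

Import Order.TTheory GRing.Theory Num.Theory.
Import numFieldNormedType.Exports.

Local Open Scope classical_set_scope.
Local Open Scope ring_scope.

(** * Quaternion arithmetic *)

Section quaternion_norm.
Context {R : realType}.
Implicit Types (p q r : quat R) (a : R).

Lemma q_reD p q : q_re (p + q) = q_re p + q_re q. Proof. by []. Qed.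
Lemma q_iD p q : q_i (p + q) = q_i p + q_i q. Proof. by []. Qed.
Lemma q_jD p q : q_j (p + q) = q_j p + q_j q. Proof. by []. Qed.
Lemma q_kD p q : q_k (p + q) = q_k p + q_k q. Proof. by []. Qed.
Lemma q_reN p : q_re (- p) = - q_re p. Proof. by []. Qed.
Lemma q_iN p : q_i (- p) = - q_i p. Proof. by []. Qed.
Lemma q_jN p : q_j (- p) = - q_j p. Proof. by []. Qed.
Lemma q_kN p : q_k (- p) = - q_k p. Proof. by []. Qed.
Lemma q_reZ a q : q_re (a *: q) = a * q_re q. Proof. by []. Qed.
Lemma q_iZ a q : q_i (a *: q) = a * q_i q. Proof. by []. Qed.
Lemma q_jZ a q : q_j (a *: q) = a * q_j q. Proof. by []. Qed.
Lemma q_kZ a q : q_k (a *: q) = a * q_k q. Proof. by []. Qed.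
Lemma q_reM p q : q_re (p * q) =
  q_re p * q_re q - q_i p * q_i q - q_j p * q_j q - q_k p * q_k q.
Proof. by []. Qed.
Lemma q_iM p q : q_i (p * q) =
  q_re p * q_i q + q_i p * q_re q + q_j p * q_k q - q_k p * q_j q.
Proof. by []. Qed.
Lemma q_jM p q : q_j (p * q) =
  q_re p * q_j q - q_i p * q_k q + q_j p * q_re q + q_k p * q_i q.
Proof. by []. Qed.
Lemma q_kM p q : q_k (p * q) =
  q_re p * q_k q + q_i p * q_j q - q_j p * q_i q + q_k p * q_re q.
Proof. by []. Qed.

Definition quatE := (q_reD, q_iD, q_jD, q_kD, q_reN, q_iN, q_jN, q_kN,
  q_reZ, q_iZ, q_jZ, q_kZ, q_reM, q_iM, q_jM, q_kM).

(** The Euclidean scalar product, that is, the real part of [p] times the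
conjugate of [q]. *)
Definition qdot p q : R :=
  q_re p * q_re q + q_i p * q_i q + q_j p * q_j q + q_k p * q_k q.

Definition nq q := qdot q q.

Lemma quat_eqP p q : q_re p = q_re q -> q_i p = q_i q -> q_j p = q_j q ->
  q_k p = q_k q -> p = q.
Proof. by case: p q => [????] [????] /= -> -> -> ->. Qed.

Lemma qdotC p q : qdot p q = qdot q p. Proof. by rewrite /qdot; ring. Qed.

Lemma qdotDl p q r : qdot (p + q) r = qdot p r + qdot q r.
Proof. by rewrite /qdot !quatE; ring. Qed.

Lemma qdotZl a q r : qdot (a *: q) r = a * qdot q r.
Proof. by rewrite /qdot !quatE; ring. Qed.

Lemma qdot0l r : qdot 0 r = 0.
Proof. by rewrite /qdot /= !mul0r !addr0. Qed.

Lemma nq_ge0 q : 0 <= nq q.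
Proof. by rewrite /nq /qdot !addr_ge0// -expr2 sqr_ge0. Qed.

Lemma qabs_ge0 q : 0 <= qabs q. Proof. exact: sqrtr_ge0. Qed.

Lemma sqr_qabs q : qabs q ^+ 2 = nq q.
Proof. by rewrite /qabs sqr_sqrtr ?addr_ge0 ?sqr_ge0// /nq /qdot !expr2. Qed.

Lemma nqE q : nq q = q_re q ^+ 2 + q_i q ^+ 2 + q_j q ^+ 2 + q_k q ^+ 2.
Proof. by rewrite /nq /qdot !expr2. Qed.

Lemma qabsE q : qabs q = Num.sqrt (nq q). Proof. by rewrite nqE. Qed.

Lemma nqM p q : nq (p * q) = nq p * nq q.
Proof. by rewrite !nqE !quatE; ring. Qed.

Lemma qabsM p q : qabs (p * q) = qabs p * qabs q.
Proof. by rewrite !qabsE nqM sqrtrM// nq_ge0. Qed.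

Lemma nqN q : nq (- q) = nq q.
Proof. by rewrite !nqE !quatE; ring. Qed.

Lemma nqZ a q : nq (a *: q) = a ^+ 2 * nq q.
Proof. by rewrite !nqE !quatE; ring. Qed.

Lemma qabsN q : qabs (- q) = qabs q.
Proof. by rewrite !qabsE nqN. Qed.

Lemma nq_conj q : nq (qconj q) = nq q.
Proof. by rewrite !nqE /=; ring. Qed.

Lemma qabsZ a q : qabs (a *: q) = `|a| * qabs q.
Proof. by rewrite !qabsE nqZ sqrtrM ?sqr_ge0// sqrtr_sqr. Qed.

Lemma nq0 : nq (0 : quat R) = 0.
Proof. by rewrite nqE /= expr0n/= !addr0. Qed.

Lemma qabs0 : qabs (0 : quat R) = 0.
Proof. by rewrite qabsE nq0 sqrtr0. Qed.

Lemma nq_eq0 q : nq q = 0 -> q = 0.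
Proof.
rewrite nqE => h.
have := sqr_ge0 (q_re q); have := sqr_ge0 (q_i q).
have := sqr_ge0 (q_j q); have := sqr_ge0 (q_k q) => h1 h2 h3 h4.
by apply: quat_eqP; apply/eqP; rewrite -sqrf_eq0 eq_le; apply/andP;
  split => //; lra.
Qed.

Lemma nq_lagrange p q : nq p * nq q - qdot p q ^+ 2 =
  (q_re p * q_i q - q_i p * q_re q) ^+ 2 + (q_re p * q_j q - q_j p * q_re q) ^+ 2
  + (q_re p * q_k q - q_k p * q_re q) ^+ 2 + (q_i p * q_j q - q_j p * q_i q) ^+ 2
  + (q_i p * q_k q - q_k p * q_i q) ^+ 2 + (q_j p * q_k q - q_k p * q_j q) ^+ 2.
Proof. by rewrite !nqE /qdot; ring. Qed.

Lemma qdot_le p q : `|qdot p q| <= qabs p * qabs q.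
Proof.
rewrite -(@ler_pXn2r _ 2)// ?nnegrE ?mulr_ge0 ?qabs_ge0//.
rewrite real_normK ?num_real// exprMn !sqr_qabs -subr_ge0 nq_lagrange.
by rewrite !addr_ge0// sqr_ge0.
Qed.

Lemma qabs_comp q : [/\ `|q_re q| <= qabs q, `|q_i q| <= qabs q,
  `|q_j q| <= qabs q & `|q_k q| <= qabs q].
Proof.
have h x : x ^+ 2 <= nq q -> `|x| <= qabs q.
  move=> xq; rewrite -(@ler_pXn2r _ 2)// ?nnegrE ?qabs_ge0//.
  by rewrite real_normK ?num_real// sqr_qabs.
have := sqr_ge0 (q_re q); have := sqr_ge0 (q_i q).
have := sqr_ge0 (q_j q); have := sqr_ge0 (q_k q) => h1 h2 h3 h4.
by split; apply: h; rewrite nqE; lra.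
Qed.

(** A free weight [d] allows the coefficient of [nq p] to be as close to 1 as
wanted: the approximation arguments below need more than the factor 2 of [nqD_le]. *)
Lemma nqD_weight p q (d : R) : 0 < d ->
  nq (p + q) <= (1 + d) * nq p + (1 + d^-1) * nq q.
Proof.
move=> d0; rewrite -subr_ge0.
have -> : (1 + d) * nq p + (1 + d^-1) * nq q - nq (p + q) =
    d^-1 * nq (d *: p - q).
  by rewrite !nqE !quatE; field; rewrite gt_eqF.
by rewrite mulr_ge0 ?nq_ge0// invr_ge0 ltW.
Qed.

Lemma nqD_le p q : nq (p + q) <= 2 * nq p + 2 * nq q.
Proof. by have := @nqD_weight p q 1 ltr01; rewrite invr1. Qed.

Lemma nqD p q : nq (p + q) = nq p + nq q + 2 * qdot p q.
Proof. by rewrite !nqE /qdot !quatE; ring. Qed.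

Lemma qabsD p q : qabs (p + q) <= qabs p + qabs q.
Proof.
rewrite -(@ler_pXn2r _ 2)// ?nnegrE ?addr_ge0 ?qabs_ge0//.
rewrite sqrrD !sqr_qabs nqD.
have := le_trans (ler_norm _) (qdot_le p q).
by rewrite -mulr_natl; lra.
Qed.

(** The identity that makes up for the lack of commutativity: in the sum the
factors [f], [f'] separate from [k], [k'], which they do not in either term.  It
polarises the multiplicativity of [nq]. *)
Lemma qdot_mul_sym f f' k k' : qdot (f * k) (f' * k') + qdot (f' * k) (f * k') =
  2 * (qdot f f' * qdot k k').
Proof. by rewrite /qdot !quatE; ring. Qed.

End quaternion_norm.

(** * Measurability of quaternion-valued functions *)

Section quat_measurable_theory.
Context {R : realType} d (T : measurableType d).
Implicit Types (F G : T -> quat R) (u : T -> R).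

Lemma quat_measurableD F G : quat_measurable F -> quat_measurable G ->
  quat_measurable (fun x => F x + G x).
Proof.
by move=> [F1 F2 F3 F4] [G1 G2 G3 G4]; split; apply: measurable_funD.
Qed.

Lemma quat_measurableN F : quat_measurable F -> quat_measurable (fun x => - F x).
Proof. by move=> [F1 F2 F3 F4]; split; apply: measurable_funN. Qed.

Lemma quat_measurableB F G : quat_measurable F -> quat_measurable G ->
  quat_measurable (fun x => F x - G x).
Proof. by move=> mF mG; exact/quat_measurableD/quat_measurableN. Qed.

Lemma quat_measurableZ u F : measurable_fun setT u -> quat_measurable F ->
  quat_measurable (fun x => u x *: F x).
Proof. by move=> mu [F1 F2 F3 F4]; split; apply: measurable_funM. Qed.

Lemma quat_measurable_conj F : quat_measurable F ->
  quat_measurable (fun x => qconj (F x)).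
Proof. by move=> [F1 F2 F3 F4]; split => //; apply: measurable_funN. Qed.

Lemma quat_measurableM F G : quat_measurable F -> quat_measurable G ->
  quat_measurable (fun x => F x * G x).
Proof.
move=> [F1 F2 F3 F4] [G1 G2 G3 G4]; split.
- by apply: measurable_funB; [apply: measurable_funB; [apply: measurable_funB|]|];
    apply: measurable_funM.
- by apply: measurable_funB; [apply: measurable_funD; [apply: measurable_funD|]|];
    apply: measurable_funM.
- by apply: measurable_funD; [apply: measurable_funD; [apply: measurable_funB|]|];
    apply: measurable_funM.
- by apply: measurable_funD; [apply: measurable_funB; [apply: measurable_funD|]|];
    apply: measurable_funM.
Qed.

Lemma quat_measurable_cst (q : quat R) : quat_measurable (fun _ : T => q).
Proof. by split; apply: measurable_cst. Qed.

Lemma measurable_qdot F G : quat_measurable F -> quat_measurable G ->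
  measurable_fun setT (fun x => qdot (F x) (G x)).
Proof.
move=> [F1 F2 F3 F4] [G1 G2 G3 G4].
by do 3 (apply: measurable_funD; last by apply: measurable_funM);
  apply: measurable_funM.
Qed.

Lemma measurable_nq F : quat_measurable F -> measurable_fun setT (nq \o F).
Proof. by move=> mF; exact: measurable_qdot. Qed.

Lemma quat_measurable_qexp (u : quat R) (t : T -> R) : measurable_fun setT t ->
  quat_measurable (fun x => qexp u (t x)).
Proof.
move=> mt; apply: quat_measurableD; apply: quat_measurableZ; try exact: quat_measurable_cst.
  apply: measurableT_comp => //; apply: continuous_measurable_fun; exact: continuous_cos.
apply: measurableT_comp => //; apply: continuous_measurable_fun; exact: continuous_sin.
Qed.

Lemma measurable_qabs F : quat_measurable F -> measurable_fun setT (qabs \o F).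
Proof.
move=> mF.
have -> : qabs \o F = Num.sqrt \o (nq \o F) by apply/funext => x /=; exact: qabsE.
by apply: measurableT_comp; [by apply: continuous_measurable_fun; exact: sqrt_continuous|exact: measurable_nq].
Qed.

Lemma quat_measurable_sum (I : Type) (s : seq I) (F : I -> T -> quat R) :
  (forall i, quat_measurable (F i)) ->
  quat_measurable (fun x => \sum_(i <- s) F i x).
Proof.
move=> mF; elim: s => [|i s IH].
  rewrite (_ : (fun _ => _) = fun=> 0); first exact: quat_measurable_cst.
  by apply/funext => x; rewrite big_nil.
rewrite (_ : (fun _ => _) = fun x => F i x + \sum_(i <- s) F i x).
  exact: quat_measurableD.
by apply/funext => x; rewrite big_cons.
Qed.

End quat_measurable_theory.

Lemma quat_measurable_comp {R : realType} d d' (T : measurableType d)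
    (U : measurableType d') (F : U -> quat R) (g : T -> U) :
  quat_measurable F -> measurable_fun setT g -> quat_measurable (F \o g).
Proof.
by move=> [F1 F2 F3 F4] mg; split;
  [exact: measurableT_comp F1 mg|exact: measurableT_comp F2 mg
  |exact: measurableT_comp F3 mg|exact: measurableT_comp F4 mg].
Qed.

(** * Affine changes of variables *)

Section affine_line.
Context {R : realType}.
Local Notation mu := (@lebesgue_measure R).

Lemma measurable_affine (a b : R) :
  measurable_fun setT (fun x : measurableTypeR R => a * x + b : measurableTypeR R).
Proof.
by apply: measurable_funD.
Qed.

(** It suffices to compare, on half-open intervals, the Lebesgue measure with
[`|a|] times its image by the affine map. *)
Lemma ge0_integral_affine (a b : R) (F : measurableTypeR R -> \bar R) : a != 0 ->
  measurable_fun setT F -> (forall x, 0 <= F x)%E ->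
  (\int[mu]_x F (a * x + b)%R = `|a|^-1%:E * \int[mu]_x F x)%E.
Proof.
move=> a0 mF F0.
have mphi := measurable_affine a b.
pose phi := (fun x : measurableTypeR R => a * x + b : measurableTypeR R).
pose m' := mscale (NngNum (normr_ge0 a)) (pushforward mu phi).
pose m := m' mphi.
have E A : measurable A -> mu A = m A.
  move=> mA; apply: lebesgue_measure_unique mA => _ [[x y]] _ <-.
  change (mu `]x, y]%classic = (`|a|%:E * mu (phi @^-1` `]x, y]%classic))%E).
  have [a1|a1] := ltP 0 a.
    have -> : phi @^-1` `]x, y] = `](x - b) / a, (y - b) / a]%classic.
      apply/seteqP; split => z /=; rewrite !in_itv/= /phi => /andP[h1 h2].
        by rewrite ltr_pdivrMr// ler_pdivlMr// ltrBlDr lerBrDr mulrC h1 h2.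
      by move: h1 h2; rewrite ltr_pdivrMr// ler_pdivlMr// ltrBlDr lerBrDr mulrC => -> ->.
    rewrite !lebesgue_measure_itv/= !lte_fin.
    rewrite ltr_pM2r ?invr_gt0// ltrD2r gtr0_norm//.
    by case: ifP => _; rewrite ?mule0// -!EFinB -EFinM; congr (_%:E); field.
  (* For a negative factor the preimage is closed on the left instead. *)
  have {}a1 : a < 0 by rewrite lt_neqAle a0.
  have -> : phi @^-1` `]x, y] = `[(y - b) / a, (x - b) / a[%classic.
    apply/seteqP; split => z /=; rewrite !in_itv/= /phi => /andP[h1 h2].
      by rewrite ltr_ndivlMr// ler_ndivrMr// ltrBlDr lerBrDr mulrC h1 h2.
    by move: h1 h2; rewrite ltr_ndivlMr// ler_ndivrMr// ltrBlDr lerBrDr mulrC => -> ->.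
  rewrite !lebesgue_measure_itv/= !lte_fin.
  rewrite ltr_nM2r ?invr_lt0// ltrD2r ltr0_norm//.
  by case: ifP => _; rewrite ?mule0// -!EFinB -EFinM; congr (_%:E); field.
have -> : (\int[mu]_x F (a * x + b)%R = \int[pushforward mu phi]_x F x)%E.
  by rewrite (ge0_integral_pushforward mphi).
have -> : (\int[mu]_x F x = \int[m]_x F x)%E.
  by apply: eq_measure_integral => A mA _; exact: E.
by rewrite ge0_integral_mscale//= muleA -EFinM mulVf ?normr_eq0// mul1e.
Qed.

End affine_line.

Section cV_integrals.
Context {R : realType}.
Local Notation mu := (@lebesgue_measure R).
Local Notation nu := (@lebesgue_cV R).

Lemma vuncons_vcons n (x : 'cV[R]_n.+1) : vcons (vuncons x) = x.
Proof.
apply/matrixP => i j; rewrite (ord1 j) {j}.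
case: (split_ordP (i : 'I_(1 + n))) => j ->; rewrite /vcons /vuncons /=.
  rewrite (@col_mxEu R 1) (ord1 j) !mxE eqxx.
  by congr (x _ _); exact: val_inj.
rewrite (@col_mxEd R 1) mxE.
by congr (x _ _); exact: val_inj.
Qed.

Lemma vcons0 n (a : R) (x : 'cV[R]_n) : vcons (a, x) ord0 0 = a.
Proof. by have := congr1 fst (vconsK (a, x)). Qed.

Lemma vconsS n (a : R) (x : 'cV[R]_n) i : vcons (a, x) (lift ord0 i) 0 = x i 0.
Proof.
by have /(congr1 snd)/= /matrixP/(_ i 0) := vconsK (a, x); rewrite mxE.
Qed.

Lemma cV_ext n (x y : 'cV[R]_n) : (forall i, x i 0 = y i 0) -> x = y.
Proof. by move=> h; apply/matrixP => i j; rewrite (ord1 j). Qed.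

Lemma vcons_ext n (x y : 'cV[R]_n.+1) : x ord0 0 = y ord0 0 ->
  (forall i, x (lift ord0 i) 0 = y (lift ord0 i) 0) -> x = y.
Proof.
move=> h0 hS; apply: cV_ext => i.
by case: (unliftP ord0 i) => [j ->|->].
Qed.

Lemma ge0_integral_cV0 (F : 'cV[R]_0 -> \bar R) :
  (\int[nu 0]_x F x = F 0%R)%E.
Proof.
have -> : F = cst (F 0) by apply/funext => x /=; congr F; apply: cV_ext => -[].
by rewrite /= integral_cst//= diracT mule1.
Qed.

Lemma measurable_vconsr n d (T : measurableType d) (F : 'cV[R]_n.+1 -> T) (a : R) :
  measurable_fun setT F -> measurable_fun setT (fun x => F (vcons (a, x))).
Proof.
move=> mF; apply: (measurableT_comp mF).
exact: (measurableT_comp (@measurable_vcons R n) (pair1_measurable (a : measurableTypeR R))).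
Qed.

Lemma measurable_vconsl n d (T : measurableType d) (F : 'cV[R]_n.+1 -> T) x :
  measurable_fun setT F ->
  measurable_fun setT (fun a : measurableTypeR R => F (vcons (a, x))).
Proof.
move=> mF; apply: (measurableT_comp mF).
exact: (measurableT_comp (@measurable_vcons R n) (pair2_measurable _)).
Qed.

Section fubini.
Variables (n : nat) (F : 'cV[R]_n.+1 -> \bar R).
Hypotheses (mF : measurable_fun setT F) (F0 : forall x, (0 <= F x)%E).

Lemma ge0_integral_vcons :
  (\int[nu n.+1]_x F x = \int[mu \x nu n]_z F (vcons z))%E.
Proof.
by rewrite [LHS](ge0_integral_pushforward (@measurable_vcons R n))//; exact: mF.
Qed.

Let mFv : measurable_fun setT (F \o @vcons R n).
Proof. exact: (measurableT_comp mF (@measurable_vcons R n)). Qed.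

Lemma ge0_integral_cVS :
  (\int[nu n.+1]_x F x = \int[mu]_a \int[nu n]_x F (vcons (a, x)))%E.
Proof.
rewrite ge0_integral_vcons (fubini_tonelli1 (F \o @vcons R n))//.
by move=> z; exact: F0.
Qed.

Lemma ge0_integral_cVSr :
  (\int[nu n.+1]_x F x = \int[nu n]_x \int[mu]_a F (vcons (a, x)))%E.
Proof.
rewrite ge0_integral_vcons (fubini_tonelli2 (F \o @vcons R n))//.
by move=> z; exact: F0.
Qed.

Lemma measurable_ge0_integral_vconsl :
  measurable_fun setT (fun a : measurableTypeR R => \int[nu n]_x F (vcons (a, x)))%E.
Proof. by apply: (measurable_fun_fubini_tonelli_F (F \o @vcons R n)) => // z; exact: F0. Qed.

End fubini.

Definition aff n (s t : 'cV[R]_n) (x : 'cV[R]_n) : 'cV[R]_n :=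
  \col_i (s i 0 * x i 0 + t i 0).

Lemma measurable_aff n (s t : 'cV[R]_n) : measurable_fun setT (aff s t).
Proof.
apply: measurable_cVP => i.
rewrite (_ : (fun _ => _) =
  (fun y : measurableTypeR R => s i 0 * y + t i 0 : measurableTypeR R) \o
  (fun x : 'cV[R]_n => x i 0)).
  by apply: measurableT_comp; [exact: measurable_affine|exact: measurable_vcoord].
by apply/funext => x /=; rewrite mxE.
Qed.

Lemma aff_vcons n (s t : 'cV[R]_n.+1) a (x : 'cV[R]_n) :
  aff s t (vcons (a, x)) = vcons (s ord0 0 * a + t ord0 0,
    aff (vuncons s).2 (vuncons t).2 x).
Proof.
apply: vcons_ext => [|i]; first by rewrite mxE !vcons0.
by rewrite mxE !vconsS [in RHS]mxE [(vuncons s).2]lock [(vuncons t).2]lock -!lock !mxE.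
Qed.

(** Induction on the dimension, one coordinate at a time. *)
Theorem ge0_integral_aff n (s t : 'cV[R]_n) (F : 'cV[R]_n -> \bar R) :
  (forall i, s i 0 != 0) -> measurable_fun setT F -> (forall x, 0 <= F x)%E ->
  (\int[nu n]_x F (aff s t x) = (\prod_i `|s i 0|)^-1%:E * \int[nu n]_x F x)%E.
Proof.
elim: n s t F => [|n IH] s t F s0 mF F0.
  rewrite !ge0_integral_cV0 big_ord0 invr1 mul1e; congr F.
  by apply: cV_ext => -[].
have mFa : measurable_fun setT (fun x => F (aff s t x)).
  exact: (measurableT_comp mF (measurable_aff s t)).
rewrite ge0_integral_cVS// ge0_integral_cVS//.
have H a : (\int[nu n]_x F (aff s t (vcons (a, x))) =
   (\prod_(i < n) `|s (lift ord0 i) 0|)^-1%:E *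
   \int[nu n]_x F (vcons ((s ord0 0 * a + t ord0 0)%R, x)))%E.
  under eq_integral do rewrite aff_vcons.
  rewrite (IH _ _ (fun x => F (vcons ((s ord0 0 * a + t ord0 0)%R, x))))//.
  - by congr (_%:E * _)%E; congr (_^-1); apply: eq_bigr => i _; rewrite mxE.
  - by move=> i; rewrite mxE.
  - exact: measurable_vconsr.
under eq_integral do rewrite H.
pose G a := (\int[nu n]_x F (vcons (a, x)))%E.
have mG : measurable_fun setT (G : measurableTypeR R -> _).
  exact: measurable_ge0_integral_vconsl mF F0.
have G0 a : (0 <= G a)%E by exact: integral_ge0.
rewrite -[LHS]/(\int[mu]_a (_ * G (s ord0 0 * a + t ord0 0)%R))%E.
rewrite -[X in _ = (_ * X)%E]/(\int[mu]_a G a)%E.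
have mGa : measurable_fun setT (fun a : measurableTypeR R => G (s ord0 0 * a + t ord0 0)).
  exact: (measurableT_comp mG (measurable_affine _ _)).
have c0 : (0 <= (\prod_(i < n) `|s (lift ord0 i) 0|)^-1%:E)%E.
  by rewrite lee_fin invr_ge0 prodr_ge0.
have := @ge0_integralZl _ _ _ mu _ measurableT
  (fun a : measurableTypeR R => G (s ord0 0 * a + t ord0 0)) mGa _ (fun x _ => G0 _) c0.
move=> ->.
rewrite (ge0_integral_affine _ (s0 ord0) mG G0).
by rewrite muleA -EFinM -invfM big_ord_recl mulrC.
Qed.

End cV_integrals.

(** * Fubini's theorem for real-valued integrals *)

Section product_fubini.
Context {R : realType} {d1 d2} {T1 : measurableType d1} {T2 : measurableType d2}.
Variables (m1 : {sigma_finite_measure set T1 -> \bar R})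
  (m2 : {sigma_finite_measure set T2 -> \bar R}).

(** The product measure with its sigma-finite structure, which lets it serve as a
factor of further products. *)
Definition prodm : {sigma_finite_measure set (T1 * T2)%type -> \bar R} :=
  HB.pack (m1 \x m2)%E (Measure_isSigmaFinite.Build _ _ _ (m1 \x m2)%E
    (product_sigma_finite m1 m2)).

Variable F : (T1 * T2)%type -> R.
Hypothesis iF : prodm.-integrable setT (EFin \o F).

Let iF' : (m1 \x m2)%E.-integrable setT (EFin \o F) := iF.

Lemma Rintegral_prod12 :
  \int[m1]_x \int[m2]_y F (x, y) = \int[prodm]_z F z.
Proof.
rewrite /Rintegral -(integral12_prod_meas1 iF'); congr fine.
apply: ae_eq_integral => //.
- apply/measurable_EFinP; apply: (measurableT_comp (@fine_measurable R setT measurableT)).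
  exact: measurable_fubini_F iF'.
- exact: measurable_fubini_F iF'.
- apply: filterS (ae_integrable1 iF') => x ix _.
  by rewrite fineK//; exact: (integrable_fin_num _ ix).
Qed.

Lemma Rintegral_prod21 :
  \int[m2]_y \int[m1]_x F (x, y) = \int[prodm]_z F z.
Proof.
rewrite /Rintegral -(integral21_prod_meas1 iF'); congr fine.
apply: ae_eq_integral => //.
- apply/measurable_EFinP; apply: (measurableT_comp (@fine_measurable R setT measurableT)).
  exact: measurable_fubini_G iF'.
- exact: measurable_fubini_G iF'.
- apply: filterS (ae_integrable2 iF') => x ix _.
  by rewrite fineK//; exact: (integrable_fin_num _ ix).
Qed.

Lemma Rfubini : \int[m1]_x \int[m2]_y F (x, y) = \int[m2]_y \int[m1]_x F (x, y).
Proof. by rewrite Rintegral_prod12 Rintegral_prod21. Qed.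

Lemma integrable_Rfubini1 :
  m1.-integrable setT (EFin \o (fun x => \int[m2]_y F (x, y))).
Proof.
have := integrable_fubini_F iF'.
move=> /integrableP[mI oI]; apply/integrableP; split.
  apply/measurable_EFinP; apply: (measurableT_comp (@fine_measurable R setT measurableT)).
  exact: mI.
apply: le_lt_trans oI; apply: ge0_le_integral => //.
- apply: measurableT_comp => //; apply/measurable_EFinP.
  by apply: (measurableT_comp (@fine_measurable R setT measurableT)).
- exact: measurableT_comp.
- move=> x _ /=; rewrite /Rintegral /fubini_F.
  by case: (\int[m2]_y _)%E => [r| |] /=; rewrite ?normr0 ?leey ?lexx.
Qed.

Lemma integrable_Rfubini2 :
  m2.-integrable setT (EFin \o (fun y => \int[m1]_x F (x, y))).
Proof.
have iG : m2.-integrable setT (fun y => \int[m1]_x (F (x, y))%:E)%E.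
  have mG := measurable_fubini_G iF'.
  have mAF : measurable_fun setT (abse \o (EFin \o F)).
    by apply: measurableT_comp => //; exact: (measurable_int _ iF').
  apply/integrableP; split => //.
  have := (integrable21ltyP m1 m2 (measurable_int _ iF')).1 iF'.
  apply: le_lt_trans; apply: ge0_le_integral => //.
  - exact: measurableT_comp.
  - apply: (measurable_fun_fubini_tonelli_G (abse \o (EFin \o F))) => // z.
    exact: abse_ge0.
  - move=> y _; apply: le_abse_integral => //.
    by apply: (measurableT_comp (measurable_int _ iF')).
move/integrableP: iG => [mI oI]; apply/integrableP; split.
  apply/measurable_EFinP; apply: (measurableT_comp (@fine_measurable R setT measurableT)).
  exact: mI.
apply: le_lt_trans oI; apply: ge0_le_integral => //.
- apply: measurableT_comp => //; apply/measurable_EFinP.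
  by apply: (measurableT_comp (@fine_measurable R setT measurableT)).
- exact: measurableT_comp.
- move=> x _ /=; rewrite /Rintegral.
  by case: (\int[m1]_x _)%E => [r| |] /=; rewrite ?normr0 ?leey ?lexx.
Qed.

End product_fubini.

(** * Maps that scale a measure *)

Section scaling_maps.
Context {R : realType} {d} {T : measurableType d} (mu : {measure set T -> \bar R}).
Implicit Types (phi : T -> T) (c : R).

(** Change of variables by [phi], with a constant factor.  All the maps below are
composites of diagonal maps, translations and shears, so closure under
composition replaces a theory of determinants. *)
Definition scales phi c := [/\ measurable_fun setT phi, 0 < c &
  forall F : T -> \bar R, measurable_fun setT F -> (forall x, 0 <= F x)%E ->
  (\int[mu]_x F (phi x) = c%:E * \int[mu]_x F x)%E].

Lemma scales_comp phi psi c e : scales phi c -> scales psi e ->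
  scales (phi \o psi) (c * e).
Proof.
move=> [mphi c0 Hphi] [mpsi e0 Hpsi]; split.
- exact: measurableT_comp.
- exact: mulr_gt0.
- move=> F mF F0 /=.
  have mFp : measurable_fun setT (F \o phi) by exact: measurableT_comp.
  rewrite (Hpsi (F \o phi))//; last by move=> x; exact: F0.
  by rewrite /= Hphi// muleA -EFinM mulrC.
Qed.

(** The positive and negative parts scale separately; as [c] is positive, this is
compatible with infinite values of either part. *)
Lemma scales_integral phi c (F : T -> \bar R) : scales phi c ->
  measurable_fun setT F -> (\int[mu]_x F (phi x) = c%:E * \int[mu]_x F x)%E.
Proof.
move=> [mphi c0 Hphi] mF.
rewrite [LHS]integralE [in RHS]integralE.
have -> : (\int[mu]_x (fun x => F (phi x))^\+ x = c%:E * \int[mu]_x F^\+ x)%E.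
  rewrite -(Hphi _ (measurable_funepos mF)) => [|x]; last exact: funepos_ge0.
  by apply: eq_integral => x _; rewrite !funeposE.
have -> : (\int[mu]_x (fun x => F (phi x))^\- x = c%:E * \int[mu]_x F^\- x)%E.
  rewrite -(Hphi _ (measurable_funeneg mF)) => [|x]; last exact: funeneg_ge0.
  by apply: eq_integral => x _; rewrite !funenegE.
have : (0 <= \int[mu]_x F^\+ x)%E by exact: integral_ge0.
have : (0 <= \int[mu]_x F^\- x)%E by exact: integral_ge0.
move: (\int[mu]_x F^\+ x)%E (\int[mu]_x F^\- x)%E => [a| |] [b| |] // _ _.
- by rewrite -!EFinM -!EFinB mulrBr.
- by rewrite [(_ - +oo)%E]/= gt0_muley ?gt0_muleNy ?lte_fin.
- by rewrite [(+oo - _)%E]/= gt0_muley ?lte_fin.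
- by rewrite [(+oo - +oo)%E]/= gt0_muley ?gt0_muleNy ?lte_fin.
Qed.

Lemma scales_Rintegral phi c (F : T -> R) : scales phi c ->
  measurable_fun setT F -> \int[mu]_x F (phi x) = c * \int[mu]_x F x.
Proof.
move=> H mF; rewrite /Rintegral (scales_integral (F := EFin \o F) H); last first.
  exact/measurable_EFinP.
have [_ c0 _] := H.
case: (\int[mu]_x (EFin \o F) x)%E => //=.
- by rewrite gt0_muley ?lte_fin//= mulr0.
- by rewrite gt0_muleNy ?lte_fin//= mulr0.
Qed.

Lemma scales_integrable phi c (F : T -> R) : scales phi c ->
  mu.-integrable setT (EFin \o F) -> mu.-integrable setT (EFin \o (F \o phi)).
Proof.
move=> H /integrableP[mF iF]; have [mphi c0 Hphi] := H.
have mF' : measurable_fun setT F by exact/measurable_EFinP.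
apply/integrableP; split.
  by apply/measurable_EFinP; exact: measurableT_comp.
rewrite [X in (X < _)%E](_ : _ = c%:E * \int[mu]_x `|(EFin \o F) x|)%E.
  by rewrite lte_mul_pinfty// lee_fin ltW.
have mAF : measurable_fun setT (abse \o (EFin \o F)) by exact: measurableT_comp.
by rewrite -(Hphi _ mAF) => [|x]; last exact: abse_ge0.
Qed.

End scaling_maps.

Section scaling_cV.
Context {R : realType}.
Local Notation mu := (@lebesgue_measure R).
Local Notation nu := (@lebesgue_cV R).

Lemma scales_aff n (s t : 'cV[R]_n) : (forall i, s i 0 != 0) ->
  scales (nu n) (aff s t) (\prod_i `|s i 0|)^-1.
Proof.
move=> s0; split; first exact: measurable_aff.
- by rewrite invr_gt0 prodr_gt0// => i _; rewrite normr_gt0.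
- by move=> F mF F0; exact: ge0_integral_aff.
Qed.

Lemma scales_aff1 n (s t : 'cV[R]_n) : (forall i, `|s i 0| = 1) ->
  scales (nu n) (aff s t) 1.
Proof.
move=> s1; have := @scales_aff n s t.
under eq_bigr do rewrite s1.
rewrite big1// invr1; apply => i.
by rewrite -normr_eq0 s1 oner_eq0.
Qed.

Lemma scales_addr n (t : 'cV[R]_n) : scales (nu n) (fun x => x + t) 1.
Proof.
rewrite (_ : (fun x => _) = aff (const_mx 1) t).
  by apply: scales_aff1 => i; rewrite mxE normr1.
by apply/funext => x; apply: cV_ext => i; rewrite !mxE mul1r.
Qed.

Lemma scales_subl n (t : 'cV[R]_n) : scales (nu n) (fun x => t - x) 1.
Proof.
rewrite (_ : (fun x => _) = aff (const_mx (-1)) t).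
  by apply: scales_aff1 => i; rewrite mxE normrN normr1.
by apply/funext => x; apply: cV_ext => i; rewrite !mxE mulN1r addrC.
Qed.

Lemma measurable_dotv d (T : measurableType d) n (f g : T -> 'cV[R]_n) :
  measurable_fun setT f -> measurable_fun setT g ->
  measurable_fun setT (fun x => dotv (f x) (g x)).
Proof.
move=> mf mg; apply: measurable_sum => i.
by apply: measurable_funM; [exact: (measurableT_comp (measurable_vcoord i) mf)|
  exact: (measurableT_comp (measurable_vcoord i) mg)].
Qed.

(** The product by the unipotent matrix with first row [1, s^T]; [tshear] is the
product by its transpose. *)
Definition shear n (s : 'cV[R]_n) (x : 'cV[R]_n.+1) : 'cV[R]_n.+1 :=
  vcons (x ord0 0 + dotv s (vuncons x).2, (vuncons x).2).

Definition tshear n (s : 'cV[R]_n) (x : 'cV[R]_n.+1) : 'cV[R]_n.+1 :=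
  vcons (x ord0 0 : measurableTypeR R, (vuncons x).2 + x ord0 0 *: s).

Lemma measurable_vtail n : measurable_fun setT (fun x : 'cV[R]_n.+1 => (vuncons x).2).
Proof. exact: (measurableT_comp measurable_snd (@measurable_vuncons R n)). Qed.

Lemma measurable_vhead n :
  measurable_fun setT (fun x : 'cV[R]_n.+1 => x ord0 0 : measurableTypeR R).
Proof. exact: measurable_vcoord. Qed.

Lemma measurable_shear n (s : 'cV[R]_n) : measurable_fun setT (shear s).
Proof.
apply: (measurableT_comp (@measurable_vcons R n)).
apply: measurable_fun_pair; last exact: measurable_vtail.
apply: measurable_funD; first exact: measurable_vhead.
by apply: measurable_dotv; [exact: measurable_cst|exact: measurable_vtail].
Qed.

Lemma measurable_addv d (T : measurableType d) n (f g : T -> 'cV[R]_n) :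
  measurable_fun setT f -> measurable_fun setT g ->
  measurable_fun setT (fun x => f x + g x).
Proof.
move=> mf mg; apply: measurable_cVP => i.
rewrite (_ : (fun _ => _) = (fun x => f x i 0 + g x i 0)).
  by apply: measurable_funD; [exact: (measurableT_comp (measurable_vcoord i) mf)|
    exact: (measurableT_comp (measurable_vcoord i) mg)].
by apply/funext => x; rewrite mxE.
Qed.

Lemma measurable_scalev d (T : measurableType d) n (a : T -> R) (g : T -> 'cV[R]_n) :
  measurable_fun setT a -> measurable_fun setT g ->
  measurable_fun setT (fun x => a x *: g x).
Proof.
move=> ma mg; apply: measurable_cVP => i.
rewrite (_ : (fun _ => _) = (fun x => a x * g x i 0)).
  by apply: measurable_funM => //; exact: (measurableT_comp (measurable_vcoord i) mg).
by apply/funext => x; rewrite mxE.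
Qed.

Lemma measurable_subv d (T : measurableType d) n (f g : T -> 'cV[R]_n) :
  measurable_fun setT f -> measurable_fun setT g ->
  measurable_fun setT (fun x => f x - g x).
Proof.
move=> mf mg; rewrite (_ : (fun x => _) = (fun x => f x + (-1) *: g x)).
  by apply: measurable_addv => //; apply: measurable_scalev.
by apply/funext => x; rewrite scaleN1r.
Qed.

Lemma measurable_tshear n (s : 'cV[R]_n) : measurable_fun setT (tshear s).
Proof.
apply: (measurableT_comp (@measurable_vcons R n)).
apply: measurable_fun_pair; first exact: measurable_vhead.
apply: measurable_addv; first exact: measurable_vtail.
apply: measurable_scalev; first exact: measurable_vhead.
exact: measurable_cst.
Qed.

(** Integrating first in the first coordinate, a shear is a translation; the
transposed shear is one for the other coordinates. *)
Lemma scales_shear n (s : 'cV[R]_n) : scales (nu n.+1) (shear s) 1.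
Proof.
split => [||F mF F0]; [exact: measurable_shear|exact: ltr01|].
rewrite ge0_integral_cVSr//; last exact: measurableT_comp mF (measurable_shear s).
rewrite [in RHS]ge0_integral_cVSr// mul1e.
apply: eq_integral => x _.
have mFx := measurable_vconsl x mF.
have := ge0_integral_affine (dotv s x) (oner_neq0 R) mFx (fun a => F0 _).
rewrite normr1 invr1 mul1e => <-.
apply: eq_integral => a _; congr F.
by rewrite /shear vcons0 vconsK mul1r.
Qed.

Lemma scales_tshear n (s : 'cV[R]_n) : scales (nu n.+1) (tshear s) 1.
Proof.
split => [||F mF F0]; [exact: measurable_tshear|exact: ltr01|].
rewrite ge0_integral_cVS//; last exact: measurableT_comp mF (measurable_tshear s).
rewrite [in RHS]ge0_integral_cVS// mul1e.
apply: eq_integral => a _.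
have mFa := measurable_vconsr a mF.
have [_ _ /(_ _ mFa (fun x => F0 _))] := scales_addr (a *: s).
rewrite mul1e => <-.
apply: eq_integral => x _; congr F.
by rewrite /tshear vcons0 vconsK.
Qed.

End scaling_cV.

(** * Integrals of quaternion-valued functions *)

Lemma integrable_EFinP {R : realType} d (T : measurableType d)
    (mu : {measure set T -> \bar R}) (u : T -> R) :
  mu.-integrable setT (EFin \o u) <->
  measurable_fun setT u /\ (\int[mu]_x `|u x|%:E < +oo)%E.
Proof.
split=> [/integrableP[mu1 iu]|[mu1 iu]].
  by split => //; exact/measurable_EFinP.
by apply/integrableP; split => //; exact/measurable_EFinP.
Qed.

Lemma le_integrable_real {R : realType} d (T : measurableType d)
    (mu : {measure set T -> \bar R}) (u v : T -> R) :
  measurable_fun setT u -> (forall x, `|u x| <= v x) ->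
  mu.-integrable setT (EFin \o v) -> mu.-integrable setT (EFin \o u).
Proof.
move=> mu1 uv iv; apply: le_integrable iv => //.
  exact/measurable_EFinP.
move=> x _ /=; rewrite lee_fin; apply: le_trans (uv x) _.
exact: ler_norm.
Qed.

Lemma integrable_tensor {R : realType} d1 d2 (T1 : measurableType d1)
    (T2 : measurableType d2) (m1 : {sigma_finite_measure set T1 -> \bar R})
    (m2 : {sigma_finite_measure set T2 -> \bar R}) (u : T1 -> R) (v : T2 -> R) :
  m1.-integrable setT (EFin \o u) -> m2.-integrable setT (EFin \o v) ->
  (prodm m1 m2).-integrable setT (EFin \o (fun z => u z.1 * v z.2)).
Proof.
move=> /integrable_EFinP[mu iu] /integrable_EFinP[mv iv].
have mw : measurable_fun setT (fun z : T1 * T2 => u z.1 * v z.2).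
  by apply: measurable_funM; exact: measurableT_comp.
apply/integrableP; split; first exact/measurable_EFinP.
rewrite -[X in (X < _)%E]/(\int[(m1 \x m2)%E]_z `|(EFin \o (fun z : T1 * T2 => (u z.1 * v z.2)%R)) z|)%E.
rewrite (fubini_tonelli1 (fun z : T1 * T2 => (`|(u z.1 * v z.2)%R|%:E)%E)) => [||z].
- rewrite /fubini_F /=.
  rewrite (eq_integral (fun x => `|u x|%:E * \int[m2]_y `|v y|%:E))%E; last first.
    move=> x _; under eq_integral do rewrite normrM EFinM.
    rewrite ge0_integralZl//.
    by apply/measurable_EFinP; exact: measurableT_comp.
  rewrite ge0_integralZr//.
  + rewrite lte_mul_pinfty//.
      by rewrite integral_ge0// => x _; rewrite lee_fin.
    by rewrite ge0_fin_numE// integral_ge0// => x _; rewrite lee_fin.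
  + by apply/measurable_EFinP; exact: measurableT_comp.
  + by rewrite integral_ge0// => x _; rewrite lee_fin.
- by apply/measurable_EFinP; exact: measurableT_comp.
- by rewrite lee_fin.
Qed.

Section quat_integral_theory.
Context {R : realType} {d} {T : measurableType d}.
Variable mu : {measure set T -> \bar R}.
Implicit Types F G : T -> quat R.

Definition quat_integrable F :=
  quat_measurable F /\ (\int[mu]_x (qabs (F x))%:E < +oo)%E.

Lemma quat_integrable_qabs F : quat_integrable F ->
  mu.-integrable setT (EFin \o (qabs \o F)).
Proof.
move=> [mF iF]; apply/integrable_EFinP; split; first exact: measurable_qabs.
by under eq_integral do rewrite ger0_norm ?qabs_ge0//.
Qed.

Lemma le_quat_integrable F (v : T -> R) : quat_measurable F ->
  (forall x, qabs (F x) <= v x) -> mu.-integrable setT (EFin \o v) ->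
  quat_integrable F.
Proof.
move=> mF Fv iv; split => //.
have /integrable_EFinP[_] : mu.-integrable setT (EFin \o (qabs \o F)).
  apply: le_integrable_real iv; first exact: measurable_qabs.
  by move=> x /=; rewrite ger0_norm ?qabs_ge0.
by under eq_integral do rewrite ger0_norm ?qabs_ge0//.
Qed.

Lemma quat_integrable_comp F : quat_integrable F ->
  [/\ mu.-integrable setT (EFin \o (q_re \o F)),
      mu.-integrable setT (EFin \o (q_i \o F)),
      mu.-integrable setT (EFin \o (q_j \o F)) &
      mu.-integrable setT (EFin \o (q_k \o F))].
Proof.
move=> iF; have [[m1 m2 m3 m4] _] := iF; have iq := quat_integrable_qabs iF.
by split; apply: le_integrable_real iq => // x /=;
  have [h1 h2 h3 h4] := qabs_comp (F x).
Qed.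

Lemma quat_integrableD F G : quat_integrable F -> quat_integrable G ->
  quat_integrable (fun x => F x + G x).
Proof.
move=> iF iG; apply: (@le_quat_integrable _ (fun x => qabs (F x) + qabs (G x))).
- by apply: quat_measurableD; [exact: iF.1|exact: iG.1].
- by move=> x; exact: qabsD.
- by have := integrableD measurableT (quat_integrable_qabs iF) (quat_integrable_qabs iG).
Qed.

Lemma quat_integrableN F : quat_integrable F -> quat_integrable (fun x => - F x).
Proof.
move=> [mF iF]; split; first exact: quat_measurableN.
by under eq_integral do rewrite qabsN.
Qed.

Lemma quat_integrableB F G : quat_integrable F -> quat_integrable G ->
  quat_integrable (fun x => F x - G x).
Proof. by move=> iF iG; apply: quat_integrableD => //; exact: quat_integrableN. Qed.

Lemma quat_integrableZ F (u : T -> R) (c : R) : quat_integrable F ->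
  measurable_fun setT u -> (forall x, `|u x| <= c) ->
  quat_integrable (fun x => u x *: F x).
Proof.
move=> iF mu1 uc; apply: (@le_quat_integrable _ (fun x => c * qabs (F x))).
- by apply: quat_measurableZ => //; exact: iF.1.
- by move=> x; rewrite qabsZ ler_wpM2r// qabs_ge0.
- by have := integrableZl measurableT c (quat_integrable_qabs iF).
Qed.

Lemma quat_integrableMl F (p : quat R) : quat_integrable F ->
  quat_integrable (fun x => p * F x).
Proof.
move=> iF; apply: (@le_quat_integrable _ (fun x => qabs p * qabs (F x))).
- by apply: quat_measurableM; [exact: quat_measurable_cst|exact: iF.1].
- by move=> x; rewrite qabsM.
- by have := integrableZl measurableT (qabs p) (quat_integrable_qabs iF).
Qed.

Lemma quat_integrableMr F (p : quat R) : quat_integrable F ->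
  quat_integrable (fun x => F x * p).
Proof.
move=> iF; apply: (@le_quat_integrable _ (fun x => qabs p * qabs (F x))).
- by apply: quat_measurableM; [exact: iF.1|exact: quat_measurable_cst].
- by move=> x; rewrite qabsM mulrC.
- by have := integrableZl measurableT (qabs p) (quat_integrable_qabs iF).
Qed.

Lemma quat_integralD F G : quat_integrable F -> quat_integrable G ->
  quat_integral mu (fun x => F x + G x) = quat_integral mu F + quat_integral mu G.
Proof.
move=> /quat_integrable_comp[F1 F2 F3 F4] /quat_integrable_comp[G1 G2 G3 G4].
by apply: quat_eqP; rewrite quatE /=; apply: RintegralD.
Qed.

Lemma quat_integralN F : quat_integrable F ->
  quat_integral mu (fun x => - F x) = - quat_integral mu F.
Proof.
move=> /quat_integrable_comp[F1 F2 F3 F4].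
have h (u : T -> R) : mu.-integrable setT (EFin \o u) ->
    \int[mu]_x (- u x) = - \int[mu]_x u x.
  by move=> iu; under eq_Rintegral do rewrite -mulN1r; rewrite RintegralZl// mulN1r.
by apply: quat_eqP; rewrite quatE /=; apply: h.
Qed.

Lemma quat_integralB F G : quat_integrable F -> quat_integrable G ->
  quat_integral mu (fun x => F x - G x) = quat_integral mu F - quat_integral mu G.
Proof.
by move=> iF iG; rewrite quat_integralD ?quat_integralN//; exact: quat_integrableN.
Qed.

Lemma quat_integralZ F (a : R) : quat_integrable F ->
  quat_integral mu (fun x => a *: F x) = a *: quat_integral mu F.
Proof.
move=> /quat_integrable_comp[F1 F2 F3 F4].
by apply: quat_eqP; rewrite quatE /=; apply: RintegralZl.
Qed.

(** Testing against a fixed quaternion reduces identities between quaternion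
integrals to real ones, see [qdot_ext]. *)
Lemma qdot_quat_integral F (p : quat R) : quat_integrable F ->
  qdot p (quat_integral mu F) = \int[mu]_x qdot p (F x).
Proof.
move=> /quat_integrable_comp[F1 F2 F3 F4].
have Z (c : R) (u : T -> R) : mu.-integrable setT (EFin \o u) ->
  mu.-integrable setT (EFin \o (fun x => c * u x)).
  by move=> iu; have := integrableZl measurableT c iu.
have D (u v : T -> R) : mu.-integrable setT (EFin \o u) ->
  mu.-integrable setT (EFin \o v) -> mu.-integrable setT (EFin \o (fun x => u x + v x)).
  by move=> iu iv; have := integrableD measurableT iu iv.
rewrite /qdot RintegralD//; [|by do 2 (apply: (D); last exact: Z); exact: Z|exact: Z].
rewrite RintegralD//; [|by apply: D; exact: Z|exact: Z].
by rewrite RintegralD//; [|exact: Z|exact: Z]; rewrite !RintegralZl.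
Qed.

Lemma qdot_ext (p q : quat R) : (forall r, qdot r p = qdot r q) -> p = q.
Proof.
move=> h; have := h (Quat 1 0 0 0); have := h (Quat 0 1 0 0).
have := h (Quat 0 0 1 0); have := h (Quat 0 0 0 1); rewrite /qdot /=.
by rewrite !(mul0r, mul1r, add0r, addr0) => *; exact: quat_eqP.
Qed.

(** Left multiplication is moved to the test quaternion, as its adjoint. *)
Lemma quat_integralMl F (p : quat R) : quat_integrable F ->
  quat_integral mu (fun x => p * F x) = p * quat_integral mu F.
Proof.
move=> iF; apply: qdot_ext => r.
rewrite qdot_quat_integral; last exact: quat_integrableMl.
have adj q : qdot r (p * q) = qdot (qconj p * r) q.
  by rewrite /qdot !quatE /=; ring.
by under eq_Rintegral do rewrite adj; rewrite adj qdot_quat_integral.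
Qed.

Lemma quat_integralMr F (p : quat R) : quat_integrable F ->
  quat_integral mu (fun x => F x * p) = quat_integral mu F * p.
Proof.
move=> iF; apply: qdot_ext => r.
rewrite qdot_quat_integral; last exact: quat_integrableMr.
have adj q : qdot r (q * p) = qdot (r * qconj p) q.
  by rewrite /qdot !quatE /=; ring.
by under eq_Rintegral do rewrite adj; rewrite adj qdot_quat_integral.
Qed.

Lemma eq_quat_integral F G : F =1 G -> quat_integral mu F = quat_integral mu G.
Proof. by move=> /funext ->. Qed.

(** The norm of the integral [q] is attained by testing against [q] itself. *)
Lemma qabs_quat_integral F : quat_integrable F ->
  qabs (quat_integral mu F) <= \int[mu]_x qabs (F x).
Proof.
move=> iF; set q := quat_integral mu F.
have [q0|q0] := leP (qabs q) 0.
  by apply: le_trans q0 _; apply: Rintegral_ge0 => x _; exact: qabs_ge0.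
rewrite -(ler_pM2l q0) -expr2 sqr_qabs {1}/nq qdot_quat_integral//.
rewrite -RintegralZl//; last exact: quat_integrable_qabs.
have iq : mu.-integrable setT (EFin \o (fun x => qabs q * qabs (F x))).
  by have := integrableZl measurableT (qabs q) (quat_integrable_qabs iF).
apply: le_Rintegral => //.
  apply: le_integrable_real iq; last by move=> x; exact: qdot_le.
  by apply: measurable_qdot; [exact: quat_measurable_cst|exact: iF.1].
by move=> x _; apply: le_trans (qdot_le _ _); exact: ler_norm.
Qed.

End quat_integral_theory.

(** This turns the squared norm of an integral into a double integral. *)
Lemma qdot_quat_integral2 {R : realType} d (T : measurableType d)
    (mu : {sigma_finite_measure set T -> \bar R}) (F G : T -> quat R) :
  quat_integrable mu F -> quat_integrable mu G ->
  (prodm mu mu).-integrable setT (EFin \o (fun z => qdot (F z.1) (G z.2))) /\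
  qdot (quat_integral mu F) (quat_integral mu G) =
    \int[prodm mu mu]_z qdot (F z.1) (G z.2).
Proof.
move=> iF iG.
have i2 : (prodm mu mu).-integrable setT (EFin \o (fun z => qdot (F z.1) (G z.2))).
  apply: (le_integrable_real _ _ (integrable_tensor (quat_integrable_qabs iF)
    (quat_integrable_qabs iG))).
    by apply: measurable_qdot;
     [exact: quat_measurable_comp iF.1 measurable_fst
     |exact: quat_measurable_comp iG.1 measurable_snd].
  by move=> z; exact: qdot_le.
split => //; rewrite -Rintegral_prod12//.
transitivity (\int[mu]_x qdot (F x) (quat_integral mu G)).
  by rewrite qdotC qdot_quat_integral//; apply: eq_Rintegral => x _; exact: qdotC.
by apply: eq_Rintegral => x _ /=; exact: qdot_quat_integral.
Qed.

(** * Square-integrable quaternion-valued functions *)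

Section square_integrals.
Context {R : realType} {d} {T : measurableType d}.
Variable mu : {measure set T -> \bar R}.
Implicit Types F G : T -> quat R.

(** The square of the L2 norm, which spares square roots. *)
Definition nq2 F := (\int[mu]_x (nq (F x))%:E)%E.

Lemma nq2_ge0 F : (0 <= nq2 F)%E.
Proof. by apply: integral_ge0 => x _; rewrite lee_fin nq_ge0. Qed.

Lemma nq2N F : nq2 (fun x => - F x) = nq2 F.
Proof. by rewrite /nq2; under eq_integral do rewrite nqN. Qed.

Lemma nq2_fin F : (nq2 F < +oo)%E -> nq2 F \is a fin_num.
Proof. by rewrite ge0_fin_numE// nq2_ge0. Qed.

Lemma nq2_integrable F : quat_measurable F -> (nq2 F < +oo)%E ->
  mu.-integrable setT (EFin \o (nq \o F)).
Proof.
move=> mF iF; apply/integrable_EFinP; split; first exact: measurable_nq.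
by under eq_integral do rewrite ger0_norm ?nq_ge0//.
Qed.

Lemma nq2D F G : quat_measurable F -> quat_measurable G ->
  (nq2 (fun x => F x + G x)%R <= 2%:E * nq2 F + 2%:E * nq2 G)%E.
Proof.
move=> mF mG; rewrite /nq2.
have m1 := measurable_nq mF; have m2 := measurable_nq mG.
have m1' : measurable_fun setT (fun x => (nq (F x))%:E) by exact/measurable_EFinP.
have m2' : measurable_fun setT (fun x => (nq (G x))%:E) by exact/measurable_EFinP.
rewrite -!ge0_integralZl//; try by move=> x _; rewrite lee_fin nq_ge0.
rewrite -ge0_integralD//.
- apply: ge0_le_integral => //.
  + by move=> x _; rewrite lee_fin nq_ge0.
  + by apply/measurable_EFinP; apply: measurable_nq; exact: quat_measurableD.
  + by apply: emeasurable_funD; exact: measurable_funeM.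
  + by move=> x _; rewrite -!EFinM -EFinD lee_fin; exact: nqD_le.
- by move=> x _; rewrite mule_ge0// lee_fin ?nq_ge0.
- exact: measurable_funeM.
- by move=> x _; rewrite mule_ge0// lee_fin ?nq_ge0.
- exact: measurable_funeM.
Qed.

Lemma nq2Z (c : R) F : quat_measurable F ->
  (nq2 (fun x => c *: F x)%R = (c ^+ 2)%:E * nq2 F)%E.
Proof.
move=> mF; rewrite /nq2; under eq_integral do rewrite nqZ EFinM.
rewrite ge0_integralZl//.
- by apply/measurable_EFinP; exact: measurable_nq.
- by move=> x _; rewrite lee_fin nq_ge0.
- by rewrite lee_fin sqr_ge0.
Qed.

Lemma nq_dist_le (p q : quat R) (e : R) : 0 < e ->
  `|nq p - nq q| <= e * nq q + (1 + e^-1) * nq (p - q).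
Proof.
move=> e0.
have h1 := nqD_weight q (p - q) e0; rewrite (addrC q) subrK in h1.
have h2 : 0 <= e^-1 * nq (e *: q + (p - q)).
  by rewrite mulr_ge0 ?nq_ge0// invr_ge0 ltW.
have E : e^-1 * nq (e *: q + (p - q)) =
    e * nq q + e^-1 * nq (p - q) + 2 * qdot q (p - q).
  by rewrite !nqE /qdot !quatE; field; rewrite gt_eqF.
have h3 : nq p = nq q + nq (p - q) + 2 * qdot q (p - q).
  by rewrite -nqD addrC subrK.
have h4 := nq_ge0 (p - q).
rewrite ler_norml; apply/andP; split; rewrite E in h2; lra.
Qed.

(** Continuity of the squared norm in the form suited to [approx_eq]: the error is a
small multiple of [nq2 F] plus a large multiple of the square distance. *)
Lemma nq2_dist F G (e : R) : 0 < e -> quat_measurable F -> quat_measurable G ->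
  (nq2 F < +oo)%E -> (nq2 (fun x => G x - F x)%R < +oo)%E ->
  (nq2 G < +oo)%E /\ `|fine (nq2 G) - fine (nq2 F)| <=
    e * fine (nq2 F) + (1 + e^-1) * fine (nq2 (fun x => G x - F x)).
Proof.
move=> e0 mF mG iF iGF.
have mGF : quat_measurable (fun x => G x - F x) by exact: quat_measurableB.
have iG : (nq2 G < +oo)%E.
  rewrite (_ : G = fun x => (G x - F x) + F x); last first.
    by apply/funext => x; rewrite subrK.
  apply: le_lt_trans (nq2D mGF mF) _.
  by apply: lte_add_pinfty; rewrite lte_mul_pinfty// lee_fin.
split => //.
have jF := nq2_integrable mF iF; have jG := nq2_integrable mG iG.
have jGF := nq2_integrable mGF iGF.
have jD := integrableB measurableT jG jF.
have z1 := integrableZl measurableT e jF.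
have z2 := integrableZl measurableT (1 + e^-1) jGF.
have -> : fine (nq2 G) - fine (nq2 F) = \int[mu]_x (nq (G x) - nq (F x)).
  by rewrite RintegralB.
apply: le_trans (le_normr_Rintegral measurableT jD) _.
have -> : e * fine (nq2 F) + (1 + e^-1) * fine (nq2 (fun x => G x - F x)) =
    \int[mu]_x (e * nq (F x) + (1 + e^-1) * nq (G x - F x)).
  by rewrite RintegralD//; rewrite ?RintegralZl.
apply: le_Rintegral => //.
- exact: integrable_norm jD.
- by have := integrableD measurableT z1 z2.
- by move=> x _; exact: nq_dist_le.
Qed.

End square_integrals.

(** * The integral of the squared cardinal sine *)

Section sinc.
Context {R : realType}.
Local Notation mu := (@lebesgue_measure R).

Lemma normr_sin_le (x : R) : `|sin x| <= `|x|.
Proof.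
have H (y : R) : 0 <= y -> `|sin y| <= y.
  move=> y0.
  have [c _] := @MVT_segment R sin cos 0 y y0 (fun x _ => is_derive_sin x)
    (continuous_subspaceT (@continuous_sin R)).
  rewrite sin0 !subr0 => ->; rewrite normrM (ger0_norm y0) ler_piMl//.
  exact: cos_max.
have [x0|x0] := leP 0 x; first by rewrite (ger0_norm x0) H.
by rewrite -normrN -sinN (ltr0_norm x0) H// oppr_ge0 ltW.
Qed.

(** The squared modulus of the Fourier transform, at [l], of the indicator of an
interval of length [w]; it reads 0 at [l = 0]. *)
Definition sinc2 (w l : R) : R := sin (pi * (w * l)) ^+ 2 / (pi * l) ^+ 2.

Lemma sinc2_ge0 w l : 0 <= sinc2 w l.
Proof. by rewrite mulr_ge0 ?invr_ge0 ?sqr_ge0. Qed.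

Lemma sinc2_le w l : sinc2 w l <= w ^+ 2.
Proof.
rewrite /sinc2; have [->|l0] := eqVneq l 0.
  by rewrite !mulr0 sin0 expr0n/= mul0r sqr_ge0.
have pl0 : 0 < (pi * l) ^+ 2.
  by rewrite exprn_even_gt0//= mulf_neq0// gt_eqF// pi_gt0.
rewrite ler_pdivrMr// -exprMn mulrCA -[leLHS]real_normK ?num_real//.
rewrite -[leRHS]real_normK ?num_real// ler_pXn2r ?nnegrE//.
exact: normr_sin_le.
Qed.

Lemma measurable_sinR d (T : measurableType d) (u : T -> R) :
  measurable_fun setT u -> measurable_fun setT (fun x => sin (u x)).
Proof.
move=> mf; apply: measurableT_comp => //.
by apply: continuous_measurable_fun; exact: continuous_sin.
Qed.

Lemma measurable_cosR d (T : measurableType d) (u : T -> R) :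
  measurable_fun setT u -> measurable_fun setT (fun x => cos (u x)).
Proof.
move=> mf; apply: measurableT_comp => //.
by apply: continuous_measurable_fun; exact: continuous_cos.
Qed.

Lemma measurable_sqrV d (T : measurableType d) (u : T -> R) :
  measurable_fun setT u -> measurable_fun setT (fun x => (u x ^+ 2)^-1).
Proof.
move=> mf; rewrite (_ : (fun _ => _) = (fun x => (u x ^+ 2) `^ (-1))).
  by apply: (measurableT_comp (@measurable_powR R (-1))); exact: measurable_funX.
by apply/funext => x; rewrite powR_inv1// sqr_ge0.
Qed.

Lemma measurable_invR d (T : measurableType d) (u : T -> R) :
  measurable_fun setT u -> measurable_fun setT (fun x => (u x)^-1).
Proof.
move=> mf; rewrite (_ : (fun _ => _) = (fun x => u x * (u x ^+ 2)^-1)).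
  by apply: measurable_funM => //; exact: measurable_sqrV.
apply/funext => x; have [->|u0] := eqVneq (u x) 0; first by rewrite mul0r invr0.
by field.
Qed.

Lemma measurable_sinc2 w : measurable_fun setT (sinc2 w : measurableTypeR R -> R).
Proof.
apply: measurable_funM.
  apply: measurable_funX; apply: measurable_sinR.
  by apply: measurable_funM => //; exact: mulrl_measurable.
by apply: measurable_sqrV; exact: mulrl_measurable.
Qed.

Lemma integrable_Cauchy_kernel :
  mu.-integrable setT (EFin \o (fun x : measurableTypeR R => (1 + x ^+ 2)^-1)).
Proof.
have mg : measurable_fun setT (fun x : measurableTypeR R => (1 + x ^+ 2)^-1 : R).
  by apply: measurable_invR; apply: measurable_funD => //; exact: measurable_funX.
have mg' : measurable_fun setT (fun x : measurableTypeR R => ((1 + x ^+ 2)^-1)%:E : \bar R).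
  exact/measurable_EFinP.
have g0 (x : R) : 0 <= (1 + x ^+ 2)^-1 by rewrite invr_ge0 addr_ge0// sqr_ge0.
apply/integrable_EFinP; split => //.
under eq_integral do rewrite ger0_norm//.
rewrite -(setUv `[0%R, +oo[%classic) ge0_integral_setU//=; last 4 first.
- exact: measurableC.
- by rewrite setUv.
- by move=> x _; rewrite lee_fin.
- by rewrite disj_set2E setICr.
have H : (\int[mu]_(x in `[0%R, +oo[) ((1 + x ^+ 2)^-1)%:E < +oo)%E.
  by have := @integral0y_oneDsqr R; rewrite /oneDsqr => ->; rewrite ltry.
apply: lte_add_pinfty => //; apply: le_lt_trans H.
(* By evenness the negative half-line contributes as much as the positive one. *)
have -> : (\int[mu]_(x in `[0%R, +oo[) ((1 + x ^+ 2)^-1)%:E =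
           \int[mu]_(x in `]-oo, 0%R]) ((1 + x ^+ 2)^-1)%:E)%E.
  rewrite ge0_integration_by_substitution0//.
  by apply: eq_integral => x _; rewrite sqrrN.
apply: ge0_subset_integral => //.
- exact: measurableC.
- exact: measurable_funS mg'.
- by move=> x _; rewrite lee_fin.
- by move=> x /=; rewrite !in_itv/= andbT => /negP; rewrite -ltNge => /ltW.
Qed.

(** Domination by twice the Cauchy density: the function is at most 1 and at
most [(pi l)^-2]. *)
Lemma integrable_sinc2_1 : mu.-integrable setT (EFin \o (sinc2 1 : measurableTypeR R -> R)).
Proof.
have := integrableZl measurableT 2 integrable_Cauchy_kernel.
apply: le_integrable_real; first exact: measurable_sinc2.
move=> l /=; rewrite ger0_norm ?sinc2_ge0//.
have [->|l0] := eqVneq l 0.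
  by rewrite /sinc2 !mulr0 sin0 expr0n/= mul0r addr0 invr1 mulr1.
have p1 : 1 <= pi ^+ 2 :> R.
  by rewrite -[leLHS](expr1n _ 2) ler_pXn2r ?nnegrE ?pi_ge0// (le_trans _ (pi_ge2 R))// ler1n.
have l2 : 0 < l ^+ 2 by rewrite exprn_even_gt0.
have h1 : sinc2 1 l <= 1 by have := sinc2_le 1 l; rewrite expr1n.
have h2 : sinc2 1 l * l ^+ 2 <= 1.
  have : sin (pi * (1 * l)) ^+ 2 <= 1.
    by rewrite -[leLHS]real_normK ?num_real// expr_le1// sin_max.
  have -> : sinc2 1 l * l ^+ 2 = sin (pi * (1 * l)) ^+ 2 / pi ^+ 2.
    rewrite /sinc2; move: (lt0r_neq0 (pi_gt0 R)); move: (pi : R) => P P0.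
    by field; rewrite P0 l0.
  move=> h; rewrite ler_pdivrMr; first by rewrite [leRHS]mul1r; exact: le_trans h p1.
  by rewrite (lt_le_trans _ p1).
rewrite ler_pdivlMr; last by rewrite addr_gt0.
lra.
Qed.

(** This constant is kept symbolic: it divides out of the spectral densities. *)
Definition sincI : R := \int[mu]_l sinc2 1 l.

Lemma sincIE : (\int[mu]_l (sinc2 1 l)%:E = sincI%:E)%E.
Proof. by rewrite /sincI /Rintegral fineK//; exact: (integrable_fin_num _ integrable_sinc2_1). Qed.

Lemma sincI_gt0 : 0 < sincI.
Proof.
rewrite lt_neqAle eq_sym; apply/andP; split; last first.
  by apply: Rintegral_ge0 => x _; exact: sinc2_ge0.
apply/eqP => J0.
have mf : measurable_fun setT (EFin \o (sinc2 1 : measurableTypeR R -> R)).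
  by apply/measurable_EFinP; exact: measurable_sinc2.
have : (\int[mu]_l `|(EFin \o sinc2 1) l| = 0)%E.
  under eq_integral do rewrite /= ger0_norm ?sinc2_ge0//.
  by rewrite sincIE J0.
move/(ae_eq_integral_abs mu measurableT mf) => [N [mN N0 sN]].
have : (mu `]0%R, 1%R[%classic <= mu N)%E.
  apply: le_measure; rewrite ?inE// => l; rewrite /= in_itv/= => /andP[l0 l1].
  apply: sN => /(_ Logic.I) /= [] /eqP; apply/negP; rewrite mulf_neq0//.
    rewrite sqrf_eq0 mul1r gt_eqF// sin_gt0_pi// mulr_gt0 ?pi_gt0//=.
    by rewrite gtr_pMr ?pi_gt0.
  by rewrite invr_neq0// sqrf_eq0 mulf_neq0// gt_eqF// pi_gt0.
by rewrite N0 lebesgue_measure_itv/= lte_fin ltr01 oppr0 addr0 lee_fin ler10.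
Qed.

(** Substitution of [l / w] for [l]. *)
Lemma integral_sinc2 w : mu.-integrable setT (EFin \o (sinc2 w : measurableTypeR R -> R)) /\
  \int[mu]_l sinc2 w l = `|w| * sincI.
Proof.
suff H : (\int[mu]_l (sinc2 w l)%:E = (`|w| * sincI)%:E)%E.
  split; last by rewrite /Rintegral H.
  apply/integrable_EFinP; split; first exact: measurable_sinc2.
  by under eq_integral do rewrite ger0_norm ?sinc2_ge0//; rewrite H ltry.
have [->|w0] := eqVneq w 0.
  rewrite normr0 mul0r; under eq_integral do rewrite /sinc2 mul0r mulr0 sin0 expr0n/= mul0r.
  by rewrite integral0.
have E l : (sinc2 w l)%:E = ((w ^+ 2)%:E * (sinc2 1 (w * l + 0))%:E)%E.
  rewrite -EFinM; congr (_%:E); rewrite /sinc2 addr0 mul1r.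
  have [->|l0] := eqVneq l 0; first by rewrite !mulr0 sin0 expr0n/= !mul0r mulr0.
  move: (lt0r_neq0 (pi_gt0 R)); move: (pi : R) => P P0.
  by field; rewrite w0 P0 l0.
have m1 : measurable_fun setT (fun l : measurableTypeR R => (sinc2 1 l)%:E).
  by apply/measurable_EFinP; exact: measurable_sinc2.
under eq_integral do rewrite E.
rewrite ge0_integralZl//; last 3 first.
- exact: (measurableT_comp m1 (measurable_affine w 0)).
- by move=> l _; rewrite lee_fin sinc2_ge0.
- by rewrite lee_fin sqr_ge0.
rewrite (ge0_integral_affine 0 w0 m1); last by move=> l; rewrite lee_fin sinc2_ge0.
rewrite sincIE -!EFinM; congr (_%:E); rewrite mulrA; congr (_ * _).
by rewrite -[w ^+ 2]real_normK ?num_real// expr2 mulfK// normr_eq0.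
Qed.

End sinc.

(** * Fourier transforms of intervals *)

Section box_kernel_line.
Context {R : realType}.
Local Notation mu := (@lebesgue_measure R).
Implicit Types (a p l z w : R).

(** Complex numbers are pairs of reals, because their components are integrated
separately. *)
Definition cmul (x y : R * R) : R * R :=
  (x.1 * y.1 - x.2 * y.2, x.1 * y.2 + x.2 * y.1).
Definition cconj (x : R * R) : R * R := (x.1, - x.2).
Definition cis (t : R) : R * R := (cos t, sin t).

(** The absolute value makes every pair [(a, p)] an interval; half-open intervals
are stable under intersection. *)
Definition ind1 a p (x : R) : R := ((a < x) && (x <= a + `|p|))%:R.

(** The integral of [e^(2 i pi l x)] over the interval [(a, p)], with the value 0 at
[l = 0]. *)
Definition ft1 a p l : R * R :=
  ((sin (2 * pi * l * (a + `|p|)) - sin (2 * pi * l * a)) / (2 * pi * l),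
   (cos (2 * pi * l * a) - cos (2 * pi * l * (a + `|p|))) / (2 * pi * l)).

Definition ker1 a p a' p' z l : R * R :=
  cmul (cmul (ft1 a p l) (cconj (ft1 a' p' l))) (cis (2 * pi * (l * z))).

Lemma sinc2_cos w l : sinc2 w l = (1 - cos (2 * pi * l * w)) / (2 * (pi * l) ^+ 2).
Proof.
rewrite /sinc2 -[2 * pi * l * w](_ : pi * (w * l) + pi * (w * l) = _); last by ring.
rewrite cosD; have := cos2Dsin2 (pi * (w * l)).
move: (cos _) (sin _) => c s cs.
rewrite [1 - _](_ : _ = 2 * s ^+ 2); last by rewrite -!expr2; lra.
by rewrite -[RHS]mulf_div divff ?mul1r// pnatr_eq0.
Qed.

Let invD l : (2 * (pi * l) ^+ 2)^-1 = 2 * (2 * pi * l)^-1 ^+ 2.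
Proof.
have [->|l0] := eqVneq l 0; first by rewrite !mulr0 expr0n/= mulr0 invr0 expr0n/= mulr0.
move: (lt0r_neq0 (pi_gt0 R)); move: (pi : R) => P P0.
by field; rewrite l0 P0.
Qed.

(** Product-to-sum formulas turn the real part of a product of two transforms into
squared cardinal sines at the differences of the endpoints, the integrals of which are
known. *)
Lemma ker1_re a p a' p' z l : let b := a + `|p| in let b' := a' + `|p'| in
  (ker1 a p a' p' z l).1 = 2^-1 *
  (sinc2 (b - a' + z) l + sinc2 (a - b' + z) l - sinc2 (b - b' + z) l - sinc2 (a - a' + z) l).
Proof.
move=> b b'; rewrite !sinc2_cos /ker1 /cmul /cconj /ft1 /cis /= -/b -/b'.
have E x y : 2 * pi * l * (x - y + z) =
  (2 * pi * l * x - 2 * pi * l * y) + 2 * pi * (l * z) by ring.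
rewrite !E !(cosD, sinD, cosN, sinN) invD; move: (2 * pi * l)^-1 => D.
move: (cos _) (sin _) (cos (2 * pi * l * b)) (sin (2 * pi * l * b)) => ca sa cb sb.
move: (cos (_ * a')) (sin (_ * a')) (cos (2 * pi * l * b')) (sin (2 * pi * l * b')) => ca' sa' cb' sb'.
move: (cos _) (sin _) => cz sz.
by field.
Qed.

Lemma nft1 a p l : (ft1 a p l).1 ^+ 2 + (ft1 a p l).2 ^+ 2 = sinc2 `|p| l.
Proof.
rewrite sinc2_cos /ft1 /=.
have -> : 2 * pi * l * `|p| = 2 * pi * l * (a + `|p|) - 2 * pi * l * a by ring.
rewrite cosB invD; move: (2 * pi * l)^-1 => D.
have := cos2Dsin2 (2 * pi * l * a); have := cos2Dsin2 (2 * pi * l * (a + `|p|)).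
set ca := cos (_ * a); set sa := sin (_ * a).
set cb := cos _; set sb := sin _; move: ca sa cb sb => ca sa cb sb h1 h2.
have -> : 1 - (cb * ca + sb * sa) = 2^-1 * ((sa - sb) ^+ 2 + (cb - ca) ^+ 2).
  by lra.
by field.
Qed.

Lemma measurable_ft1 a p :
  measurable_fun setT (fun l : measurableTypeR R => (ft1 a p l).1) /\
  measurable_fun setT (fun l : measurableTypeR R => (ft1 a p l).2).
Proof.
have m c : measurable_fun setT (fun l : measurableTypeR R => 2 * pi * l * c : R).
  by apply: measurable_funM => //; exact: mulrl_measurable.
have mi : measurable_fun setT (fun l : measurableTypeR R => (2 * pi * l)^-1 : R).
  by apply: measurable_invR; exact: mulrl_measurable.
by split; apply: measurable_funM => //; apply: measurable_funB;
  first [apply: measurable_sinR|apply: measurable_cosR].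
Qed.

Lemma measurable_cmul d (T : measurableType d) (u v : T -> R * R) :
  measurable_fun setT (fun x => (u x).1) -> measurable_fun setT (fun x => (u x).2) ->
  measurable_fun setT (fun x => (v x).1) -> measurable_fun setT (fun x => (v x).2) ->
  measurable_fun setT (fun x => (cmul (u x) (v x)).1) /\
  measurable_fun setT (fun x => (cmul (u x) (v x)).2).
Proof.
by move=> *; split; [apply: measurable_funB|apply: measurable_funD];
  apply: measurable_funM.
Qed.

Lemma measurable_ker d (T : measurableType d) (u v : T -> R * R) (t : T -> R) :
  measurable_fun setT (fun x => (u x).1) -> measurable_fun setT (fun x => (u x).2) ->
  measurable_fun setT (fun x => (v x).1) -> measurable_fun setT (fun x => (v x).2) ->
  measurable_fun setT t ->
  measurable_fun setT (fun x => (cmul (cmul (u x) (cconj (v x))) (cis (t x))).1) /\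
  measurable_fun setT (fun x => (cmul (cmul (u x) (cconj (v x))) (cis (t x))).2).
Proof.
move=> u1 u2 v1 v2 mt.
have [c1 c2] : measurable_fun setT (fun x => (cmul (u x) (cconj (v x))).1) /\
  measurable_fun setT (fun x => (cmul (u x) (cconj (v x))).2).
  by apply: measurable_cmul => //; exact: measurable_funN.
by apply: measurable_cmul => //; [exact: measurable_cosR|exact: measurable_sinR].
Qed.

Lemma ker_bound (u v : R * R) t :
  `|(cmul (cmul u (cconj v)) (cis t)).1| <=
     (u.1 ^+ 2 + u.2 ^+ 2) + (v.1 ^+ 2 + v.2 ^+ 2) /\
  `|(cmul (cmul u (cconj v)) (cis t)).2| <=
     (u.1 ^+ 2 + u.2 ^+ 2) + (v.1 ^+ 2 + v.2 ^+ 2).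
Proof.
have E : (cmul (cmul u (cconj v)) (cis t)).1 ^+ 2 +
  (cmul (cmul u (cconj v)) (cis t)).2 ^+ 2 =
  (u.1 ^+ 2 + u.2 ^+ 2) * (v.1 ^+ 2 + v.2 ^+ 2) * (cos t ^+ 2 + sin t ^+ 2).
  by rewrite /=; ring.
rewrite cos2Dsin2 mulr1 in E.
move: (_.1) (_.2) E => x y.
have : 0 <= u.1 ^+ 2 + u.2 ^+ 2 by rewrite addr_ge0 ?sqr_ge0.
have : 0 <= v.1 ^+ 2 + v.2 ^+ 2 by rewrite addr_ge0 ?sqr_ge0.
move: (u.1 ^+ 2 + u.2 ^+ 2) (v.1 ^+ 2 + v.2 ^+ 2) => A B B0 A0 E.
have h w w' : w ^+ 2 + w' ^+ 2 = A * B -> `|w| <= A + B.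
  move=> e; rewrite -(@ler_pXn2r _ 2)// ?nnegrE ?addr_ge0//.
  rewrite real_normK ?num_real//; have := sqr_ge0 w'; nra.
by split; [exact: h E|rewrite addrC in E; exact: h E].
Qed.

(** The length of the intersection of two intervals, as a combination of distances
of endpoints; the shape is that of [ker1_re]. *)
Lemma integral_ind1 a p a' p' z :
  mu.-integrable setT (EFin \o (fun t : measurableTypeR R => ind1 a p t * ind1 a' p' (t + z))) /\
  \int[mu]_t (ind1 a p t * ind1 a' p' (t + z)) =
  let b := a + `|p| in let b' := a' + `|p'| in
  2^-1 * (`|b - a' + z| + `|a - b' + z| - `|b - b' + z| - `|a - a' + z|).
Proof.
pose lo := Num.max a (a' - z); pose hi := Num.min (a + `|p|) (a' + `|p'| - z).
have E t : ind1 a p t * ind1 a' p' (t + z) = \1_(`]lo, hi]%classic) t.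
  rewrite /ind1 indicE -natrM mulnb; congr (_%:R); congr nat_of_bool.
  rewrite (_ : (t \in `]lo, hi]%classic) = (t \in `]lo, hi])); last first.
    by rewrite mem_setE.
  rewrite in_itv/= /lo /hi gt_max le_min ltrBlDr lerBrDr.
  by rewrite andbACA.
have mE : measurable (`]lo, hi]%classic : set (measurableTypeR R)) by [].
have fE : (mu `]lo, hi]%classic < +oo)%E.
  rewrite lebesgue_measure_itv/=; case: ifP => _; last exact: ltry.
  by rewrite -EFinB ltry.
have iE : mu.-integrable setT (EFin \o (\1_(`]lo, hi]%classic : set (measurableTypeR R)) : _ -> R)).
  apply/integrable_EFinP; split; first exact: measurable_indic.
  rewrite (eq_integral (fun x => (\1_(`]lo, hi]%classic : set (measurableTypeR R)) x)%:E)).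
    by rewrite integral_indic// setIT.
  by move=> x _; rewrite ger0_norm// indicE.
split.
  by rewrite (_ : (fun _ => _) = (\1_(`]lo, hi]%classic : set (measurableTypeR R)) : _ -> R))//; apply/funext.
under eq_Rintegral do rewrite E.
rewrite /Rintegral integral_indic// setIT [X in fine X = _]lebesgue_measure_itv/=.
have b0 := normr_ge0 p; have b0' := normr_ge0 p'.
rewrite lte_fin (fun_if fine) /= /lo /hi.
move: `|p| `|p'| b0 b0' => P P' b0 b0'.
have -> : `|a - a' + z| = 2 * Num.max a (a' - z) - a - (a' - z).
  by case: (leP a (a' - z)) => h; [rewrite ler0_norm|rewrite gtr0_norm]; lra.
have -> : `|a + P - (a' + P') + z| =
    a + P + (a' + P' - z) - 2 * Num.min (a + P) (a' + P' - z).
  by case: (leP (a + P) (a' + P' - z)) => h; [rewrite ler0_norm|rewrite gtr0_norm]; lra.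
have [h1|h1] := leP a (a' - z); have [h2|h2] := leP (a + P) (a' + P' - z);
  case: ltP => h; case: (ger0P (a + P - a' + z)) => ?;
  case: (ger0P (a - (a' + P') + z)) => ?; lra.
Qed.

(** Plancherel's formula for two intervals.  The real parts agree because both sides
are the same combination of distances of endpoints; the imaginary part is odd. *)
Lemma integral_ker1 a p a' p' z :
  [/\ mu.-integrable setT (EFin \o (fun l : measurableTypeR R => (ker1 a p a' p' z l).1)),
      mu.-integrable setT (EFin \o (fun l : measurableTypeR R => (ker1 a p a' p' z l).2)),
      \int[mu]_l (ker1 a p a' p' z l).1 =
        sincI * \int[mu]_t (ind1 a p t * ind1 a' p' (t + z)) &
      \int[mu]_l (ker1 a p a' p' z l).2 = 0].
Proof.
have [m1 m2] := measurable_ft1 a p; have [m1' m2'] := measurable_ft1 a' p'.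
have mt : measurable_fun setT (fun l : measurableTypeR R => 2 * pi * (l * z) : R).
  by apply: measurable_funM => //; exact: mulrr_measurable.
have [mk1 mk2] := measurable_ker m1 m2 m1' m2' mt.
have iS w := (integral_sinc2 w).1.
have iB := integrableD measurableT (iS `|p|) (iS `|p'|).
have bnd l : `|(ker1 a p a' p' z l).1| <= sinc2 `|p| l + sinc2 `|p'| l /\
             `|(ker1 a p a' p' z l).2| <= sinc2 `|p| l + sinc2 `|p'| l.
  by rewrite -(nft1 a) -(nft1 a'); exact: ker_bound.
have i1 : mu.-integrable setT (EFin \o (fun l : measurableTypeR R => (ker1 a p a' p' z l).1)).
  by apply: le_integrable_real iB => // l; have [] := bnd l.
have i2 : mu.-integrable setT (EFin \o (fun l : measurableTypeR R => (ker1 a p a' p' z l).2)).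
  by apply: le_integrable_real iB => // l; have [] := bnd l.
split => //.
- under eq_Rintegral do rewrite ker1_re.
  set b := a + `|p|; set b' := a' + `|p'|.
  pose S w := sinc2 w : measurableTypeR R -> R.
  have D (u v : measurableTypeR R -> R) : mu.-integrable setT (EFin \o u) ->
    mu.-integrable setT (EFin \o v) -> mu.-integrable setT (EFin \o (fun x => u x + v x)).
    by move=> iu iv; have := integrableD measurableT iu iv.
  have B (u v : measurableTypeR R -> R) : mu.-integrable setT (EFin \o u) ->
    mu.-integrable setT (EFin \o v) -> mu.-integrable setT (EFin \o (fun x => u x - v x)).
    by move=> iu iv; have := integrableB measurableT iu iv.
  have j1 := D _ _ (iS (b - a' + z)) (iS (a - b' + z)).
  have j2 := B _ _ j1 (iS (b - b' + z)).
  have j3 := B _ _ j2 (iS (a - a' + z)).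
  rewrite RintegralZl// RintegralB// RintegralB// RintegralD//.
  rewrite (integral_ind1 a p a' p' z).2 !(integral_sinc2 _).2 /= -/b -/b'.
  by ring.
(* The imaginary part is odd, so its integral equals its opposite. *)
- have H := scales_Rintegral (phi := fun x : measurableTypeR R => -1 * x + 0 : measurableTypeR R) (c := 1) (mu := mu).
  have sc : scales mu (fun x : measurableTypeR R => -1 * x + 0 : measurableTypeR R) 1.
    split => [||F mF F0]; [exact: measurable_affine|exact: ltr01|].
    have := ge0_integral_affine 0 (_ : -1 != 0 :> R) mF F0.
    by rewrite normrN normr1 invr1; apply; rewrite oppr_eq0 oner_eq0.
  have := H _ sc mk2; rewrite mul1r.
  have -> : \int[mu]_x (ker1 a p a' p' z (-1 * x + 0)).2 =
      \int[mu]_x (-1 * (ker1 a p a' p' z x).2).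
    apply: eq_Rintegral => l _; rewrite addr0 mulN1r /ker1 /cmul /cconj /ft1 /cis /=.
    rewrite !(mulrN, mulNr) !(cosN, sinN) invrN.
    by ring.
  by rewrite RintegralZl// => /eqP; rewrite mulN1r eq_sym -addr_eq0 -mulr2n mulrn_eq0 => /eqP.
Qed.

End box_kernel_line.

(** * Fourier transforms of boxes *)

Section Rintegral_cV.
Context {R : realType}.
Local Notation mu := (@lebesgue_measure R).
Local Notation nu := (@lebesgue_cV R).

Lemma integral_vcons n (F : 'cV[R]_n.+1 -> \bar R) : measurable_fun setT F ->
  (\int[nu n.+1]_x F x = \int[prodm mu (nu n)]_z F (vcons z))%E.
Proof.
move=> mF; rewrite integralE [RHS]integralE.
rewrite (ge0_integral_vcons (measurable_funepos mF)); last by move=> x; exact: funepos_ge0.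
rewrite (ge0_integral_vcons (measurable_funeneg mF)); last by move=> x; exact: funeneg_ge0.
by congr (_ - _)%E; apply: eq_integral => z _; rewrite ?funeposE ?funenegE.
Qed.

Lemma Rintegral_vcons n (F : 'cV[R]_n.+1 -> R) : measurable_fun setT F ->
  \int[nu n.+1]_x F x = \int[prodm mu (nu n)]_z F (vcons z).
Proof.
by move=> mF; rewrite /Rintegral integral_vcons//; exact/measurable_EFinP.
Qed.

Lemma integrable_vcons n (F : 'cV[R]_n.+1 -> R) : measurable_fun setT F ->
  (prodm mu (nu n)).-integrable setT (EFin \o (fun z => F (vcons z))) ->
  (nu n.+1).-integrable setT (EFin \o F).
Proof.
move=> mF /integrable_EFinP[_ iF]; apply/integrable_EFinP; split => //.
rewrite integral_vcons//; apply/measurable_EFinP.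
exact: measurableT_comp.
Qed.

Lemma Rintegral_tensor d1 d2 (T1 : measurableType d1)
    (T2 : measurableType d2) (m1 : {sigma_finite_measure set T1 -> \bar R})
    (m2 : {sigma_finite_measure set T2 -> \bar R}) (u : T1 -> R) (v : T2 -> R) :
  m1.-integrable setT (EFin \o u) -> m2.-integrable setT (EFin \o v) ->
  \int[prodm m1 m2]_z (u z.1 * v z.2) = \int[m1]_x u x * \int[m2]_y v y.
Proof.
move=> iu iv; rewrite -Rintegral_prod12/=; last exact: integrable_tensor.
rewrite -RintegralZr//; apply: eq_Rintegral => x _.
by rewrite RintegralZl.
Qed.

Lemma Rintegral_cV0 (F : 'cV[R]_0 -> R) : \int[nu 0]_x F x = F 0.
Proof.
have -> : F = cst (F 0) by apply/funext => x /=; congr F; apply: cV_ext => -[].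
rewrite /Rintegral (_ : (\int[_]_x _)%E = (F 0)%:E)//.
by have := ge0_integral_cV0; rewrite /= integral_cst//= diracT mule1.
Qed.

Lemma integrable_cV0 (F : 'cV[R]_0 -> R) : (nu 0).-integrable setT (EFin \o F).
Proof.
have -> : F = cst (F 0) by apply/funext => x /=; congr F; apply: cV_ext => -[].
apply/integrable_EFinP; split; first exact: measurable_cst.
by rewrite ge0_integral_cV0 ltry.
Qed.

End Rintegral_cV.

Section box_kernel.
Context {R : realType}.
Local Notation mu := (@lebesgue_measure R).
Local Notation nu := (@lebesgue_cV R).

Definition boxf n (a p x : 'cV[R]_n) : R := \prod_i ind1 (a i 0) (p i 0) (x i 0).

(** The tensor product of the transforms of the sides of the box. *)
Fixpoint boxft n : 'cV[R]_n -> 'cV[R]_n -> 'cV[R]_n -> R * R :=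
  match n with
  | 0 => fun _ _ _ => (1, 0)
  | n'.+1 => fun a p l =>
      cmul (ft1 (a ord0 0) (p ord0 0) (l ord0 0))
        (boxft (vuncons a).2 (vuncons p).2 (vuncons l).2)
  end.

Definition boxker n (a p a' p' z l : 'cV[R]_n) : R * R :=
  cmul (cmul (boxft a p l) (cconj (boxft a' p' l))) (cis (2 * pi * dotv l z)).

Lemma dotv_vcons n (l z : 'cV[R]_n.+1) :
  dotv l z = l ord0 0 * z ord0 0 + dotv (vuncons l).2 (vuncons z).2.
Proof.
rewrite /dotv big_ord_recl; congr (_ + _).
by apply: eq_bigr => i _; rewrite !mxE.
Qed.

Lemma boxft_vcons n (a p : 'cV[R]_n.+1) l0 (l : 'cV[R]_n) :
  boxft a p (vcons (l0, l)) =
  cmul (ft1 (a ord0 0) (p ord0 0) l0) (boxft (vuncons a).2 (vuncons p).2 l).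
Proof.
have := vconsK (l0, l); move: (vcons _) (vcons0 l0 l) => v <- /(congr1 snd) /= <-.
by [].
Qed.

Lemma boxker_vcons n (a p a' p' z : 'cV[R]_n.+1) l0 (l : 'cV[R]_n) :
  boxker a p a' p' z (vcons (l0, l)) =
  cmul (ker1 (a ord0 0) (p ord0 0) (a' ord0 0) (p' ord0 0) (z ord0 0) l0)
    (boxker (vuncons a).2 (vuncons p).2 (vuncons a').2 (vuncons p').2 (vuncons z).2 l).
Proof.
have cisD x y : cis (2 * pi * (x + y)) = cmul (cis (2 * pi * x)) (cis (2 * pi * y)).
  by rewrite /cmul /cis mulrDr cosD sinD /=; congr pair; ring.
rewrite /boxker /ker1 dotv_vcons !boxft_vcons vcons0 vconsK cisD.
move: (boxft _ _ _) (boxft _ _ _) (cis _) (cis _) (ft1 _ _ _) (ft1 _ _ _).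
by move=> [? ?] [? ?] [? ?] [? ?] [? ?] [? ?]; rewrite /cmul /cconj /=; congr pair; ring.
Qed.

Lemma boxf_vcons n (a p : 'cV[R]_n.+1) x0 x :
  boxf a p (vcons (x0, x)) =
  ind1 (a ord0 0) (p ord0 0) x0 * boxf (vuncons a).2 (vuncons p).2 x.
Proof.
rewrite /boxf big_ord_recl vcons0; congr (_ * _).
by apply: eq_bigr => i _; rewrite vconsS !mxE.
Qed.

Lemma measurable_boxft n (a p : 'cV[R]_n) :
  measurable_fun setT (fun l => (boxft a p l).1) /\
  measurable_fun setT (fun l => (boxft a p l).2).
Proof.
elim: n a p => [|n IH] a p; first by split; exact: measurable_cst.
have [m1 m2] := measurable_ft1 (a ord0 0) (p ord0 0).
have [m1' m2'] := IH (vuncons a).2 (vuncons p).2.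
have mh := @measurable_vhead R n; have mt := @measurable_vtail R n.
apply: (measurable_cmul (u := fun l : 'cV[R]_n.+1 => ft1 (a ord0 0) (p ord0 0) (l ord0 0))
  (v := fun l : 'cV[R]_n.+1 => boxft (vuncons a).2 (vuncons p).2 (vuncons l).2)).
- exact: (measurableT_comp m1 mh).
- exact: (measurableT_comp m2 mh).
- exact: (measurableT_comp m1' mt).
- exact: (measurableT_comp m2' mt).
Qed.

Lemma measurable_ind1 (a p : R) : measurable_fun setT (ind1 a p : measurableTypeR R -> R).
Proof.
rewrite (_ : ind1 a p = \1_(`]a, a + `|p|]%classic : set (measurableTypeR R))).
  exact: measurable_indic.
apply/funext => x; rewrite indicE mem_setE in_itv/=.
by rewrite /ind1.
Qed.

Lemma measurable_boxf n (a p : 'cV[R]_n) : measurable_fun setT (boxf a p).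
Proof.
apply: measurable_prod => i _.
exact: (measurableT_comp (measurable_ind1 _ _) (measurable_vcoord i)).
Qed.

Lemma measurable_boxker n (a p a' p' z : 'cV[R]_n) :
  measurable_fun setT (fun l => (boxker a p a' p' z l).1) /\
  measurable_fun setT (fun l => (boxker a p a' p' z l).2).
Proof.
have [m1 m2] := measurable_boxft a p; have [m1' m2'] := measurable_boxft a' p'.
apply: (measurable_ker (u := boxft a p) (v := boxft a' p')) => //.
apply: measurable_funM => //.
by apply: measurable_dotv; [exact: measurable_id|exact: measurable_cst].
Qed.

Lemma ind1_bound (a p x : R) : 0 <= ind1 a p x <= 1.
Proof. by rewrite /ind1 ler0n lern1 leq_b1. Qed.

Lemma boxf_bound n (a p x : 'cV[R]_n) : 0 <= boxf a p x <= 1.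
Proof.
apply/andP; split.
  by rewrite /boxf prodr_ge0// => i _; case/andP: (ind1_bound (a i 0) (p i 0) (x i 0)).
by rewrite /boxf prodr_ile1// => i _; exact: ind1_bound.
Qed.

Lemma measurable_box_overlap n (a p a' p' z : 'cV[R]_n) :
  measurable_fun setT (fun t => boxf a p t * boxf a' p' (t + z)).
Proof.
apply: measurable_funM; first exact: measurable_boxf.
have [m _ _] := scales_addr z.
exact: (measurableT_comp (measurable_boxf a' p') m).
Qed.

Lemma vcons_add n (x0 : R) (x : 'cV[R]_n) (z : 'cV[R]_n.+1) :
  vcons (x0, x) + z = vcons (x0 + z ord0 0, x + (vuncons z).2).
Proof.
by apply: vcons_ext => [|i]; rewrite [LHS]mxE ?vcons0 ?vconsS// !mxE.
Qed.

(** The kernels of boxes are complex products of the kernels of their first sides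
and of the remaining ones; in the product of integrals, the imaginary parts vanish. *)
Theorem integral_boxker n (a p a' p' z : 'cV[R]_n) :
  [/\ (nu n).-integrable setT (EFin \o (fun l => (boxker a p a' p' z l).1)),
      (nu n).-integrable setT (EFin \o (fun l => (boxker a p a' p' z l).2)),
      (nu n).-integrable setT (EFin \o (fun t => boxf a p t * boxf a' p' (t + z))),
      \int[nu n]_l (boxker a p a' p' z l).1 =
        sincI ^+ n * \int[nu n]_t (boxf a p t * boxf a' p' (t + z)) &
      \int[nu n]_l (boxker a p a' p' z l).2 = 0].
Proof.
elim: n a p a' p' z => [|n IH] a p a' p' z.
  split; [exact: integrable_cV0|exact: integrable_cV0|exact: integrable_cV0|..].
    rewrite !Rintegral_cV0 /boxker /cmul /cconj /cis /= /dotv !big_ord0 /boxf !big_ord0.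
    by rewrite mulr0 cos0 sin0; ring.
  rewrite !Rintegral_cV0 /boxker /cmul /cconj /cis /= /dotv !big_ord0.
  by rewrite mulr0 cos0 sin0; ring.
have [mk1 mk2] := measurable_boxker a p a' p' z.
have mo := measurable_box_overlap a p a' p' z.
have [i1 i2 io e1 e2] := IH (vuncons a).2 (vuncons p).2 (vuncons a').2 (vuncons p').2 (vuncons z).2.
have [j1 j2 f1 f2] := integral_ker1 (a ord0 0) (p ord0 0) (a' ord0 0) (p' ord0 0) (z ord0 0).
have [jo _] := integral_ind1 (a ord0 0) (p ord0 0) (a' ord0 0) (p' ord0 0) (z ord0 0).
set k1 := fun l : measurableTypeR R => ker1 (a ord0 0) (p ord0 0) (a' ord0 0) (p' ord0 0) (z ord0 0) l.
set kn := fun l : 'cV[R]_n => boxker (vuncons a).2 (vuncons p).2 (vuncons a').2 (vuncons p').2 (vuncons z).2 l.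
have {}e1 : \int[nu n]_l (kn l).1 = _ := e1; have {}e2 : \int[nu n]_l (kn l).2 = 0 := e2.
have {}f1 : \int[mu]_l (k1 l).1 = _ := f1; have {}f2 : \int[mu]_l (k1 l).2 = 0 := f2.
have E1 : (fun w => (boxker a p a' p' z (vcons w)).1) =
    fun w => (k1 w.1).1 * (kn w.2).1 - (k1 w.1).2 * (kn w.2).2.
  by apply/funext => -[l0 l]; rewrite boxker_vcons.
have E2 : (fun w => (boxker a p a' p' z (vcons w)).2) =
    fun w => (k1 w.1).1 * (kn w.2).2 + (k1 w.1).2 * (kn w.2).1.
  by apply/funext => -[l0 l]; rewrite boxker_vcons.
pose o1 := fun t : measurableTypeR R => ind1 (a ord0 0) (p ord0 0) t * ind1 (a' ord0 0) (p' ord0 0) (t + z ord0 0).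
pose on := fun t => boxf (vuncons a).2 (vuncons p).2 t * boxf (vuncons a').2 (vuncons p').2 (t + (vuncons z).2).
have Eo : (fun w => boxf a p (vcons w) * boxf a' p' (vcons w + z)) =
    fun w => o1 w.1 * on w.2.
  apply/funext => -[t0 t]; rewrite vcons_add !boxf_vcons /= /o1 /on.
  by rewrite mulrACA.
have T11 := integrable_tensor j1 i1; have T22 := integrable_tensor j2 i2.
have T12 := integrable_tensor j1 i2; have T21 := integrable_tensor j2 i1.
have To := integrable_tensor jo io.
split.
- apply: integrable_vcons => //; rewrite E1.
  by have := integrableB measurableT T11 T22.
- apply: integrable_vcons => //; rewrite E2.
  by have := integrableD measurableT T12 T21.
- by apply: integrable_vcons => //; rewrite Eo.
- rewrite !Rintegral_vcons// E1 Eo RintegralB// (Rintegral_tensor j1 i1).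
  rewrite (Rintegral_tensor j2 i2) (Rintegral_tensor jo io) e1 e2 f1 f2.
  by rewrite mul0r subr0 exprS; ring.
- rewrite !Rintegral_vcons// E2 RintegralD// (Rintegral_tensor j1 i2).
  rewrite (Rintegral_tensor j2 i1) e2 f2.
  by rewrite mulr0 mul0r addr0.
Qed.

(** The modulus of the transform of a box is at most the volume of the box. *)
Lemma boxft_bound n (a p : 'cV[R]_n) : exists C, forall l,
  (boxft a p l).1 ^+ 2 + (boxft a p l).2 ^+ 2 <= C.
Proof.
exists (\prod_i (p i 0) ^+ 2); elim: n a p => [|n IH] a p l.
  by rewrite big_ord0 /= expr1n expr0n/= addr0.
rewrite -[boxft a p l]/(cmul (ft1 (a ord0 0) (p ord0 0) (l ord0 0))
  (boxft (vuncons a).2 (vuncons p).2 (vuncons l).2)).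
have := IH (vuncons a).2 (vuncons p).2 (vuncons l).2.
rewrite big_ord_recl.
have -> : \prod_(i < n) (p (lift ord0 i) 0) ^+ 2 = \prod_i ((vuncons p).2 i 0) ^+ 2.
  by apply: eq_bigr => i _; rewrite mxE.
have := nft1 (a ord0 0) (p ord0 0) (l ord0 0).
have := sinc2_le `|p ord0 0| (l ord0 0).
have := sinc2_ge0 `|p ord0 0| (l ord0 0).
rewrite real_normK ?num_real//.
move: (ft1 _ _ _) (boxft _ _ _) (sinc2 _ _) => u v S S0 Sp uS vP.
have -> : (cmul u v).1 ^+ 2 + (cmul u v).2 ^+ 2 =
  (u.1 ^+ 2 + u.2 ^+ 2) * (v.1 ^+ 2 + v.2 ^+ 2) by rewrite /=; ring.
by rewrite uS ler_pM// addr_ge0 ?sqr_ge0.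
Qed.

End box_kernel.

(** * Step functions and their spectral densities *)

Lemma Rintegral_sum {R : realType} d (T : measurableType d)
    (mu : {measure set T -> \bar R}) (I : Type) (s : seq I) (F : I -> T -> R) :
  (forall i, mu.-integrable setT (EFin \o F i)) ->
  mu.-integrable setT (EFin \o (fun x => \sum_(i <- s) F i x)) /\
  \int[mu]_x (\sum_(i <- s) F i x) = \sum_(i <- s) \int[mu]_x F i x.
Proof.
move=> iF; elim: s => [|i s [IH1 IH2]].
  have -> : (fun x => \sum_(i <- [::]) F i x) = fun=> 0.
    by apply/funext => x; rewrite big_nil.
  by split; [exact: integrable0|rewrite big_nil Rintegral_cst// mul0r].
have E : (fun x => \sum_(j <- i :: s) F j x) = fun x => F i x + \sum_(j <- s) F j x.
  by apply/funext => x; rewrite big_cons.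
rewrite E; split; first by have := integrableD measurableT (iF i) IH1.
by rewrite RintegralD// IH2 big_cons.
Qed.

Section qdot_linear.
Context {R : realType}.
Implicit Types p q r : quat R.

Lemma qdot_suml (I : Type) (s : seq I) (F : I -> quat R) r :
  qdot (\sum_(i <- s) F i) r = \sum_(i <- s) qdot (F i) r.
Proof.
elim: s => [|i s IH]; first by rewrite !big_nil qdot0l.
by rewrite !big_cons qdotDl IH.
Qed.

Lemma qdot_sum (I : Type) (s : seq I) (c e : I -> R) (q : I -> quat R) :
  qdot (\sum_(i <- s) c i *: q i) (\sum_(i <- s) e i *: q i) =
  \sum_(i <- s) \sum_(j <- s) qdot (q i) (q j) * (c i * e j).
Proof.
rewrite qdot_suml; apply: eq_bigr => i _.
rewrite qdotC qdot_suml; apply: eq_bigr => j _.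
by rewrite qdotZl qdotC qdotZl; ring.
Qed.

End qdot_linear.

Section step_functions.
Context {R : realType} (n : nat).
Local Notation nu := (@lebesgue_cV R n).
Local Notation V := 'cV[R]_n.
Implicit Types (s : seq (quat R * (V * V))) (f : V -> quat R).

(** A step function is given by its values and, for each of them, the corner and
the sides of a box; boxes may overlap. *)
Definition stepf s (x : V) : quat R := \sum_(e <- s) boxf e.2.1 e.2.2 x *: e.1.

(** [m] is a spectral density of [f]: the real autocorrelation of [f] is the cosine
transform of [m].  For a complex function, [m] would be the squared modulus of the
Fourier transform. *)
Definition bochner f (m : V -> R) :=
  [/\ measurable_fun setT m, forall l, 0 <= m l, exists C, forall l, m l <= C,
    nu.-integrable setT (EFin \o m) &
    forall z, \int[nu]_t qdot (f t) (f (t + z)) = \int[nu]_l (m l * cos (2 * pi * dotv l z))].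

Lemma boxf_idem (a p x : V) : boxf a p x * boxf a p x = boxf a p x.
Proof.
rewrite /boxf -big_split; apply: eq_bigr => i _ /=.
by rewrite /ind1 -natrM mulnb andbb.
Qed.

Lemma integrable_boxf (a p : V) : nu.-integrable setT (EFin \o boxf a p).
Proof.
have [_ _ + _ _] := integral_boxker a p a p 0.
rewrite (_ : (fun t => _) = boxf a p)//; apply/funext => x.
by rewrite addr0 boxf_idem.
Qed.

Lemma stepf_measurable s : quat_measurable (stepf s).
Proof.
apply: quat_measurable_sum => e; apply: quat_measurableZ.
  exact: measurable_boxf.
exact: quat_measurable_cst.
Qed.

Lemma stepf_nil : stepf [::] = fun=> 0.
Proof. by apply/funext => x; rewrite /stepf big_nil. Qed.

Lemma stepf_cons e s : stepf (e :: s) = fun x => boxf e.2.1 e.2.2 x *: e.1 + stepf s x.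
Proof. by apply/funext => x; rewrite /stepf big_cons. Qed.

Lemma stepf_cat s t : stepf (s ++ t) = fun x => stepf s x + stepf t x.
Proof. by apply/funext => x; rewrite /stepf big_cat. Qed.

Definition negs s := [seq (- e.1, e.2) | e <- s].

Lemma stepf_neg s : stepf (negs s) = fun x => - stepf s x.
Proof.
apply/funext => x; rewrite /stepf /negs big_map -sumrN.
by apply: eq_bigr => e _ /=; rewrite scalerN.
Qed.

Lemma stepf_bound s : exists2 C, 0 <= C & forall x, qabs (stepf s x) <= C.
Proof.
elim: s => [|e s [C C0 IH]].
  by exists 0 => // x; rewrite stepf_nil qabs0.
exists (qabs e.1 + C) => [|x]; first by rewrite addr_ge0 ?qabs_ge0.
rewrite stepf_cons; apply: le_trans (qabsD _ _) _; apply: lerD => //.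
have /andP[b0 b1] := boxf_bound e.2.1 e.2.2 x.
by rewrite qabsZ ger0_norm// ler_piMl// qabs_ge0.
Qed.

Lemma stepf_integrable s : quat_integrable nu (stepf s).
Proof.
elim: s => [|e s IH].
  rewrite stepf_nil; split; first exact: quat_measurable_cst.
  by under eq_integral do rewrite qabs0; rewrite integral0.
rewrite stepf_cons; apply: quat_integrableD => //.
apply: (@le_quat_integrable _ _ _ _ _ (fun x => qabs e.1 * boxf e.2.1 e.2.2 x)).
- by apply: quat_measurableZ; [exact: measurable_boxf|exact: quat_measurable_cst].
- by move=> x; rewrite qabsZ mulrC ger0_norm//; case/andP: (boxf_bound e.2.1 e.2.2 x).
- by have := integrableZl measurableT (qabs e.1) (integrable_boxf e.2.1 e.2.2).
Qed.

Lemma stepf_L2 s : (nq2 nu (stepf s) < +oo)%E.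
Proof.
have [C C0 bC] := stepf_bound s.
have i1 := quat_integrable_qabs (stepf_integrable s).
have := integrableZl measurableT C i1.
have m2 := measurable_nq (stepf_measurable s).
move=> /(le_integrable_real (u := nq \o stepf s) m2) H.
have /integrable_EFinP[_] : nu.-integrable setT (EFin \o (nq \o stepf s)).
  apply: H => x /=; rewrite ger0_norm ?nq_ge0// -sqr_qabs expr2.
  by rewrite ler_wpM2r ?qabs_ge0.
by under eq_integral do rewrite /= ger0_norm ?nq_ge0//.
Qed.

Definition step_ftc s (l : V) : quat R := \sum_(e <- s) (boxft e.2.1 e.2.2 l).1 *: e.1.
Definition step_fts s (l : V) : quat R := \sum_(e <- s) (boxft e.2.1 e.2.2 l).2 *: e.1.
(** The Fourier transform of a step function takes values in the complexified
quaternions; [step_ftc] and [step_fts] are its two components, and the density is the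
sum of their squares, normalised by the constant of [integral_boxker]. *)
Definition step_density s (l : V) : R :=
  (@sincI R ^+ n)^-1 * (nq (step_ftc s l) + nq (step_fts s l)).

(** Multiplying the transform of a box by the conjugate of another, the imaginary
part is antisymmetric in the two boxes whereas [qdot] is symmetric, so that these parts
cancel in the double sum. *)
Lemma step_density_ker s z l : step_density s l * cos (2 * pi * dotv l z) =
  (@sincI R ^+ n)^-1 * \sum_(e <- s) \sum_(e' <- s)
    qdot e.1 e'.1 * (boxker e.2.1 e.2.2 e'.2.1 e'.2.2 z l).1.
Proof.
rewrite /step_density -[LHS]mulrA; congr (_ * _).
set C := step_ftc s l; set S := step_fts s l.
set co := cos _; set si := sin (2 * pi * dotv l z).
transitivity ((qdot C C + qdot S S) * co - (qdot S C - qdot C S) * si).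
  by rewrite (qdotC S C) subrr mul0r subr0.
rewrite /C /S /step_ftc /step_fts !qdot_sum.
rewrite -big_split/= -sumrB !mulr_suml -sumrB; apply: eq_bigr => e _.
rewrite -big_split/= -sumrB !mulr_suml -sumrB; apply: eq_bigr => e' _.
by rewrite /boxker /cmul /cconj /cis /= -/co -/si; ring.
Qed.

Lemma sincIn_neq0 : @sincI R ^+ n != 0.
Proof. by rewrite expf_neq0// gt_eqF// sincI_gt0. Qed.

(** By bilinearity this is the case of pairs of boxes, [integral_boxker]. *)
Lemma stepf_bochner s : bochner (stepf s) (step_density s).
Proof.
pose k z l := \sum_(e <- s) \sum_(e' <- s)
    qdot e.1 e'.1 * (boxker e.2.1 e.2.2 e'.2.1 e'.2.2 z l).1.
have ik z : nu.-integrable setT (EFin \o k z) /\ \int[nu]_l k z l =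
    \sum_(e <- s) \sum_(e' <- s) qdot e.1 e'.1 *
       (sincI ^+ n * \int[nu]_t (boxf e.2.1 e.2.2 t * boxf e'.2.1 e'.2.2 (t + z))).
  pose G e e' l := qdot e.1 e'.1 * (boxker e.2.1 e.2.2 e'.2.1 e'.2.2 z l).1 : R.
  have iG e e' : nu.-integrable setT (EFin \o G e e').
    have [i1 _ _ _ _] := integral_boxker e.2.1 e.2.2 e'.2.1 e'.2.2 z.
    by have := integrableZl measurableT (qdot e.1 e'.1) i1.
  have [iS eS] := Rintegral_sum s (fun e => (Rintegral_sum s (iG e)).1).
  split => //; rewrite [LHS]eS; apply: eq_bigr => e _.
  rewrite (Rintegral_sum s (iG e)).2; apply: eq_bigr => e' _.
  have [i1 _ _ e1 _] := integral_boxker e.2.1 e.2.2 e'.2.1 e'.2.2 z.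
  by rewrite RintegralZl// e1.
have Ek z : (fun l => step_density s l * cos (2 * pi * dotv l z)) =
    fun l => (@sincI R ^+ n)^-1 * k z l.
  by apply/funext => l; rewrite step_density_ker.
have E0 : step_density s = fun l => (@sincI R ^+ n)^-1 * k 0 l.
  rewrite -Ek; apply/funext => l; rewrite (_ : dotv l 0 = 0) ?mulr0 ?cos0 ?mulr1//.
  by rewrite /dotv big1// => i _; rewrite mxE mulr0.
have im : nu.-integrable setT (EFin \o step_density s).
  by rewrite E0; have := integrableZl measurableT (@sincI R ^+ n)^-1 (ik 0).1.
split => //.
- by have /integrable_EFinP[] := im.
- move=> l; apply: mulr_ge0; last by rewrite addr_ge0 ?nq_ge0.
  by rewrite invr_ge0 exprn_ge0// ltW// sincI_gt0.
- suff [C HC] : exists C, forall l, nq (step_ftc s l) + nq (step_fts s l) <= C.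
    exists ((@sincI R ^+ n)^-1 * C) => l; apply: ler_wpM2l => //.
    by rewrite invr_ge0 exprn_ge0// ltW// sincI_gt0.
  rewrite /step_ftc /step_fts; elim: {ik Ek E0 im k} s => [|e s [C IH]].
    by exists 0 => l; rewrite !big_nil nq0 addr0.
  have [B HB] := boxft_bound e.2.1 e.2.2.
  exists (2 * (B * nq e.1) + 2 * C) => l; rewrite !big_cons.
  have h1 := nqD_le ((boxft e.2.1 e.2.2 l).1 *: e.1)
    (\sum_(j <- s) (boxft j.2.1 j.2.2 l).1 *: j.1).
  have h2 := nqD_le ((boxft e.2.1 e.2.2 l).2 *: e.1)
    (\sum_(j <- s) (boxft j.2.1 j.2.2 l).2 *: j.1).
  have h3 := IH l.
  have h4 := ler_wpM2r (nq_ge0 e.1) (HB l).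
  rewrite !nqZ in h1 h2; lra.
- move=> z; rewrite Ek RintegralZl; [|by []|exact: (ik z).1].
  rewrite (ik z).2 /stepf.
  under eq_Rintegral do rewrite qdot_sum.
  pose G e e' t := qdot e.1 e'.1 * (boxf e.2.1 e.2.2 t * boxf e'.2.1 e'.2.2 (t + z)) : R.
  have iG e e' : nu.-integrable setT (EFin \o G e e').
    have [_ _ i1 _ _] := integral_boxker e.2.1 e.2.2 e'.2.1 e'.2.2 z.
    by have := integrableZl measurableT (qdot e.1 e'.1) i1.
  rewrite (Rintegral_sum s (fun e => (Rintegral_sum s (iG e)).1)).2 mulr_sumr.
  apply: eq_bigr => e _; rewrite (Rintegral_sum s (iG e)).2 mulr_sumr.
  apply: eq_bigr => e' _.
  have [_ _ i1 _ _] := integral_boxker e.2.1 e.2.2 e'.2.1 e'.2.2 z.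
  rewrite RintegralZl// mulrCA; congr (_ * _).
  by rewrite mulrA mulVf ?mul1r// sincIn_neq0.
Qed.

End step_functions.

(** * Energy of a convolution and of the matching correlation *)

Lemma qdotM_le {R : realType} (p q a b : quat R) :
  `|qdot (p * a) (q * b)| <= qabs p * qabs q * (qabs a * qabs b).
Proof. by apply: le_trans (qdot_le _ _) _; rewrite !qabsM mulrACA. Qed.

Section convolution_energy.
Context {R : realType} (n : nat).
Local Notation nu := (@lebesgue_cV R n).
Local Notation V := 'cV[R]_n.
Implicit Types (f k : V -> quat R).

Definition qconv f k (t : V) := quat_integral nu (fun y => f (t - y) * k y).
Definition qcorr f k (t : V) := quat_integral nu (fun y => f (t + y) * k y).
Definition costr k (l : V) :=
  quat_integral nu (fun y => cos (2 * pi * dotv l y) *: k y).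
Definition sintr k (l : V) :=
  quat_integral nu (fun y => sin (2 * pi * dotv l y) *: k y).

(** For fixed second variable the first factor is only translated, so Tonelli's
theorem separates the two integrals. *)
Lemma integrable_translate d (T : measurableType d)
    (m2 : {sigma_finite_measure set T -> \bar R}) (g : V -> R) (h : T -> R) (phi : T -> V) :
  nu.-integrable setT (EFin \o g) -> m2.-integrable setT (EFin \o h) ->
  measurable_fun setT phi ->
  (prodm nu m2).-integrable setT (EFin \o (fun z => g (z.1 + phi z.2) * h z.2)).
Proof.
move=> /integrable_EFinP[mg ig] /integrable_EFinP[mh ih] mphi.
have mG : measurable_fun setT (fun z : V * T => g (z.1 + phi z.2) * h z.2).
  apply: measurable_funM; last exact: (measurableT_comp mh measurable_snd).
  apply: (measurableT_comp mg); apply: measurable_addv; first exact: measurable_fst.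
  exact: (measurableT_comp mphi measurable_snd).
have mGE : measurable_fun setT (fun z : V * T => (g (z.1 + phi z.2) * h z.2)%:E).
  exact/measurable_EFinP.
apply: (integrable21ltyP nu m2 mGE).2 => /=.
have E y : (\int[nu]_x `|g (x + phi y) * h y|%:E = \int[nu]_x `|g x|%:E * `|h y|%:E)%E.
  have ma : measurable_fun setT (fun x : V => `|g x|%:E).
    by apply/measurable_EFinP; exact: measurableT_comp.
  have [m1 _ /(_ _ ma (fun x => normr_ge0 _)) H] := scales_addr (phi y).
  under eq_integral do rewrite normrM EFinM.
  by rewrite ge0_integralZr// ?H ?mul1e//; exact: (measurableT_comp ma m1).
under eq_integral do rewrite E.
have g0 : (0 <= \int[nu]_x `|g x|%:E)%E by apply: integral_ge0 => x _; rewrite lee_fin.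
rewrite ge0_integralZl//.
  by rewrite lte_mul_pinfty// ge0_fin_numE.
by apply/measurable_EFinP; exact: measurableT_comp.
Qed.

Variables (f k : V -> quat R) (m : V -> R).
Hypotheses (fm : bochner f m) (iF : quat_integrable nu f)
  (bF : exists2 C, 0 <= C & forall x, qabs (f x) <= C) (iK : quat_integrable nu k).

Local Notation P2 := (prodm nu nu).

Let mF : quat_measurable f := iF.1.
Let mK : quat_measurable k := iK.1.

Let iKK : P2.-integrable setT (EFin \o (fun z => qabs (k z.1) * qabs (k z.2))).
Proof. exact: (integrable_tensor (quat_integrable_qabs iK) (quat_integrable_qabs iK)). Qed.

Lemma quat_integrable_mul_bounded (phi : V -> V) : measurable_fun setT phi ->
  quat_integrable nu (fun y => f (phi y) * k y).
Proof.
move=> mphi; have [C C0 bC] := bF.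
apply: (@le_quat_integrable _ _ _ _ _ (fun y => C * qabs (k y))).
- by apply: quat_measurableM => //; exact: quat_measurable_comp mF mphi.
- by move=> y; rewrite qabsM ler_wpM2r// qabs_ge0.
- by have := integrableZl measurableT C (quat_integrable_qabs iK).
Qed.

Let W (s : R) (w : V * (V * V)) :=
  qdot (f (w.1 + s *: w.2.1) * k w.2.1) (f (w.1 + s *: w.2.2) * k w.2.2).

Let mscale d (T : measurableType d) (s : R) (g : T -> V) : measurable_fun setT g ->
  measurable_fun setT (fun x => s *: g x).
Proof. by move=> mg; apply: measurable_scalev. Qed.

Let iW s : (prodm nu P2).-integrable setT (EFin \o W s).
Proof.
have [C C0 bC] := bF.
have i1 := quat_integrable_qabs iF.
have i2 := integrableZl measurableT C iKK.
have mphi : measurable_fun setT (fun z : V * V => s *: z.1).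
  exact: mscale measurable_fst.
have i3 := integrable_translate i1 i2 mphi.
apply: le_integrable_real i3.
  apply: measurable_qdot; apply: quat_measurableM.
  - apply: (quat_measurable_comp mF); apply: measurable_addv; first exact: measurable_fst.
    by apply: mscale; exact: (measurableT_comp measurable_fst measurable_snd).
  - by apply: (quat_measurable_comp mK); exact: (measurableT_comp measurable_fst measurable_snd).
  - apply: (quat_measurable_comp mF); apply: measurable_addv; first exact: measurable_fst.
    by apply: mscale; exact: (measurableT_comp measurable_snd measurable_snd).
  - by apply: (quat_measurable_comp mK); exact: (measurableT_comp measurable_snd measurable_snd).
move=> w; apply: le_trans (qdot_le _ _) _; rewrite !qabsM /=.
rewrite -[leLHS]mulrA ler_wpM2l ?qabs_ge0// mulrCA.
by rewrite ler_wpM2r ?mulr_ge0 ?qabs_ge0.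
Qed.

(** Here [s = -1] is the convolution and [s = 1] the correlation. *)
Let energyW s : nq2 nu (fun t => quat_integral nu (fun y => f (t + s *: y) * k y)) =
  (\int[P2]_z \int[nu]_t W s (t, z))%:E.
Proof.
have iw := iW s.
rewrite -(Rfubini iw) /nq2 -[RHS]fineK; last by [].
have E t : nq (quat_integral nu (fun y => f (t + s *: y) * k y)) =
    \int[P2]_z W s (t, z).
  have mphi : measurable_fun setT (fun y : V => t + s *: y).
    by apply: measurable_addv; [exact: measurable_cst|apply: mscale; exact: measurable_id].
  have iu := quat_integrable_mul_bounded mphi.
  by rewrite /nq (qdot_quat_integral2 iu iu).2.
under eq_integral do rewrite E.
have i1 := integrable_Rfubini1 iw.
by rewrite /= /Rintegral fineK//; exact: (integrable_fin_num _ i1).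
Qed.

Let shiftW z : \int[nu]_t W (-1) (t, z) + \int[nu]_t W 1 (t, z) =
  2 * (qdot (k z.1) (k z.2) *
    \int[nu]_l (m l * cos (2 * pi * dotv l (z.1 - z.2)))).
Proof.
have [C C0 bC] := bF; have [_ _ _ _ <-] := fm.
pose w : V := z.1 - z.2.
have mw : measurable_fun setT (fun t : V => t + w) by have [] := scales_addr w.
pose g1 (t : V) := qdot (f t * k z.1) (f (t + w) * k z.2).
pose g2 (t : V) := qdot (f (t + w) * k z.1) (f t * k z.2).
have mfw : quat_measurable (fun t : V => f (t + w)) by exact: quat_measurable_comp mF mw.
have mc q : quat_measurable (fun _ : V => q : quat R) by exact: quat_measurable_cst.
have mg1 : measurable_fun setT g1 by apply: measurable_qdot; apply: quat_measurableM.
have mg2 : measurable_fun setT g2 by apply: measurable_qdot; apply: quat_measurableM.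
have iv : nu.-integrable setT (EFin \o
    (fun t => C * (qabs (k z.1) * qabs (k z.2)) * qabs (f t))).
  by have := integrableZl measurableT (C * (qabs (k z.1) * qabs (k z.2))) (quat_integrable_qabs iF).
have ig1 : nu.-integrable setT (EFin \o g1).
  apply: le_integrable_real iv => // t; apply: le_trans (qdotM_le _ _ _ _) _.
  rewrite [leRHS]mulrAC ler_wpM2r ?mulr_ge0 ?qabs_ge0//.
  by rewrite mulrC ler_wpM2r ?qabs_ge0.
have ig2 : nu.-integrable setT (EFin \o g2).
  apply: le_integrable_real iv => // t; apply: le_trans (qdotM_le _ _ _ _) _.
  rewrite [leRHS]mulrAC ler_wpM2r ?mulr_ge0 ?qabs_ge0//.
  by rewrite ler_wpM2r ?qabs_ge0.
have mW s : measurable_fun setT (fun t : V => W s (t, z)).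
  have mt c : measurable_fun setT (fun t : V => t + c) by have [] := scales_addr c.
  rewrite /W /=; apply: measurable_qdot; apply: quat_measurableM.
  - exact: quat_measurable_comp mF (mt _).
  - exact: mc.
  - exact: quat_measurable_comp mF (mt _).
  - exact: mc.
have -> : \int[nu]_t W (-1) (t, z) = \int[nu]_t g1 t.
  rewrite -[LHS]mul1r -(scales_Rintegral (scales_addr z.1) (mW (-1))).
  apply: eq_Rintegral => t _; rewrite /W /g1 /= !scaleN1r addrK.
  by rewrite -addrA.
have -> : \int[nu]_t W 1 (t, z) = \int[nu]_t g2 t.
  rewrite -[LHS]mul1r -(scales_Rintegral (scales_addr (- z.2)) (mW 1)).
  apply: eq_Rintegral => t _; rewrite /W /g2 /= !scale1r subrK.
  by rewrite -addrA (addrC (- _)).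
have iff : nu.-integrable setT (EFin \o (fun t : V => qdot (f t) (f (t + w)))).
  have iC : nu.-integrable setT (EFin \o (fun t => C * qabs (f t))).
    by have := integrableZl measurableT C (quat_integrable_qabs iF).
  apply: le_integrable_real iC; first exact: measurable_qdot.
  by move=> t; apply: le_trans (qdot_le _ _) _; rewrite /= mulrC ler_wpM2r ?qabs_ge0.
rewrite -RintegralD// -RintegralZl//.
rewrite -RintegralZl//; last by have := integrableZl measurableT (qdot (k z.1) (k z.2)) iff.
apply: eq_Rintegral => t _; rewrite /g1 /g2 qdot_mul_sym.
by rewrite (mulrC (qdot (f t) _)).
Qed.

Let X (w : (V * V) * V) := qdot (k w.1.1) (k w.1.2) *
  (m w.2 * cos (2 * pi * dotv w.2 (w.1.1 - w.1.2))).

Let measurable_phase d (T : measurableType d) (g h : T -> V) :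
  measurable_fun setT g -> measurable_fun setT h ->
  measurable_fun setT (fun x => 2 * pi * dotv (g x) (h x)).
Proof. by move=> mg mh; apply: measurable_funM => //; exact: measurable_dotv. Qed.

Let iX : (prodm P2 nu).-integrable setT (EFin \o X).
Proof.
have [mm m0 _ im _] := fm.
apply: le_integrable_real (integrable_tensor iKK im).
  apply: measurable_funM.
    by apply: measurable_qdot; apply: (quat_measurable_comp mK);
     [exact: (measurableT_comp measurable_fst measurable_fst)
     |exact: (measurableT_comp measurable_snd measurable_fst)].
  apply: measurable_funM; first exact: (measurableT_comp mm measurable_snd).
  apply: measurable_cosR; apply: measurable_phase; first exact: measurable_snd.
  by apply: measurable_subv; [exact: (measurableT_comp measurable_fst measurable_fst)
     |exact: (measurableT_comp measurable_snd measurable_fst)].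
move=> w; rewrite /X normrM ler_pM ?qdot_le//.
by rewrite normrM (ger0_norm (m0 _)) ler_piMr// cos_max.
Qed.

Lemma quat_integrable_costr l :
  quat_integrable nu (fun y => cos (2 * pi * dotv l y) *: k y) /\
  quat_integrable nu (fun y => sin (2 * pi * dotv l y) *: k y).
Proof.
have mp := measurable_phase (measurable_cst l) (@measurable_id _ V setT).
split.
- by apply: (quat_integrableZ (c := 1)) => // [|y]; [exact: measurable_cosR|exact: cos_max].
- by apply: (quat_integrableZ (c := 1)) => // [|y]; [exact: measurable_sinR|exact: sin_max].
Qed.

Let integral_X1 l : \int[P2]_z X (z, l) = m l * (nq (costr k l) + nq (sintr k l)).
Proof.
have [i1 i2] := quat_integrable_costr l.
have [j1 e1] := qdot_quat_integral2 i1 i1; have [j2 e2] := qdot_quat_integral2 i2 i2.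
rewrite /nq e1 e2 -RintegralD// -RintegralZl//; last first.
  by have := integrableD measurableT j1 j2.
apply: eq_Rintegral => z _; rewrite /X /=.
have -> : dotv l (z.1 - z.2) = dotv l z.1 - dotv l z.2.
  by rewrite /dotv -sumrB; apply: eq_bigr => i _; rewrite !mxE mulrBr.
by rewrite mulrBr cosB !(qdotZl, qdotC _ (_ *: _)) (qdotC (k z.2)); ring.
Qed.

(** Both energies are triple integrals of scalar products of [f(t -+ y) k(y)] and
[f(t -+ y') k(y')].  Translating [t] by [y] in one and by [-y'] in the other makes the
values of [f] the same two, exchanged, so that [qdot_mul_sym] applies; the integral in
[t] is then the autocorrelation of [f] at [y - y'], which [bochner] replaces by a cosine
transform, and [cos (b - b')] splits into the cosine and sine transforms of [k]. *)
Theorem convolution_energy :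
  (nq2 nu (qconv f k) + nq2 nu (qcorr f k) =
   2%:E * \int[nu]_l (m l * (nq (costr k l) + nq (sintr k l)))%:E)%E.
Proof.
have -> : qconv f k = fun t => quat_integral nu (fun y => f (t + -1 *: y) * k y).
  by apply/funext => t; apply: eq_quat_integral => y; rewrite scaleN1r.
have -> : qcorr f k = fun t => quat_integral nu (fun y => f (t + 1 *: y) * k y).
  by apply/funext => t; apply: eq_quat_integral => y; rewrite scale1r.
rewrite !energyW -EFinD -RintegralD//; try exact: integrable_Rfubini2 (iW _).
under eq_Rintegral do rewrite shiftW.
have E z : qdot (k z.1) (k z.2) * \int[nu]_l (m l * cos (2 * pi * dotv l (z.1 - z.2))) =
    \int[nu]_l X (z, l).
  have [mm m0 _ im _] := fm.
  rewrite -RintegralZl//; apply: le_integrable_real im.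
    apply: measurable_funM => //; apply: measurable_cosR; apply: measurable_phase.
      exact: measurable_id.
    exact: (measurable_cst (z.1 - z.2)).
  by move=> l; rewrite normrM (ger0_norm (m0 _)) ler_piMr// cos_max.
under eq_Rintegral do rewrite E.
rewrite RintegralZl//; last exact: integrable_Rfubini1 iX.
rewrite (Rfubini iX).
under eq_Rintegral do rewrite integral_X1.
have := integrable_Rfubini2 iX.
rewrite (_ : (fun y => _) = (fun l => m l * (nq (costr k l) + nq (sintr k l)))); last first.
  by apply/funext => l; exact: integral_X1.
move=> i2; rewrite EFinM /Rintegral fineK//.
exact: (integrable_fin_num _ i2).
Qed.

End convolution_energy.

(** * Cosine and sine transforms from the two-sided Fourier transform *)

Section reflections.
Context {R : realType} (n : nat).
Local Notation V := 'cV[R]_(n + n).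
Local Notation nu := (@lebesgue_cV R (n + n)).
Implicit Types (g h : V -> quat R) (w z : V) (e : R).

Definition refl e e' (w : V) : V := col_mx (e *: usubmx w) (e' *: dsubmx w).

Lemma refl11 w : refl 1 1 w = w.
Proof. by rewrite /refl !scale1r vsubmxK. Qed.

Lemma refl_refl e1 e1' e2 e2' w :
  refl e1 e1' (refl e2 e2' w) = refl (e1 * e2) (e1' * e2') w.
Proof. by rewrite /refl col_mxKu col_mxKd !scalerA. Qed.

Lemma scales_refl e e' : `|e| = 1 -> `|e'| = 1 -> scales nu (refl e e') 1.
Proof.
move=> e1 e1'.
rewrite (_ : refl e e' = aff (col_mx (const_mx e) (const_mx e')) 0).
  by apply: scales_aff1 => i; case: (split_ordP i) => j ->; rewrite ?col_mxEu ?col_mxEd mxE.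
apply/funext => w; apply: cV_ext => i; rewrite /aff /refl [RHS]mxE [X in _ + X]mxE addr0.
by case: (split_ordP i) => j ->; rewrite ?col_mxEu ?col_mxEd !mxE.
Qed.

(** Applied to the values of the Fourier transform at the four reflections of a
frequency, [cos_part] and [sin_part] recover the cosine and sine transforms.  The
cosine of [A + B] is [cos A cos B - sin A sin B], and the products of cosines and
of sines are the even-even and odd-odd parts of the two-sided exponential; the
latter comes with [qI] on the left and [qJ] on the right, which the multiplications by
[qI] and [qJ] remove. *)
Definition cos_part (p1 p2 p3 p4 : quat R) : quat R :=
  4^-1 *: ((p1 + p2 + p3 + p4) - qI * (p1 - p2 - p3 + p4) * qJ).
Definition sin_part (p1 p2 p3 p4 : quat R) : quat R :=
  4^-1 *: (qI * (p1 - p2 + p3 - p4) + (p1 + p2 - p3 - p4) * qJ).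

Definition parity (op : quat R -> quat R -> quat R -> quat R -> quat R) g w :=
  op (g w) (g (refl (-1) 1 w)) (g (refl 1 (-1) w)) (g (refl (-1) (-1) w)).

(** The four terms list the values at the reflected frequencies.  Up to signs, the
four combinations of even and odd parts are the same at each of them, and the
parallelogram identity removes the products. *)
Lemma parity_energy (p1 p2 p3 p4 : quat R) :
  let E p1 p2 p3 p4 := nq (cos_part p1 p2 p3 p4) + nq (sin_part p1 p2 p3 p4) in
  E p1 p2 p3 p4 + E p2 p1 p4 p3 + E p3 p4 p1 p2 + E p4 p3 p2 p1 =
  nq p1 + nq p2 + nq p3 + nq p4.
Proof.
have par (x y : quat R) : nq (x + y) + nq (x - y) = 2 * (nq x + nq y).
  by rewrite !nqE !quatE; ring.
have nI : nq (@qI R) = 1 by rewrite nqE /= expr0n expr1n !addr0 add0r.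
have nJ : nq (@qJ R) = 1 by rewrite nqE /= expr0n expr1n !addr0 add0r.
rewrite /cos_part /sin_part !nqZ -!mulrDr.
set a := p1 + p2 + p3 + p4; set d := p1 - p2 - p3 + p4.
set b := p1 - p2 + p3 - p4; set c := p1 + p2 - p3 - p4.
have a2 : p2 + p1 + p4 + p3 = a by rewrite /a (addrC p2) -!addrA (addrC p4).
have a3 : p3 + p4 + p1 + p2 = a by rewrite /a -addrA addrC addrA.
have a4 : p4 + p3 + p2 + p1 = a.
  by rewrite -a3 (addrC p4) -[LHS]addrA (addrC p2) addrA.
have d2 : p2 - p1 - p4 + p3 = - d.
  by apply: quat_eqP; rewrite /d !quatE; ring.
have d3 : p3 - p4 - p1 + p2 = - d by apply: quat_eqP; rewrite /d !quatE; ring.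
have d4 : p4 - p3 - p2 + p1 = d by apply: quat_eqP; rewrite /d !quatE; ring.
have b2 : p2 - p1 + p4 - p3 = - b by apply: quat_eqP; rewrite /b !quatE; ring.
have b3 : p3 - p4 + p1 - p2 = b by apply: quat_eqP; rewrite /b !quatE; ring.
have b4 : p4 - p3 + p2 - p1 = - b by apply: quat_eqP; rewrite /b !quatE; ring.
have c2 : p2 + p1 - p4 - p3 = c by apply: quat_eqP; rewrite /c !quatE; ring.
have c3 : p3 + p4 - p1 - p2 = - c by apply: quat_eqP; rewrite /c !quatE; ring.
have c4 : p4 + p3 - p2 - p1 = - c by apply: quat_eqP; rewrite /c !quatE; ring.
rewrite a2 a3 a4 b2 b3 b4 c2 c3 c4 d2 d3 d4 !mulrN !mulNr !opprK.
have h1 := par a (qI * d * qJ); have h2 := par (qI * b) (c * qJ).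
have -> : - (qI * b) + c * qJ = - (qI * b - c * qJ) by rewrite opprB addrC.
have -> : - (qI * b) + - (c * qJ) = - (qI * b + c * qJ) by rewrite opprD.
rewrite !nqN !nqM nI nJ !mul1r !mulr1 in h1 h2 *.
have k1 := par (p1 + p4) (p2 + p3); have k2 := par (p1 - p4) (p2 - p3).
have -> : nq p1 + nq p2 + nq p3 + nq p4 = 4^-1 * (nq a + nq b + nq c + nq d).
  have -> : a = (p1 + p4) + (p2 + p3) by apply: quat_eqP; rewrite /a !quatE; ring.
  have -> : d = (p1 + p4) - (p2 + p3) by apply: quat_eqP; rewrite /d !quatE; ring.
  have -> : c = (p1 - p4) + (p2 - p3) by apply: quat_eqP; rewrite /c !quatE; ring.
  have -> : b = (p1 - p4) - (p2 - p3) by apply: quat_eqP; rewrite /b !quatE; ring.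
  have := par p1 p4; have := par p2 p3; move: k1 k2; lra.
move: h1 h2; rewrite expr2; lra.
Qed.

Lemma quat_measurable_parity g : quat_measurable g ->
  quat_measurable (parity cos_part g) /\ quat_measurable (parity sin_part g).
Proof.
move=> mg.
have n1 : `|1| = 1 :> R by rewrite normr1.
have n2 : `|-1| = 1 :> R by rewrite normrN normr1.
have m2 : quat_measurable (fun w => g (refl (-1) 1 w)).
  by apply: (quat_measurable_comp mg); have [] := scales_refl n2 n1.
have m3 : quat_measurable (fun w => g (refl 1 (-1) w)).
  by apply: (quat_measurable_comp mg); have [] := scales_refl n1 n2.
have m4 : quat_measurable (fun w => g (refl (-1) (-1) w)).
  by apply: (quat_measurable_comp mg); have [] := scales_refl n2 n2.
have mc (q : quat R) : quat_measurable (fun _ : V => q) by exact: quat_measurable_cst.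
split; apply: (quat_measurableZ (u := fun=> 4^-1)); first exact: measurable_cst.
- apply: quat_measurableB; first by do 3 apply: quat_measurableD => //.
  apply: quat_measurableM; last exact: mc.
  apply: quat_measurableM; first exact: mc.
  by apply: quat_measurableD => //; do 2 apply: quat_measurableB => //.
- exact: measurable_cst.
- apply: quat_measurableD.
    apply: quat_measurableM; first exact: mc.
    by apply: quat_measurableB => //; apply: quat_measurableD => //; apply: quat_measurableB.
  apply: quat_measurableM; last exact: mc.
  by do 2 apply: quat_measurableB => //; apply: quat_measurableD.
Qed.

(** The energy of the cosine and sine transforms, as a function of the Fourier
transform alone; this makes sense for L2 limits. *)
Definition penergy g w := nq (parity cos_part g w) + nq (parity sin_part g w).

Lemma measurable_penergy g : quat_measurable g -> measurable_fun setT (penergy g).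
Proof.
by move=> /quat_measurable_parity[m1 m2]; apply: measurable_funD; exact: measurable_nq.
Qed.

Lemma penergy_ge0 g w : 0 <= penergy g w.
Proof. by rewrite addr_ge0 ?nq_ge0. Qed.

(** Averaging over the four reflections does not change an integral with an even
weight, and on averages [parity_energy] applies. *)
Theorem integral_penergy g (om : V -> R) : quat_measurable g ->
  measurable_fun setT om -> (forall w, 0 <= om w) ->
  (forall e e' w, `|e| = 1 -> om (refl e e' w) = om w) ->
  (\int[nu]_w (penergy g w * om w)%:E = \int[nu]_w (nq (g w) * om w)%:E)%E.
Proof.
move=> mg mo o0 oe.
have n1 : `|1| = 1 :> R by rewrite normr1.
have n2 : `|-1| = 1 :> R by rewrite normrN normr1.
have mP := measurable_penergy mg; have mQ := measurable_nq mg.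
have avg (F : V -> R) : measurable_fun setT F -> (forall w, 0 <= F w) ->
    (4%:E * \int[nu]_w (F w * om w)%:E = \int[nu]_w
      ((F w + F (refl (-1) 1 w) + F (refl 1 (-1) w) + F (refl (-1) (-1) w)) * om w)%:E)%E.
  move=> mF F0.
  have mFo : measurable_fun setT (fun w => (F w * om w)%:E).
    by apply/measurable_EFinP; exact: measurable_funM.
  have Fo0 w : (0 <= (F w * om w)%:E)%E by rewrite lee_fin mulr_ge0.
  have H e e' : `|e| = 1 -> `|e'| = 1 ->
      measurable_fun setT (fun w => (F (refl e e' w) * om w)%:E) /\
      (\int[nu]_w (F w * om w)%:E = \int[nu]_w (F (refl e e' w) * om w)%:E)%E.
    move=> e1 e1'; have [mr _ /(_ _ mFo Fo0)] := scales_refl e1 e1'.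
    rewrite mul1e => E; split.
      apply/measurable_EFinP; apply: measurable_funM => //.
      exact: (measurableT_comp mF mr).
    by rewrite -E; apply: eq_integral => w _; rewrite oe.
  have [h2 e2] := H _ _ n2 n1; have [h3 e3] := H _ _ n1 n2; have [h4 e4] := H _ _ n2 n2.
  have P e e' w : (0 <= (F (refl e e' w) * om w)%:E)%E by rewrite lee_fin mulr_ge0.
  under [RHS]eq_integral do rewrite !mulrDl !EFinD.
  rewrite ge0_integralD//; last 2 first.
  - by move=> w _; rewrite !adde_ge0.
  - by apply: emeasurable_funD => //; apply: emeasurable_funD.
  rewrite ge0_integralD//; last 2 first.
  - by move=> w _; rewrite adde_ge0.
  - by apply: emeasurable_funD.
  rewrite ge0_integralD// -e2 -e3 -e4.
  have : (0 <= \int[nu]_w (F w * om w)%:E)%E by exact: integral_ge0.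
  move: (\int[nu]_w (F w * om w)%:E)%E => [x _| |//].
    by rewrite -!EFinD -EFinM; congr (_%:E); ring.
  by rewrite gt0_muley// lte_fin.
have hP := avg _ mP (penergy_ge0 g).
have hQ := avg _ mQ (fun w => nq_ge0 (g w)).
have H : (4%:E * \int[nu]_w (penergy g w * om w)%:E =
    4%:E * \int[nu]_w ((nq \o g) w * om w)%:E)%E.
  rewrite hP hQ; apply: eq_integral => w _; congr ((_ * _)%:E).
  rewrite /penergy /parity !refl_refl !(mulr1, mul1r, mulrNN) refl11.
  by rewrite -parity_energy.
have -> : (\int[nu]_w (penergy g w * om w)%:E = 4^-1%:E * (4%:E * \int[nu]_w (penergy g w * om w)%:E))%E.
  by rewrite muleA -EFinM mulVf ?mul1e.
by rewrite H muleA -EFinM mulVf ?mul1e.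
Qed.

Lemma dotv_split w z : dotv w z =
  dotv (usubmx w) (usubmx z) + dotv (dsubmx w) (dsubmx z).
Proof.
rewrite /dotv big_split_ord /=; congr (_ + _); apply: eq_bigr => i _.
  by rewrite !mxE.
by rewrite !mxE.
Qed.

Lemma measurable_halves :
  measurable_fun setT (@usubmx R n n 1) /\ measurable_fun setT (@dsubmx R n n 1).
Proof.
split; apply: measurable_cVP => i.
  rewrite (_ : (fun z => _) = fun z : V => z (lshift n i) 0); first exact: measurable_vcoord.
  by apply/funext => z; rewrite mxE.
rewrite (_ : (fun z => _) = fun z : V => z (rshift n i) 0); first exact: measurable_vcoord.
by apply/funext => z; rewrite mxE.
Qed.

Lemma dotvZl m e (x y : 'cV[R]_m) : dotv (e *: x) y = e * dotv x y.
Proof. by rewrite /dotv mulr_sumr; apply: eq_bigr => i _; rewrite mxE mulrA. Qed.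

(** [M] and [P] are the exponentials on the left at opposite angles, [M'] and [P'] those on
the right: sums and differences of them isolate cosines and sines. *)
Lemma parity_exp (c s c' s' : R) (q : quat R) :
  let M : quat R := c *: (1 : quat R) - s *: qI in let P : quat R := c *: (1 : quat R) + s *: qI in
  let M' : quat R := c' *: (1 : quat R) - s' *: qJ in let P' : quat R := c' *: (1 : quat R) + s' *: qJ in
  cos_part (M * q * M') (P * q * M') (M * q * P') (P * q * P') =
    (c * c' - s * s') *: q /\
  sin_part (M * q * M') (P * q * M') (M * q * P') (P * q * P') =
    (s * c' + c * s') *: q.
Proof.
move=> M P M' P'.
have MP : M + P = (2 * c) *: (1 : quat R) by rewrite /M /P addrACA addNr addr0 -scalerDl; congr (_ *: _); ring.
have MP' : M' + P' = (2 * c') *: (1 : quat R) by rewrite /M' /P' addrACA addNr addr0 -scalerDl; congr (_ *: _); ring.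
have dMP : M - P = (- (2 * s)) *: qI.
  by apply: quat_eqP; rewrite /M /P !quatE /=; ring.
have dMP' : M' - P' = (- (2 * s')) *: qJ.
  by apply: quat_eqP; rewrite /M' /P' !quatE /=; ring.
have [e1 e2 e3 e4] : [/\
    M * q * M' + P * q * M' + M * q * P' + P * q * P' = (M + P) * q * (M' + P'),
    M * q * M' - P * q * M' - M * q * P' + P * q * P' = (M - P) * q * (M' - P'),
    M * q * M' - P * q * M' + M * q * P' - P * q * P' = (M - P) * q * (M' + P') &
    M * q * M' + P * q * M' - M * q * P' - P * q * P' = (M + P) * q * (M' - P')].
  clear; move: M P M' P' => M P M' P'; split.
  - by rewrite [RHS]mulrDr !mulrDl addrA.
  - by rewrite [RHS]mulrBr !mulrBl opprB addrA [RHS]addrAC.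
  - by rewrite [RHS]mulrDr !mulrBl addrA.
  - by rewrite [RHS]mulrBr !mulrDl opprD addrA.
rewrite /cos_part /sin_part e1 e2 e3 e4 MP MP' dMP dMP'.
have I1 (x : R) (p : quat R) : x *: (1 : quat R) * p = x *: p.
  by apply: quat_eqP; rewrite !quatE /=; ring.
have J1 (y : R) (p : quat R) : p * (y *: (1 : quat R)) = y *: p.
  by apply: quat_eqP; rewrite !quatE /=; ring.
have I2 (x : R) (p : quat R) : qI * (x *: (qI : quat R) * p) = (- x) *: p.
  by apply: quat_eqP; rewrite !quatE /=; ring.
have J2 (y : R) (p : quat R) : p * (y *: (qJ : quat R)) * qJ = (- y) *: p.
  by apply: quat_eqP; rewrite !quatE /=; ring.
have r1 (x y : R) : x *: (1 : quat R) * q * (y *: (1 : quat R)) = (y * x) *: q.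
  by rewrite I1 J1 scalerA.
have r2 (x y : R) : qI * (x *: (qI : quat R) * q * (y *: (qJ : quat R))) * qJ = (y * x) *: q.
  by rewrite mulrA J2 I2 scalerA mulrNN.
have r3 (x y : R) : qI * (x *: (qI : quat R) * q * (y *: (1 : quat R))) = (- (x * y)) *: q.
  by rewrite mulrA I2 J1 scalerA mulrN mulrC.
have r4 (x y : R) : x *: (1 : quat R) * q * (y *: (qJ : quat R)) * qJ = (- (x * y)) *: q.
  by rewrite J2 I1 scalerA mulNr mulrC.
rewrite r1 r2 r3 r4 -scalerBl -scalerDl !scalerA.
by split; congr (_ *: _); field.
Qed.

Lemma quat_integral_cos_part (F1 F2 F3 F4 : V -> quat R) :
  quat_integrable nu F1 -> quat_integrable nu F2 ->
  quat_integrable nu F3 -> quat_integrable nu F4 ->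
  quat_integral nu (fun z => cos_part (F1 z) (F2 z) (F3 z) (F4 z)) =
  cos_part (quat_integral nu F1) (quat_integral nu F2)
    (quat_integral nu F3) (quat_integral nu F4).
Proof.
move=> i1 i2 i3 i4; rewrite /cos_part.
have j12 := quat_integrableD i1 i2; have j123 := quat_integrableD j12 i3.
have j := quat_integrableD j123 i4.
have k12 := quat_integrableB i1 i2; have k123 := quat_integrableB k12 i3.
have k := quat_integrableD k123 i4.
have kl := quat_integrableMl qI k; have kr := quat_integrableMr qJ kl.
rewrite quat_integralZ; last exact: quat_integrableB.
rewrite quat_integralB// quat_integralD// quat_integralD// quat_integralD//.
by rewrite quat_integralMr// quat_integralMl// quat_integralD// quat_integralB// quat_integralB.
Qed.

Lemma quat_integral_sin_part (F1 F2 F3 F4 : V -> quat R) :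
  quat_integrable nu F1 -> quat_integrable nu F2 ->
  quat_integrable nu F3 -> quat_integrable nu F4 ->
  quat_integral nu (fun z => sin_part (F1 z) (F2 z) (F3 z) (F4 z)) =
  sin_part (quat_integral nu F1) (quat_integral nu F2)
    (quat_integral nu F3) (quat_integral nu F4).
Proof.
move=> i1 i2 i3 i4; rewrite /sin_part.
have j12 := quat_integrableB i1 i2; have j123 := quat_integrableD j12 i3.
have j := quat_integrableB j123 i4.
have k12 := quat_integrableD i1 i2; have k123 := quat_integrableB k12 i3.
have k := quat_integrableB k123 i4.
have jl := quat_integrableMl qI j; have kr := quat_integrableMr qJ k.
rewrite quat_integralZ; last exact: quat_integrableD.
rewrite quat_integralD// quat_integralMl// quat_integralB// quat_integralD// quat_integralB//.
by rewrite quat_integralMr// quat_integralB// quat_integralB// quat_integralD.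
Qed.

(** [cos_part] and [sin_part] commute with the integral, and under the integral
[parity_exp] is the addition formula for [cos] and [sin] at [dotv w z]. *)
Theorem parity_QFT1 h w : quat_integrable nu h ->
  parity cos_part (QFT1 h) w = costr h w /\ parity sin_part (QFT1 h) w = sintr h w.
Proof.
move=> ih.
pose A z := 2 * pi * dotv (usubmx w) (usubmx z).
pose B z := 2 * pi * dotv (dsubmx w) (dsubmx z).
pose K e e' z := qexp qI (- (e * A z)) * h z * qexp qJ (- (e' * B z)).
have KE e e' : QFT1 h (refl e e' w) = quat_integral nu (K e e').
  apply: eq_quat_integral => z; rewrite /K /A /B /refl col_mxKu col_mxKd !dotvZl.
  by rewrite !(mulrCA e) !(mulrCA e') !mulrA.
have [mu md] := measurable_halves.
have mA : measurable_fun setT A.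
  by apply: measurable_funM => //; apply: measurable_dotv.
have mB : measurable_fun setT B.
  by apply: measurable_funM => //; apply: measurable_dotv.
have nqexp (u : quat R) t : qabs u = 1 -> q_re u = 0 -> qabs (qexp u t) = 1.
  move=> u1 u0; have := sqr_qabs u; rewrite u1 expr1n nqE u0 expr0n add0r => hu.
  rewrite qabsE (_ : nq _ = 1) ?sqrtr1// nqE /qexp !quatE u0 /= !(mulr0, mulr1, addr0, add0r).
  rewrite !exprMn -!addrA -!mulrDr addrA -hu mulr1.
  exact: cos2Dsin2.
have i1 : qabs (@qI R) = 1 by rewrite qabsE nqE /= expr0n expr1n !addr0 add0r sqrtr1.
have j1 : qabs (@qJ R) = 1 by rewrite qabsE nqE /= expr0n expr1n !addr0 add0r sqrtr1.
have iK e e' : quat_integrable nu (K e e').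
  apply: (le_quat_integrable _ _ (quat_integrable_qabs ih)).
    apply: quat_measurableM; first apply: quat_measurableM.
    - by apply: quat_measurable_qexp; apply: measurable_funN; apply: measurable_funM.
    - exact: ih.1.
    - by apply: quat_measurable_qexp; apply: measurable_funN; apply: measurable_funM.
  by move=> z; rewrite !qabsM !nqexp// mul1r mulr1.
have KE1 := KE 1 1; rewrite refl11 in KE1.
have [c1 c2] := quat_integrable_costr ih w.
rewrite /parity KE1 !KE.
have dw z : 2 * pi * dotv w z = A z + B z by rewrite dotv_split mulrDr.
have EM (u : quat R) x : qexp u (- x) = cos x *: (1 : quat R) - sin x *: u.
  by rewrite /qexp cosN sinN scaleNr.
have EP (u : quat R) x : qexp u (- - x) = cos x *: (1 : quat R) + sin x *: u.
  by rewrite opprK.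
split; [rewrite -quat_integral_cos_part//|rewrite -quat_integral_sin_part//];
  apply: eq_quat_integral => z; rewrite dw /K !(mul1r, mulN1r) !EP !EM.
- by rewrite (parity_exp _ _ _ _ _).1 cosD.
- by rewrite (parity_exp _ _ _ _ _).2 sinD.
Qed.

End reflections.

(** * Approximation and the Cauchy-Schwarz inequality *)

Section real_limits.
Context {R : realType}.
Implicit Types a b c x y : R.

(** The discriminant argument of the Cauchy-Schwarz inequality. *)
Lemma quadratic_bound a b c : 0 <= a -> 0 <= b -> 0 <= c ->
  (forall x, 0 < x -> 2 * c <= x * a + b / x) -> c ^+ 2 <= a * b.
Proof.
move=> a0 b0 c0 H; have [->|cn] := eqVneq c 0; first by rewrite expr0n mulr_ge0.
have cp : 0 < c by rewrite lt_neqAle eq_sym cn.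
have [a00|an] := eqVneq a 0.
  have bp : 0 < b / c + 1 by have := divr_ge0 b0 (ltW cp); lra.
  have := H _ bp; rewrite a00 mulr0 add0r ler_pdivlMr// mulrDr mulr1.
  have -> : 2 * c * (b / c) = 2 * b by field.
  lra.
have ap : 0 < a by rewrite lt_neqAle eq_sym an.
have := H _ (divr_gt0 cp ap).
have -> : c / a * a + b / (c / a) = c + a * b / c by field; rewrite an cn.
by move=> h; rewrite expr2 -ler_pdivlMr//; lra.
Qed.

(** To compare two numbers it is enough to bound their distance by errors of the form
that [nq2_dist] produces: [d] is chosen first, then [e] depending on it. *)
Lemma approx_eq x y S K : 0 <= S -> 0 <= K ->
  (forall d e, 0 < d -> 0 < e -> `|x - y| <= d * S + (1 + d^-1) * (K * e)) -> x = y.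
Proof.
move=> S0 K0 H; apply/eqP; rewrite -subr_eq0 -normr_le0 leNgt; apply/negP => D.
set D0 := `|x - y| in H D.
(* With [d] the first error is at most a quarter of the distance, then with [e] the
   second one is. *)
pose d := D0 / (4 * (S + 1)).
have S1 : 0 < S + 1 by lra.
have K1 : 0 < K + 1 by lra.
have d0 : 0 < d by rewrite divr_gt0// mulr_gt0.
have i0 : 0 < 1 + d^-1 by rewrite addr_gt0// invr_gt0.
pose e := D0 / (4 * ((1 + d^-1) * (K + 1))).
have e0 : 0 < e by rewrite divr_gt0// !mulr_gt0.
have := H d e d0 e0.
have h1 : d * S <= D0 / 4.
  have -> : D0 / 4 = d * (S + 1) by rewrite /d; field; rewrite gt_eqF.
  by rewrite ler_pM2l//; lra.
have h2 : (1 + d^-1) * (K * e) <= D0 / 4.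
  have -> : D0 / 4 = (1 + d^-1) * ((K + 1) * e).
    by rewrite /e; move: (1 + d^-1) i0 => I I0; field; rewrite !gt_eqF.
  by rewrite ler_pM2l// ler_pM2r//; lra.
lra.
Qed.

End real_limits.

Lemma measurable_Rintegral {R : realType} d1 d2 (T1 : measurableType d1)
    (T2 : measurableType d2) (m2 : {sigma_finite_measure set T2 -> \bar R})
    (F : T1 * T2 -> R) : measurable_fun setT F ->
  measurable_fun setT (fun x => \int[m2]_y F (x, y)).
Proof.
move=> mF; apply: (measurableT_comp (@fine_measurable R setT measurableT)).
have mE : measurable_fun setT (EFin \o F) by exact/measurable_EFinP.
rewrite (_ : (fun x => _) = (fun x => \int[m2]_y (EFin \o F)^\+ (x, y) -
  \int[m2]_y (EFin \o F)^\- (x, y))%E).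
  apply: emeasurable_funB.
  - apply: (measurable_fun_fubini_tonelli_F (EFin \o F)^\+%E).
      exact: measurable_funepos.
    by move=> z; exact: funepos_ge0.
  - apply: (measurable_fun_fubini_tonelli_F (EFin \o F)^\-%E).
      exact: measurable_funeneg.
    by move=> z; exact: funeneg_ge0.
apply/funext => x; rewrite integralE.
by congr (_ - _)%E; apply: eq_integral => y _; rewrite ?funeposE ?funenegE.
Qed.

Lemma quat_measurable_integral {R : realType} d1 d2 (T1 : measurableType d1)
    (T2 : measurableType d2) (m2 : {sigma_finite_measure set T2 -> \bar R})
    (F : T1 * T2 -> quat R) : quat_measurable F ->
  quat_measurable (fun x => quat_integral m2 (fun y => F (x, y))).
Proof.
move=> [F1 F2 F3 F4]; split.
- exact: (measurable_Rintegral m2 F1).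
- exact: (measurable_Rintegral m2 F2).
- exact: (measurable_Rintegral m2 F3).
- exact: (measurable_Rintegral m2 F4).
Qed.

Section cauchy_schwarz.
Context {R : realType} d (T : measurableType d) (mu : {measure set T -> \bar R}).
Implicit Types F G : T -> quat R.

Lemma quat_integrableM F G : quat_measurable F -> quat_measurable G ->
  (nq2 mu F < +oo)%E -> (nq2 mu G < +oo)%E -> quat_integrable mu (fun x => F x * G x).
Proof.
move=> mF mG iF iG.
have i1 := nq2_integrable mF iF; have i2 := nq2_integrable mG iG.
apply: (@le_quat_integrable _ _ _ _ _ (fun x => nq (F x) + nq (G x))).
- exact: quat_measurableM.
- move=> x; rewrite qabsM -!sqr_qabs.
  have := qabs_ge0 (F x); have := qabs_ge0 (G x).
  by move: (qabs _) (qabs _) => a b; nra.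
- by have := integrableD measurableT i1 i2.
Qed.

(** The inequality for functions dominated by a geometric mean, which covers both
products of L2 functions and weights; integrability comes with it. *)
Lemma cauchy_schwarz_geometric (a b p : T -> R) :
  measurable_fun setT p -> (forall x, 0 <= a x) -> (forall x, 0 <= b x) ->
  (forall x, 0 <= p x) -> (forall x, p x ^+ 2 <= a x * b x) ->
  mu.-integrable setT (EFin \o a) -> mu.-integrable setT (EFin \o b) ->
  mu.-integrable setT (EFin \o p) /\
  (\int[mu]_x p x) ^+ 2 <= \int[mu]_x a x * \int[mu]_x b x.
Proof.
move=> mp a0 b0 p0 pab ia ib.
have bnd x c : 0 < c -> 2 * p x <= c * a x + c^-1 * b x.
  move=> c0; have ci0 : 0 < c^-1 by rewrite invr_gt0.
  rewrite -(@ler_pXn2r _ 2)// ?nnegrE ?addr_ge0 ?mulr_ge0 ?(ltW c0) ?(ltW ci0)//.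
  have -> : (c * a x + c^-1 * b x) ^+ 2 =
      4 * (a x * b x) + (c * a x - c^-1 * b x) ^+ 2 by field; rewrite gt_eqF.
  have := pab x; have := sqr_ge0 (c * a x - c^-1 * b x).
  rewrite exprMn (_ : 2 ^+ 2 = 4 :> R); last by ring.
  move: (p x ^+ 2) ((c * a x - c^-1 * b x) ^+ 2) (a x * b x) => y z t.
  by lra.
have ip : mu.-integrable setT (EFin \o p).
  have := integrableD measurableT ia ib.
  move=> /(le_integrable_real (u := p) (v := fun x => a x + b x)); apply => // x.
  have := bnd x 1 ltr01; rewrite invr1 !mul1r ger0_norm//.
  by have := p0 x; lra.
split => //; apply: quadratic_bound; [exact: Rintegral_ge0..|].
move=> c c0.
have j1 := integrableZl measurableT c ia; have j2 := integrableZl measurableT c^-1 ib.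
have j3 := integrableZl measurableT 2 ip.
have -> : c * \int[mu]_x a x + (\int[mu]_x b x) / c = \int[mu]_x (c * a x + c^-1 * b x).
  by rewrite RintegralD// !RintegralZl// (mulrC _ c^-1).
rewrite -RintegralZl//; apply: le_Rintegral => //.
  by have := integrableD measurableT j1 j2.
by move=> x _; exact: bnd.
Qed.

Lemma cauchy_schwarz F G : quat_measurable F -> quat_measurable G ->
  (nq2 mu F < +oo)%E -> (nq2 mu G < +oo)%E ->
  nq (quat_integral mu (fun x => F x * G x)) <= fine (nq2 mu F) * fine (nq2 mu G).
Proof.
move=> mF mG iF iG; have iFG := quat_integrableM mF mG iF iG.
rewrite -sqr_qabs; apply: (@le_trans _ _ ((\int[mu]_x qabs (F x * G x)) ^+ 2)).
  rewrite ler_pXn2r ?nnegrE ?qabs_ge0//; first exact: qabs_quat_integral.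
  by apply: Rintegral_ge0 => x _; exact: qabs_ge0.
apply: (cauchy_schwarz_geometric (measurable_qabs iFG.1) _ _ _ _
  (nq2_integrable mF iF) (nq2_integrable mG iG)).2 => x /=;
  rewrite ?nq_ge0 ?qabs_ge0//.
by rewrite sqr_qabs nqM.
Qed.

End cauchy_schwarz.

(** * Young's inequality *)

Section L2norm_nq2.
Context {R : realType} (n : nat).
Local Notation V := 'cV[R]_n.
Local Notation nu := (@lebesgue_cV R n).

Lemma norm2_nq2 d (T : measurableType d) (mu : {measure set T -> \bar R}) (D : set T)
    (F : T -> quat R) :
  norm2 mu D F = sqrte (\int[mu]_(x in D) (nq (F x))%:E)%E.
Proof.
rewrite /norm2 poweR12_sqrt; last by apply: integral_ge0 => x _; rewrite lee_fin sqr_ge0.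
by congr sqrte; apply: eq_integral => x _; rewrite sqr_qabs.
Qed.

Lemma L2norm_sqr (f : V -> quat R) : (L2norm f ^+ 2 = nq2 nu f)%E.
Proof. by rewrite /L2norm norm2_nq2 sqr_sqrte// nq2_ge0. Qed.

Lemma L2norm_lty (f : V -> quat R) : (L2norm f < +oo)%E -> (nq2 nu f < +oo)%E.
Proof.
rewrite /L2norm /norm2 => h; have := lty_poweRy (_ : 2^-1 != 0 :> R) h.
rewrite /nq2; under eq_integral do rewrite sqr_qabs.
by apply; rewrite invr_neq0.
Qed.

Lemma L2norm_small (F : nat -> V -> quat R) (e : R) : 0 < e ->
  (fun k => L2norm (F k)) @ \oo --> 0%E ->
  \forall k \near \oo, (nq2 nu (F k) <= e%:E)%E.
Proof.
move=> e0 cF; have s0 : 0 < Num.sqrt e by rewrite sqrtr_gt0.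
have /fine_cvgP[fF cf] := cF.
have /cvgrPdist_lt/(_ _ s0) H := cf.
near=> k; rewrite -L2norm_sqr.
have fk : L2norm (F k) \is a fin_num by near: k.
have : `|0 - fine (L2norm (F k))| < Num.sqrt e by near: k.
rewrite sub0r normrN => h; rewrite -(fineK fk) -EFin_expe lee_fin.
rewrite -(sqr_sqrtr (ltW e0)) -[leLHS]real_normK ?num_real//.
by rewrite ler_pXn2r ?nnegrE// ltW.
Unshelve. all: by end_near. Qed.

End L2norm_nq2.

Section young.
Context {R : realType} (n : nat).
Local Notation nu := (@lebesgue_cV R n).
Local Notation V := 'cV[R]_n.
Implicit Types (f k : V -> quat R).

Lemma measurable_conv f k : quat_measurable f -> quat_measurable k ->
  quat_measurable (qconv f k).
Proof.
move=> mf mk.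
suff mF : quat_measurable (fun z : V * V => f (z.1 - z.2) * k z.2).
  exact: (quat_measurable_integral nu mF).
apply: quat_measurableM; last exact: quat_measurable_comp mk measurable_snd.
apply: (quat_measurable_comp mf).
by apply: measurable_subv; [exact: measurable_fst|exact: measurable_snd].
Qed.

Lemma corr_conv f k : quat_measurable f -> quat_measurable k ->
  qcorr f k = qconv f (fun y => k (0 - y)).
Proof.
move=> mf mk; apply/funext => t.
have sc := @scales_subl R n 0.
have [ms _ _] := sc.
have mt : measurable_fun setT (fun y : V => t + y).
  by apply: measurable_addv; [exact: measurable_cst|exact: measurable_id].
have [F1 F2 F3 F4] := quat_measurableM (quat_measurable_comp mf mt) mk.
have E (F : V -> R) : measurable_fun setT F ->
    \int[nu]_y F y = \int[nu]_y F (0 - y).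
  by move=> mF; rewrite (scales_Rintegral sc mF) mul1r.
have EF (q : quat R -> R) : \int[nu]_y q (f (t + (0 - y)) * k (0 - y)) =
    \int[nu]_y q (f (t - y) * k (0 - y)).
  by apply: eq_Rintegral => y _; rewrite sub0r.
rewrite /qcorr /qconv /quat_integral.
rewrite -!EF.
by congr Quat; [exact: (E _ F1)|exact: (E _ F2)|exact: (E _ F3)|exact: (E _ F4)].
Qed.

Variable f : V -> quat R.
Hypotheses (iF : quat_integrable nu f) (bF : exists2 C, 0 <= C & forall x, qabs (f x) <= C).

Let mF : quat_measurable f := iF.1.

Lemma bounded_integrable_L2 : (nq2 nu f < +oo)%E.
Proof.
have [C C0 bC] := bF.
have iC : nu.-integrable setT (EFin \o (fun x => C * qabs (f x))).
  by have := integrableZl measurableT C (quat_integrable_qabs iF).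
have /integrable_EFinP[_] : nu.-integrable setT (EFin \o (nq \o f)).
  apply: le_integrable_real iC; first exact: measurable_nq.
  move=> x /=; rewrite ger0_norm ?nq_ge0// -sqr_qabs expr2.
  by rewrite ler_wpM2r ?qabs_ge0.
by under eq_integral do rewrite /= ger0_norm ?nq_ge0//.
Qed.

Lemma translate_L2 t : quat_measurable (fun y : V => f (t - y)) /\
  (nq2 nu (fun y : V => f (t - y)%R) < +oo)%E.
Proof.
have [ms _ sc] := @scales_subl R n t.
split; first exact: quat_measurable_comp mF ms.
have mN : measurable_fun setT (fun x => (nq (f x))%:E).
  by apply/measurable_EFinP; exact: measurable_nq.
rewrite /nq2 (sc _ mN); last by move=> x; rewrite lee_fin nq_ge0.
by rewrite mul1e; exact: bounded_integrable_L2.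
Qed.

Lemma conv_integrable k t : quat_measurable k -> (nq2 nu k < +oo)%E ->
  quat_integrable nu (fun y : V => f (t - y) * k y).
Proof.
by move=> mk ik; have [m1 i1] := translate_L2 t; exact: quat_integrableM.
Qed.

Lemma convB k k' : quat_measurable k -> (nq2 nu k < +oo)%E ->
  quat_measurable k' -> (nq2 nu k' < +oo)%E ->
  qconv f (fun y => k y - k' y) = fun t => qconv f k t - qconv f k' t.
Proof.
move=> mk ik mk' ik'; apply/funext => t.
rewrite /qconv -quat_integralB; [|exact: conv_integrable|exact: conv_integrable].
by apply: eq_quat_integral => y; rewrite mulrBr.
Qed.

Let A := \int[nu]_x qabs (f x).

(** The convolution is bounded pointwise by the Cauchy-Schwarz inequality with
weight [qabs (f (t - y))]; the integral in [t] then falls on this weight. *)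
Lemma young k : quat_measurable k -> (nq2 nu k < +oo)%E ->
  (nq2 nu (qconv f k) <= (A ^+ 2)%:E * nq2 nu k)%E.
Proof.
move=> mk ik; have [C C0 bC] := bF.
have ifa := quat_integrable_qabs iF.
have mfa : measurable_fun setT (fun x => qabs (f x)) by exact: measurable_qabs.
have A0 : 0 <= A by apply: Rintegral_ge0 => x _; exact: qabs_ge0.
have mG : measurable_fun setT (fun z : V * V => qabs (f (z.1 - z.2)) * nq (k z.2)).
  apply: measurable_funM.
    apply: (measurableT_comp mfa).
    by apply: measurable_subv; [exact: measurable_fst|exact: measurable_snd].
  exact: (measurableT_comp (measurable_nq mk) measurable_snd).
have mGE : measurable_fun setT (fun z : V * V => (qabs (f (z.1 - z.2)) * nq (k z.2))%:E).
  exact/measurable_EFinP.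
have G0 (z : V * V) : (0 <= (qabs (f (z.1 - z.2)) * nq (k z.2))%:E)%E.
  by rewrite lee_fin mulr_ge0 ?qabs_ge0 ?nq_ge0.
have ptw t : ((nq (qconv f k t))%:E <=
    A%:E * \int[nu]_y (qabs (f (t - y)%R) * nq (k y))%:E)%E.
  have sc := @scales_subl R n t; have [ms _ _] := sc.
  have i1 : nu.-integrable setT (EFin \o (fun y : V => qabs (f (t - y)))).
    exact: (scales_integrable sc ifa).
  have ick : nu.-integrable setT (EFin \o (fun y => C * nq (k y))).
    by have := integrableZl measurableT C (nq2_integrable mk ik).
  have i2 : nu.-integrable setT (EFin \o (fun y : V => qabs (f (t - y)) * nq (k y))).
    apply: le_integrable_real ick.
      apply: measurable_funM; last exact: measurable_nq.
      exact: (measurableT_comp mfa ms).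
    by move=> y; rewrite ger0_norm ?mulr_ge0 ?qabs_ge0 ?nq_ge0// ler_wpM2r ?nq_ge0.
  have m1 : measurable_fun setT (fun y : V => qabs (f (t - y))) by exact: (measurableT_comp mfa ms).
  have mp : measurable_fun setT (fun y : V => qabs (f (t - y)) * qabs (k y)).
    by apply: measurable_funM => //; exact: measurable_qabs.
  have wp (y : V) : (qabs (f (t - y)) * qabs (k y)) ^+ 2 <=
      qabs (f (t - y)) * (qabs (f (t - y)) * nq (k y)).
    by rewrite exprMn [qabs (k y) ^+ 2]sqr_qabs mulrA -expr2.
  have [_ cs] := cauchy_schwarz_geometric mp (fun y => qabs_ge0 _)
    (fun y => mulr_ge0 (qabs_ge0 _) (nq_ge0 _))
    (fun y => mulr_ge0 (qabs_ge0 _) (qabs_ge0 _)) wp i1 i2.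
  have -> : (\int[nu]_y (qabs (f (t - y)%R) * nq (k y))%:E =
     (\int[nu]_y (qabs (f (t - y)) * nq (k y)))%:E)%E.
    by rewrite /Rintegral fineK//; exact: (integrable_fin_num _ i2).
  rewrite -EFinM lee_fin.
  rewrite (scales_Rintegral sc mfa) mul1r in cs.
  apply: le_trans cs; rewrite -sqr_qabs ler_pXn2r ?nnegrE ?qabs_ge0//.
    have := qabs_quat_integral (conv_integrable t mk ik).
    by under eq_Rintegral do rewrite qabsM.
  by apply: Rintegral_ge0 => y _; rewrite mulr_ge0 ?qabs_ge0.
have mI := measurable_fun_fubini_tonelli_F (m2 := nu) _ mGE G0.
apply: (@le_trans _ _ (\int[nu]_t (A%:E * \int[nu]_y (qabs (f (t - y)%R) * nq (k y))%:E))%E).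
  apply: ge0_le_integral => //.
  - by move=> t _; rewrite lee_fin nq_ge0.
  - by apply/measurable_EFinP; apply: measurable_nq; exact: measurable_conv.
  - exact: measurable_funeM.
pose I t := (\int[nu]_y (qabs (f (t - y)%R) * nq (k y))%:E)%E.
have I0 t : (0 <= I t)%E by apply: integral_ge0 => y _; exact: (G0 (t, y)).
have A0E : (0 <= A%:E)%E by rewrite lee_fin.
rewrite (@ge0_integralZl _ _ _ nu _ measurableT I mI A%:E (fun t _ => I0 t) A0E) /I.
have AE : (\int[nu]_x (qabs (f x))%:E = A%:E)%E.
  by rewrite /A /Rintegral fineK//; exact: (integrable_fin_num _ ifa).
have := fubini_tonelli (m1 := nu) (m2 := nu) _ mGE G0 => /= ->.
have E y : (\int[nu]_x (qabs (f (x - y)%R) * nq (k y))%:E = A%:E * (nq (k y))%:E)%E.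
  have [ms _ sc] := @scales_addr R n (- y).
  have mfE : measurable_fun setT (fun x => (qabs (f x))%:E) by exact/measurable_EFinP.
  under eq_integral do rewrite EFinM.
  rewrite ge0_integralZr//.
  - by rewrite (sc _ mfE) ?mul1e ?AE// => x; rewrite lee_fin qabs_ge0.
  - exact: (measurableT_comp mfE ms).
  - by move=> x _; rewrite lee_fin qabs_ge0.
  - by rewrite lee_fin nq_ge0.
under eq_integral do rewrite E.
rewrite ge0_integralZl//; last 2 first.
- by apply/measurable_EFinP; exact: measurable_nq.
- by move=> x _; rewrite lee_fin nq_ge0.
by rewrite muleA -EFinM -expr2.
Qed.

End young.

(** * The convolution identity for L2 kernels *)

(** An identity [s1 + s2 = c (a + b)] that holds for approximations of its terms
holds for the terms, up to the sum of the errors. *)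
Lemma perturbed_identity {R : realType}
    (c d I C K e s1h s2h s1 s2 ah bh a b v1 v2 : R) : 0 <= c -> 0 <= I ->
  `|s1h - s1| <= d * s1 + I * (K * e) -> `|s2h - s2| <= d * s2 + I * (K * e) ->
  `|ah - a| <= d * a + I * v1 -> `|bh - b| <= d * b + I * v2 ->
  v1 + v2 <= C * e -> s1h + s2h = c * (ah + bh) ->
  `|s1 + s2 - c * (a + b)| <=
    d * (s1 + s2 + c * (a + b)) + I * ((2 * K + c * C) * e).
Proof.
move=> c0 I0 k1 k2 k3 k4 Ev Eq.
have j : c * (`|ah - a| + `|bh - b|) <= c * (d * (a + b) + I * (C * e)).
  apply: ler_wpM2l => //; have := ler_wpM2l I0 Ev; lra.
have -> : s1 + s2 - c * (a + b) = c * ((ah - a) + (bh - b)) - ((s1h - s1) + (s2h - s2)).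
  by move: Eq; lra.
apply: le_trans (ler_normB _ _) _; rewrite normrM (ger0_norm c0).
have h1 := ler_normD (ah - a) (bh - b); have h2 := ler_normD (s1h - s1) (s2h - s2).
have h3 := ler_wpM2l c0 h1.
apply: le_trans (lerD (le_trans h3 j) (le_trans h2 (lerD k1 k2))) _.
by rewrite le_eqVlt; apply/orP; left; apply/eqP; ring.
Qed.

Section limit_identity.
Context {R : realType} (n : nat).
Local Notation V := 'cV[R]_(n + n).
Local Notation nu := (@lebesgue_cV R (n + n)).
Implicit Types (f g h phi : V -> quat R).

Lemma is_QFT_approx phi g (e : R) : is_QFT phi g -> 0 < e ->
  exists h, [/\ L1 h, L2 h, (nq2 nu (fun x => h x - phi x)%R <= e%:E)%E &
    (nq2 nu (fun w => QFT1 h w - g w)%R <= e%:E)%E].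
Proof.
move=> [_ [h [hh c1 c2]]] e0.
have n1 := L2norm_small e0 c1; have n2 := L2norm_small e0 c2.
have [k _ Hk] : \forall k \near \oo, (nq2 nu (fun x => h k x - phi x)%R <= e%:E)%E /\
    (nq2 nu (fun w => QFT1 (h k) w - g w)%R <= e%:E)%E.
  by near=> k; split; near: k.
have [a1 a2] := Hk k (leqnn k); have [h1 h2] := hh k.
by exists (h k).
Unshelve. all: by end_near. Qed.

Lemma measurable_QFT1 h : quat_measurable h -> quat_measurable (QFT1 h).
Proof.
move=> mh.
suff mF : quat_measurable (fun z : V * V =>
    qexp qI (- (2 * pi * dotv (usubmx z.1) (usubmx z.2))) * h z.2 *
    qexp qJ (- (2 * pi * dotv (dsubmx z.1) (dsubmx z.2)))).
  exact: (quat_measurable_integral nu mF).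
have [mu1 md1] := @measurable_halves R n.
apply: quat_measurableM; first apply: quat_measurableM.
- apply: quat_measurable_qexp; apply: measurable_funN; apply: measurable_funM; first exact: measurable_cst.
  by apply: measurable_dotv; [exact: (measurableT_comp mu1 measurable_fst)
    |exact: (measurableT_comp mu1 measurable_snd)].
- exact: quat_measurable_comp mh measurable_snd.
- apply: quat_measurable_qexp; apply: measurable_funN; apply: measurable_funM; first exact: measurable_cst.
  by apply: measurable_dotv; [exact: (measurableT_comp md1 measurable_fst)
    |exact: (measurableT_comp md1 measurable_snd)].
Qed.

Variables (Mi Mt : V -> V) (cM ct : R).
Hypotheses (sMi : scales nu Mi cM) (sMt : scales nu Mt ct)
  (dotM : forall l y, dotv l y = dotv (Mt l) (Mi y)).
Variables (f : V -> quat R) (m : V -> R).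
Hypotheses (fm : bochner f m) (iF : quat_integrable nu f)
  (bF : exists2 C, 0 <= C & forall x, qabs (f x) <= C).

Let mF : quat_measurable f := iF.1.
Let mMi : measurable_fun setT Mi. Proof. by have [] := sMi. Qed.
Let mMt : measurable_fun setT Mt. Proof. by have [] := sMt. Qed.
Let cM0 : 0 < cM. Proof. by have [] := sMi. Qed.
Let S (T : V -> V) (k : V -> quat R) := qconv f (k \o T).

(** The square root of [m] is absorbed in a quaternion-valued function, so that
the weighted energies are squared norms to which [nq2_dist] applies. *)
Let gop (op : quat R -> quat R -> quat R -> quat R -> quat R) g (l : V) : quat R :=
  Num.sqrt (m l) *: parity op g (Mt l).

Let weighted g := (\int[nu]_l (m l * (cM ^+ 2 * penergy g (Mt l)))%:E)%E.

Let transfer h l : quat_integrable nu h ->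
  costr (h \o Mi) l = cM *: costr h (Mt l) /\ sintr (h \o Mi) l = cM *: sintr h (Mt l).
Proof.
move=> ih; have [i1 i2] := quat_integrable_costr ih (Mt l).
have H (u : R -> R) : quat_integrable nu (fun y => u (2 * pi * dotv (Mt l) y) *: h y) ->
   quat_integral nu (fun y => u (2 * pi * dotv l y) *: h (Mi y)) =
   cM *: quat_integral nu (fun y => u (2 * pi * dotv (Mt l) y) *: h y).
  move=> [[m1 m2 m3 m4] _].
  have E (q : quat R -> R) : measurable_fun setT (q \o (fun y => u (2 * pi * dotv (Mt l) y) *: h y)) ->
      \int[nu]_y q (u (2 * pi * dotv l y) *: h (Mi y)) =
      cM * \int[nu]_y q (u (2 * pi * dotv (Mt l) y) *: h y).
    move=> mq; rewrite -(scales_Rintegral sMi mq).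
    by apply: eq_Rintegral => y _; rewrite /= dotM.
  by apply: quat_eqP; rewrite ?q_reZ ?q_iZ ?q_jZ ?q_kZ; apply: E.
by split; apply: H.
Qed.

Let identity_L1 h : quat_integrable nu h ->
  (nq2 nu (qconv f (h \o Mi)) + nq2 nu (qcorr f (h \o Mi)) =
   2%:E * weighted (QFT1 h))%E.
Proof.
move=> ih.
have ihM : quat_integrable nu (h \o Mi).
  split; first exact: quat_measurable_comp ih.1 mMi.
  have [_ _ /(_ (fun x => (qabs (h x))%:E)) ->] := sMi.
  - by rewrite lte_mul_pinfty ?lee_fin ?(ltW cM0)//; exact: ih.2.
  - by apply/measurable_EFinP; apply: measurable_qabs; exact: ih.1.
  - by move=> x; rewrite lee_fin qabs_ge0.
rewrite (convolution_energy fm iF bF ihM); congr (_ * _)%E.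
apply: eq_integral => l _; congr ((_ * _)%:E).
have [-> ->] := transfer l ih; rewrite !nqZ -mulrDr /penergy.
by have [-> ->] := parity_QFT1 (Mt l) ih.
Qed.

Let E g := (nq2 nu (gop (@cos_part R) g) + nq2 nu (gop (@sin_part R) g))%E.

Let m_ge0 l : 0 <= m l. Proof. by have [_ + _ _ _] := fm; apply. Qed.
Let mm : measurable_fun setT m. Proof. by have [] := fm. Qed.

Let measurable_gop g : quat_measurable g ->
  quat_measurable (gop (@cos_part R) g) /\ quat_measurable (gop (@sin_part R) g).
Proof.
move=> mg; have [m1 m2] := quat_measurable_parity mg.
have ms : measurable_fun setT (fun l => Num.sqrt (m l)).
  by apply: (measurableT_comp _ mm); apply: continuous_measurable_fun; exact: sqrt_continuous.
by split; apply: quat_measurableZ => //;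
  [exact: quat_measurable_comp m1 mMt|exact: quat_measurable_comp m2 mMt].
Qed.

Let nq_gop op g l : nq (gop op g l) = m l * nq (parity op g (Mt l)).
Proof. by rewrite /gop nqZ sqr_sqrtr. Qed.

Let weightedE g : quat_measurable g -> (weighted g = (cM ^+ 2)%:E * E g)%E.
Proof.
move=> mg; have [m1 m2] := measurable_gop mg.
rewrite /E /nq2 -ge0_integralD//; last 4 first.
- by move=> x _; rewrite lee_fin nq_ge0.
- by apply/measurable_EFinP; exact: measurable_nq.
- by move=> x _; rewrite lee_fin nq_ge0.
- by apply/measurable_EFinP; exact: measurable_nq.
rewrite -ge0_integralZl//; last 3 first.
- by apply: emeasurable_funD; apply/measurable_EFinP; exact: measurable_nq.
- by move=> x _; rewrite -EFinD lee_fin addr_ge0 ?nq_ge0.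
- by rewrite lee_fin sqr_ge0.
apply: eq_integral => l _; rewrite -EFinD -EFinM; congr (_%:E).
by rewrite !nq_gop /penergy; ring.
Qed.

Let bound_E : exists2 C, 0 <= C & forall g, quat_measurable g ->
  (E g <= C%:E * nq2 nu g)%E.
Proof.
have [_ _ [C bC] _ _] := fm.
have C0 : 0 <= C by exact: le_trans (m_ge0 0) (bC 0).
exists (C * ct) => [|g mg]; first by have [_ ct0 _] := sMt; rewrite mulr_ge0// ltW.
have mP := measurable_penergy mg.
have mPE : measurable_fun setT (fun w => (penergy g w)%:E) by exact/measurable_EFinP.
have P0 w : (0 <= (penergy g w)%:E)%E by rewrite lee_fin penergy_ge0.
have -> : nq2 nu g = (\int[nu]_w (penergy g w)%:E)%E.
  have := @integral_penergy R n g (fun=> 1) mg (@measurable_cst _ _ _ _ setT (1 : R)).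
  move=> /(_ (fun=> ler01) (fun _ _ _ _ => erefl)).
  by under eq_integral do rewrite mulr1; under [in RHS]eq_integral do rewrite mulr1.
have [_ _ /(_ _ mPE P0) H] := sMt.
have mPM : measurable_fun setT (fun w => (penergy g (Mt w))%:E).
  exact: (measurableT_comp mPE mMt).
have C0E : (0 <= C%:E)%E by rewrite lee_fin.
rewrite EFinM -muleA -H.
rewrite -(@ge0_integralZl _ _ _ nu _ measurableT _ mPM _ (fun w _ => P0 _) C0E).
have [m1 m2] := measurable_gop mg.
rewrite /E /nq2 -ge0_integralD//; last 4 first.
- by move=> x _; rewrite lee_fin nq_ge0.
- by apply/measurable_EFinP; exact: measurable_nq.
- by move=> x _; rewrite lee_fin nq_ge0.
- by apply/measurable_EFinP; exact: measurable_nq.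
apply: ge0_le_integral => //.
- by move=> x _; rewrite -EFinD lee_fin addr_ge0 ?nq_ge0.
- by apply: emeasurable_funD; apply/measurable_EFinP; exact: measurable_nq.
- by apply: measurable_funeM; exact: (measurableT_comp mPE mMt).
- move=> l _; rewrite -EFinD -EFinM lee_fin !nq_gop -mulrDr.
  by rewrite ler_wpM2r// penergy_ge0.
Qed.


Let gopB op g g' : (forall p1 p2 p3 p4 q1 q2 q3 q4,
    op (p1 - q1) (p2 - q2) (p3 - q3) (p4 - q4) = op p1 p2 p3 p4 - op q1 q2 q3 q4) ->
  gop op (fun w => g w - g' w) = fun l => gop op g l - gop op g' l.
Proof. by move=> opB; apply/funext => l; rewrite /gop /parity opB scalerBr. Qed.

Let cos_partB (p1 p2 p3 p4 q1 q2 q3 q4 : quat R) :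
  cos_part (p1 - q1) (p2 - q2) (p3 - q3) (p4 - q4) =
  cos_part p1 p2 p3 p4 - cos_part q1 q2 q3 q4.
Proof.
rewrite /cos_part -scalerBr; congr (_ *: _).
have -> : p1 - q1 + (p2 - q2) + (p3 - q3) + (p4 - q4) = p1 + p2 + p3 + p4 - (q1 + q2 + q3 + q4).
  by apply: quat_eqP; rewrite !quatE; ring.
have -> : p1 - q1 - (p2 - q2) - (p3 - q3) + (p4 - q4) = p1 - p2 - p3 + p4 - (q1 - q2 - q3 + q4).
  by apply: quat_eqP; rewrite !quatE; ring.
by rewrite mulrBr mulrBl !opprD !opprK addrACA.
Qed.

Let sin_partB (p1 p2 p3 p4 q1 q2 q3 q4 : quat R) :
  sin_part (p1 - q1) (p2 - q2) (p3 - q3) (p4 - q4) =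
  sin_part p1 p2 p3 p4 - sin_part q1 q2 q3 q4.
Proof.
rewrite /sin_part -scalerBr; congr (_ *: _).
have -> : p1 - q1 - (p2 - q2) + (p3 - q3) - (p4 - q4) = p1 - p2 + p3 - p4 - (q1 - q2 + q3 - q4).
  by apply: quat_eqP; rewrite !quatE; ring.
have -> : p1 - q1 + (p2 - q2) - (p3 - q3) - (p4 - q4) = p1 + p2 - p3 - p4 - (q1 + q2 - q3 - q4).
  by apply: quat_eqP; rewrite !quatE; ring.
by rewrite mulrBr mulrBl opprD addrACA.
Qed.

Let S_energy (T : V -> V) k : scales nu T cM -> quat_measurable k -> (nq2 nu k < +oo)%E ->
  [/\ quat_measurable (k \o T), (nq2 nu (k \o T) < +oo)%E, quat_measurable (S T k) &
    (nq2 nu (S T k) <= ((\int[nu]_x qabs (f x)) ^+ 2 * cM)%:E * nq2 nu k)%E].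
Proof.
move=> [mT _ sT] mk ik.
have mkE : measurable_fun setT (fun x => (nq (k x))%:E).
  by apply/measurable_EFinP; exact: measurable_nq.
have k0 x : (0 <= (nq (k x))%:E)%E by rewrite lee_fin nq_ge0.
have kE : (nq2 nu (k \o T) = cM%:E * nq2 nu k)%E by rewrite -(sT _ mkE k0).
have mkT : quat_measurable (k \o T) by exact: quat_measurable_comp mk mT.
have ikT : (nq2 nu (k \o T) < +oo)%E.
  by rewrite kE lte_mul_pinfty ?lee_fin ?(ltW cM0).
split => //; first exact: measurable_conv.
by have := young iF bF mkT ikT; rewrite kE muleA -EFinM.
Qed.

(** For an integrable kernel this is [convolution_energy], transported by [Mi]: the
transform of [h \o Mi] at [l] is [cM] times that of [h] at [Mt l].  For the L2 kernel
[phi], an integrable [h] is taken close to [phi], with transform close to [g].  The left side is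
continuous in the kernel by [young], the right side in the transform since [m] is
bounded ([bound_E]); [approx_eq] concludes. *)
Theorem conv_energy_limit phi g : quat_measurable phi -> (nq2 nu phi < +oo)%E ->
  is_QFT phi g ->
  (nq2 nu (qconv f (phi \o Mi)) + nq2 nu (qcorr f (phi \o Mi)) =
   2%:E * \int[nu]_l (m l * (cM ^+ 2 * penergy g (Mt l)))%:E)%E.
Proof.
move=> mphi iphi Q; have [[mg /L2norm_lty ig] _] := Q.
(* The correlation is the convolution with the kernel composed with [Mj]. *)
pose Mj := Mi \o (fun y => 0 - y).
have sMj : scales nu Mj cM.
  by have := scales_comp sMi (@scales_subl R (n + n) 0); rewrite mulr1.
pose K := (\int[nu]_x qabs (f x)) ^+ 2 * cM.
have K0 : 0 <= K by rewrite mulr_ge0 ?sqr_ge0// ltW.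
have [C C0 bC] := bound_E.
have corrE k : quat_measurable k -> qcorr f (k \o Mi) = S Mj k.
  by move=> mk; rewrite corr_conv//; exact: quat_measurable_comp mk mMi.
rewrite corrE// -/(S Mi phi) -/(weighted g) weightedE// /E.
have fin_E g' : quat_measurable g' -> (nq2 nu g' < +oo)%E ->
    (nq2 nu (gop (@cos_part R) g') < +oo)%E /\ (nq2 nu (gop (@sin_part R) g') < +oo)%E.
  move=> mg' ig'; have : (E g' < +oo)%E.
    by apply: le_lt_trans (bC _ mg') _; rewrite lte_mul_pinfty ?lee_fin.
  rewrite /E => h; split; apply: le_lt_trans h.
    by rewrite leeDl// nq2_ge0.
  by rewrite leeDr// nq2_ge0.
have [mA mB] := measurable_gop mg; have [iA iB] := fin_E g mg ig.
have [_ _ mS1 b1] := S_energy sMi mphi iphi; have [_ _ mS2 b2] := S_energy sMj mphi iphi.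
have iS1 : (nq2 nu (S Mi phi) < +oo)%E.
  by apply: le_lt_trans b1 _; rewrite lte_mul_pinfty ?lee_fin.
have iS2 : (nq2 nu (S Mj phi) < +oo)%E.
  by apply: le_lt_trans b2 _; rewrite lte_mul_pinfty ?lee_fin.
have fe F : (nq2 nu F < +oo)%E -> nq2 nu F = (fine (nq2 nu F))%:E.
  by move=> h; rewrite fineK// nq2_fin.
have f0 F : 0 <= fine (nq2 nu F) by rewrite fine_ge0// nq2_ge0.
rewrite (fe _ iS1) (fe _ iS2) (fe _ iA) (fe _ iB) -!EFinD -!EFinM.
congr (_%:E); pose c2 := 2 * cM ^+ 2.
have c20 : 0 <= c2 by rewrite mulr_ge0 ?sqr_ge0.
rewrite mulrA -/c2.
apply: (@approx_eq _ _ _ (fine (nq2 nu (S Mi phi)) + fine (nq2 nu (S Mj phi)) +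
    c2 * (fine (nq2 nu (gop (@cos_part R) g)) + fine (nq2 nu (gop (@sin_part R) g))))
  (2 * K + c2 * C)).
- by rewrite !addr_ge0// mulr_ge0// addr_ge0.
- by apply: addr_ge0; apply: mulr_ge0.
move=> d e d0 e0; have [h [L1h [mh /L2norm_lty ih] dh dQ]] := is_QFT_approx Q e0.
have mQ := measurable_QFT1 mh.
have iQ : (nq2 nu (QFT1 h) < +oo)%E.
  rewrite (_ : QFT1 h = fun w => (QFT1 h w - g w) + g w); last first.
    by apply/funext => w; rewrite subrK.
  apply: le_lt_trans (nq2D _ (quat_measurableB mQ mg) mg) _.
  apply: lte_add_pinfty; rewrite lte_mul_pinfty// ?lee_fin//.
  exact: le_lt_trans dQ (ltry _).
have [mAh mBh] := measurable_gop mQ; have [iAh iBh] := fin_E _ mQ iQ.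
have mdh := quat_measurableB mh mphi; have mdQ := quat_measurableB mQ mg.
have idh : (nq2 nu (fun x => h x - phi x)%R < +oo)%E by exact: le_lt_trans dh (ltry _).
have idQ : (nq2 nu (fun x => QFT1 h x - g x)%R < +oo)%E by exact: le_lt_trans dQ (ltry _).
have SD T : scales nu T cM -> (nq2 nu (fun t => S T h t - S T phi t)%R <= (K * e)%:E)%E.
  move=> sT; have [m1 i1 _ _] := S_energy sT mh ih; have [m2 i2 _ _] := S_energy sT mphi iphi.
  have [_ _ _] := S_energy sT mdh idh.
  rewrite -(convB iF bF m1 i1 m2 i2).
  move/le_trans; apply; rewrite (EFinM K e); exact: (lee_wpmul2l (K0 : (0 <= K%:E)%E) dh).
have Sd T : scales nu T cM -> quat_measurable (S T phi) -> (nq2 nu (S T phi) < +oo)%E ->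
    (nq2 nu (S T h) < +oo)%E /\
    `|fine (nq2 nu (S T h)) - fine (nq2 nu (S T phi))| <=
      d * fine (nq2 nu (S T phi)) + (1 + d^-1) * (K * e).
  move=> sT mST iST; have hd := SD T sT; have [_ _ mSh _] := S_energy sT mh ih.
  have hd' := le_lt_trans hd (ltry _).
  have [iSh h1] := nq2_dist d0 mST mSh iST hd'.
  split => //; apply: le_trans h1 _; rewrite lerD2l ler_wpM2l//.
    by rewrite addr_ge0// invr_ge0 ltW.
  by rewrite -lee_fin -fe.
have [jS1 k1] := Sd Mi sMi mS1 iS1; have [jS2 k2] := Sd Mj sMj mS2 iS2.
have Ed := bC _ mdQ; rewrite /E (gopB _ _ cos_partB) (gopB _ _ sin_partB) in Ed.
have {}Ed : (nq2 nu (fun l => gop (@cos_part R) (QFT1 h) l - gop (@cos_part R) g l)%R +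
    nq2 nu (fun l => gop (@sin_part R) (QFT1 h) l - gop (@sin_part R) g l)%R <= (C * e)%:E)%E.
  by apply: le_trans Ed _; rewrite (EFinM C e); exact: (lee_wpmul2l (C0 : (0 <= C%:E)%E) dQ).
have iDA : (nq2 nu (fun l => gop (@cos_part R) (QFT1 h) l - gop (@cos_part R) g l)%R < +oo)%E.
  by apply: le_lt_trans (ltry (C * e)); apply: le_trans Ed; rewrite leeDl// nq2_ge0.
have iDB : (nq2 nu (fun l => gop (@sin_part R) (QFT1 h) l - gop (@sin_part R) g l)%R < +oo)%E.
  by apply: le_lt_trans (ltry (C * e)); apply: le_trans Ed; rewrite leeDr// nq2_ge0.
rewrite (fe _ iDA) (fe _ iDB) -EFinD lee_fin in Ed.
have [_ k3] := nq2_dist d0 mA mAh iA iDA; have [_ k4] := nq2_dist d0 mB mBh iB iDB.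
have := identity_L1 (L1h : quat_integrable nu h).
rewrite corrE// -/(S Mi h) weightedE// /E.
rewrite (fe _ jS1) (fe _ jS2) (fe _ iAh) (fe _ iBh) -!EFinD -!EFinM => -[].
rewrite mulrA -/c2.
have I0 : 0 <= 1 + d^-1 by rewrite addr_ge0// invr_ge0 ltW.
move=> Eq; exact: (perturbed_identity c20 I0 k1 k2 k3 k4 Ed Eq).
Qed.

End limit_identity.

(** * Integration against a density *)

Section integral_density.
Local Open Scope ereal_scope.
Context d (T : measurableType d) (R : realType).
Variables (mu nu' : {measure set T -> \bar R}) (g : T -> R).
Hypotheses (mg : measurable_fun setT g) (g0 : forall x, (0 <= g x)%R).
Hypothesis nuE : forall A, measurable A -> nu' A = \int[mu]_(x in A) (g x)%:E.

Import HBNNSimple.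

(** Simple functions reduce the claim to measurable sets, then monotone
convergence. *)
Lemma ge0_integral_density (F : T -> \bar R) : measurable_fun setT F ->
  (forall x, 0 <= F x) -> \int[nu']_x F x = \int[mu]_x (F x * (g x)%:E).
Proof.
move=> mF F0; pose f_ := nnsfun_approx measurableT mF.
have cvgf x : (f_ n x)%:E @[n --> \oo] --> F x by apply: cvg_nnsfun_approx.
have mgE : measurable_fun setT (fun x => (g x)%:E) by exact/measurable_EFinP.
have gE0 x : 0 <= (g x)%:E by rewrite lee_fin.
transitivity (limn (fun n => \int[nu']_x (f_ n x)%:E)).
  rewrite -monotone_convergence//.
  - by apply: eq_integral => y _; apply/esym/cvg_lim.
  - by move=> n; exact/measurable_EFinP.
  - by move=> n y _; rewrite lee_fin.
  - by move=> y _ m n mn; rewrite lee_fin; exact/lefP/nd_nnsfun_approx.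
rewrite [X in limn X](_ : _ = (fun n => \int[mu]_x ((f_ n x)%:E * (g x)%:E))).
  rewrite -monotone_convergence//; last 3 first.
  - by move=> n; apply: emeasurable_funM => //; exact/measurable_EFinP.
  - by move=> n y _; rewrite mule_ge0// lee_fin.
  - by move=> y _ m n mn; apply: lee_wpmul2r => //; rewrite lee_fin; exact/lefP/nd_nnsfun_approx.
  apply: eq_integral => y _; apply/cvg_lim => //.
  by apply: cvgeZr => //; exact: cvgf.
apply/funext => n.
have mfn r : measurable (f_ n @^-1` [set r]) by exact: measurable_sfunP.
transitivity (\sum_(r \in range (f_ n)) \int[nu']_x (r * \1_(f_ n @^-1` [set r]) x)%:E).
  under eq_integral do rewrite fimfunE -fsumEFin//.
  rewrite ge0_integral_fsum//.
  - by move=> r; exact/measurable_EFinP/measurable_funM.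
  - by move=> r x _; rewrite nnfun_muleindic_ge0.
transitivity (\sum_(r \in range (f_ n)) \int[mu]_x ((r * \1_(f_ n @^-1` [set r]) x)%:E * (g x)%:E)).
  apply: eq_fsbigr => r _.
  have [r0|r0] := leP 0%R r; last first.
    by rewrite preimage_nnfun0//; under eq_integral do rewrite indic0 mulr0;
      under [RHS]eq_integral do rewrite indic0 mulr0 mul0e; rewrite !integral0.
  have r0E : 0 <= r%:E by rewrite lee_fin.
  have mi : measurable_fun setT (fun x => (\1_(f_ n @^-1` [set r]) x : R)%:E).
    exact/measurable_EFinP/measurable_indic.
  under eq_integral do rewrite EFinM.
  under [RHS]eq_integral do rewrite EFinM -muleA.
  rewrite [LHS](@ge0_integralZl _ _ _ _ _ measurableT _ mi _) => [|x _|//]; last by rewrite lee_fin.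
  rewrite [RHS](@ge0_integralZl _ _ _ _ _ measurableT _ (emeasurable_funM mi mgE) _) => [|x _|//]; last by rewrite mule_ge0// lee_fin.
  congr (_ * _); rewrite integral_indic// setIT nuE// integral_mkcond.
  apply: eq_integral => x _; rewrite patchE indicE.
  by case: ifP => _; rewrite ?mul1e ?mul0e.
rewrite -ge0_integral_fsum//.
- apply: eq_integral => x _; rewrite [in RHS]fimfunE -fsumEFin//.
  rewrite ge0_mule_fsuml// => r; rewrite nnfun_muleindic_ge0//.
- by move=> r; apply: emeasurable_funM => //; exact/measurable_EFinP/measurable_funM.
- by move=> r x _; rewrite mule_ge0// nnfun_muleindic_ge0.
Qed.

End integral_density.

(** * Dilation and shear matrices *)

Section dilations.
Context {R : realType} (m : nat).
Local Notation V := 'cV[R]_m.+1.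
Local Notation W := 'cV[R]_m.
Local Notation nu := (@lebesgue_cV R m.+1).

(** The diagonal matrix with first entry [a] and the others [r]. *)
Definition dil (a r : R) (x : V) : V := vcons (a * x ord0 0, r *: (vuncons x).2).

Lemma dil_aff a r : dil a r = aff (vcons (a : measurableTypeR R, const_mx r : W)) 0.
Proof.
apply/funext => x; apply: vcons_ext => [|i]; rewrite [RHS]mxE ?vcons0 ?vconsS.
  by rewrite mxE addr0.
by rewrite !mxE addr0.
Qed.

Lemma scales_dil a r : a != 0 -> r != 0 -> scales nu (dil a r) (`|a| * `|r| ^+ m)^-1.
Proof.
move=> a0 r0; rewrite dil_aff.
have -> : (`|a| * `|r| ^+ m)^-1 =
    (\prod_i `|vcons (a : measurableTypeR R, const_mx r : W) i 0|)^-1.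
  rewrite big_ord_recl vcons0; congr (_ * _)^-1.
  under eq_bigr do rewrite vconsS mxE.
  by rewrite prodr_const card_ord.
apply: scales_aff => i.
by case: (unliftP ord0 i) => [j ->|->]; rewrite ?vcons0// vconsS mxE.
Qed.

Lemma vuncons_tail (a : R) (x : W) : (vuncons (vcons (a : measurableTypeR R, x))).2 = x.
Proof. by rewrite vconsK. Qed.

Lemma vcons_eta (x : V) : x = vcons (x ord0 0 : measurableTypeR R, (vuncons x).2).
Proof. by rewrite -[LHS]vuncons_vcons. Qed.

Lemma dotv_vcons2 (a b : R) (x y : W) :
  dotv (vcons (a : measurableTypeR R, x)) (vcons (b : measurableTypeR R, y)) = a * b + dotv x y.
Proof. by rewrite dotv_vcons !vcons0 !vconsK. Qed.

Lemma dotvC (x y : W) : dotv x y = dotv y x.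
Proof. by apply: eq_bigr => i _; rewrite mulrC. Qed.

Lemma dotvDl (x y z : W) : dotv (x + y) z = dotv x z + dotv y z.
Proof. by rewrite /dotv -big_split; apply: eq_bigr => i _; rewrite mxE mulrDl. Qed.

(** The map applied to [l] is the transpose of the inverse of the one applied to [y]. *)
Lemma dot_dil_shear a r (s : W) (l y : V) : a != 0 -> r != 0 ->
  dotv l y = dotv (dil a r (tshear s l)) (dil a^-1 r^-1 (shear (- s) y)).
Proof.
move=> a0 r0; rewrite {1}(vcons_eta l) {1}(vcons_eta y) /dil /tshear /shear.
rewrite !vuncons_tail !vcons0 !dotv_vcons2.
set l0 := l ord0 0; set y0 := y ord0 0; set l' := (vuncons l).2; set y' := (vuncons y).2.
rewrite -scaleN1r dotvZl dotvZl (dotvC _ (r^-1 *: _)) dotvZl (dotvC y') dotvDl dotvZl.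
by field; rewrite a0 r0.
Qed.

Lemma mul_block_vcons (a b : R) (u : 'rV[R]_m) (x : W) (y : R) :
  block_mx (a%:M : 'M[R]_1) u (0 : W) (b%:M : 'M[R]_m) *m
    vcons (y : measurableTypeR R, x) =
  vcons (a * y + dotv u^T x : measurableTypeR R, b *: x).
Proof.
rewrite /vcons /= (mul_block_col (a%:M : 'M[R]_1) u 0 b%:M (y%:M) x).
congr col_mx; last by rewrite mul0mx add0r mul_scalar_mx.
apply/matrixP => i j; rewrite !ord1 mul_scalar_mx !mxE eqxx mulr1n mulr1n.
by congr (_ + _); apply: eq_bigr => k _; rewrite !mxE.
Qed.

Lemma unitmx_block (a b : R) (u : 'rV[R]_m) : a != 0 -> b != 0 ->
  (block_mx (a%:M : 'M[R]_1) u (0 : W) (b%:M : 'M[R]_m)) \in unitmx.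
Proof.
move=> a0 b0; rewrite unitmxE det_ublock !det_scalar unitrM !unitfE.
by rewrite !expf_neq0.
Qed.

(** The convention [0^-1 = 0] is the same for matrices and for numbers, so the
formula includes the degenerate dilation [a = 0]. *)
Lemma invmx_dilation (a r : R) (y : V) : (a == 0) = (r == 0) ->
  invmx (block_mx (a%:M : 'M[R]_1) (0 : 'rV_m) (0 : W) (r%:M : 'M[R]_m)) *m y =
  dil a^-1 r^-1 y.
Proof.
have [->|a0] := eqVneq a 0 => h.
  have -> : r = 0 by apply/eqP; rewrite -h.
  rewrite !raddf0 block_mx0 invmx_out; last by rewrite inE unitmxE det0 unitr0.
  rewrite mul0mx.
  rewrite /dil invr0 mul0r scale0r.
  by apply: vcons_ext => [|i]; rewrite ?vcons0 ?vconsS mxE ?mxE.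
have r0 : r != 0 by rewrite -h.
have U := unitmx_block 0 a0 r0.
apply: (canLR (mulKmx U)); rewrite /dil mul_block_vcons.
rewrite trmx0 {1}(vcons_eta y) mulrA divff// mul1r scalerA divff// scale1r.
by rewrite /dotv big1 ?addr0// => i _; rewrite mxE mul0r.
Qed.

Lemma invmx_shear (s : W) (y : V) :
  invmx (block_mx (1%:M : 'M[R]_1) (s^T : 'rV_m) (0 : W) (1%:M : 'M[R]_m)) *m y =
  shear (- s) y.
Proof.
have U := unitmx_block s^T (oner_neq0 R) (oner_neq0 R).
apply: (canLR (mulKmx U)); rewrite /shear mul_block_vcons.
rewrite trmxK {1}(vcons_eta y) mul1r scale1r -scaleN1r dotvZl mulN1r.
by congr vcons; congr pair; rewrite subrK.
Qed.

End dilations.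

(** * The shearlet transform as a convolution *)

Lemma scales_quat_integral {R : realType} d (T : measurableType d)
    (mu : {measure set T -> \bar R}) (phi : T -> T) (c : R) (F : T -> quat R) :
  scales mu phi c -> quat_measurable F ->
  quat_integral mu (F \o phi) = c *: quat_integral mu F.
Proof.
move=> sc [m1 m2 m3 m4]; apply: quat_eqP; rewrite ?q_reZ ?q_iZ ?q_jZ ?q_kZ.
- exact: scales_Rintegral sc m1.
- exact: scales_Rintegral sc m2.
- exact: scales_Rintegral sc m3.
- exact: scales_Rintegral sc m4.
Qed.

Lemma scales_nq2 {R : realType} d (T : measurableType d)
    (mu : {measure set T -> \bar R}) (phi : T -> T) (c : R) (F : T -> quat R) :
  scales mu phi c -> quat_measurable F -> (nq2 mu (F \o phi) = c%:E * nq2 mu F)%E.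
Proof.
move=> [_ _ sc] mF; rewrite /nq2 -sc//; last by move=> x; rewrite lee_fin nq_ge0.
by apply/measurable_EFinP; exact: measurable_nq.
Qed.

Lemma mulq_conjZ {R : realType} (p q : quat R) (b : R) :
  p * qconj (b *: q) = b *: (p * qconj q).
Proof. by apply: quat_eqP; rewrite !quatE /=; ring. Qed.

Section shearlet_transform.
Context {R : realType} (n : nat).
Local Notation V := 'cV[R]_(n.+1 + n.+1).
Local Notation W := 'cV[R]_(n + n.+1).
Local Notation N := (n.+1%:R : R).
Local Notation nu := (@lebesgue_cV R (n.+1 + n.+1)).
Local Notation P := (measurableTypeR R * W * V)%type.
Implicit Types (psi f : V -> quat R) (a : R).

(** The lower diagonal entry of the dilation matrix. *)
Definition signed_root a : R := Num.sg a * `|a| `^ (2 * N)^-1.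

(** The inverse of the shear-dilation matrix; [coshear] is the transpose of that
matrix, which acts on frequencies. *)
Definition unshear a (s : W) (x : V) : V := dil a^-1 (signed_root a)^-1 (shear (- s) x).

Definition coshear a (s : W) (x : V) : V := dil a (signed_root a) (tshear s x).

(** The modulus of the determinant of the dilation. *)
Definition jac a : R := `|a| * `|signed_root a| ^+ (n + n.+1).

Lemma normr_signed_root a : a != 0 -> `|signed_root a| = `|a| `^ (2 * N)^-1.
Proof.
by move=> a0; rewrite normrM normr_sg a0 mul1r ger0_norm// powR_ge0.
Qed.

Lemma normr_signed_root_gt0 a : a != 0 -> 0 < `|signed_root a|.
Proof. by move=> a0; rewrite normr_signed_root// powR_gt0// normr_gt0. Qed.

Lemma signed_root_eq0 a : (a == 0) = (signed_root a == 0).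
Proof.
have [->|a0] := eqVneq a 0; first by rewrite /signed_root sgr0 mul0r eqxx.
by apply/esym/negbTE; rewrite -normr_gt0 normr_signed_root_gt0.
Qed.

Lemma signed_root_neq0 a : a != 0 -> signed_root a != 0.
Proof. by rewrite signed_root_eq0. Qed.

Lemma signed_rootN a : signed_root (- a) = - signed_root a.
Proof. by rewrite /signed_root sgrN normrN mulNr. Qed.

Lemma unshearE a s x :
  invmx (dilation_mx n a) *m (invmx (shear_mx s) *m x) = unshear a s x.
Proof. by rewrite [X in _ *m X]invmx_shear [LHS]invmx_dilation// signed_root_eq0. Qed.

Lemma unshearN a s x : unshear a s (- x) = - unshear a s x.
Proof. by rewrite -!unshearE !mulmxN. Qed.

(** This is what makes the parameter [-a] produce a correlation. *)
Lemma unshear_opp a s x : unshear (- a) s x = - unshear a s x.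
Proof.
rewrite /unshear /dil signed_rootN !invrN.
by apply: vcons_ext => [|i]; rewrite [RHS]mxE !(vcons0, vconsS) ?mxE mulNr.
Qed.

Lemma scales_unshear a s : a != 0 -> scales nu (unshear a s) (jac a).
Proof.
move=> a0; have r0 := signed_root_neq0 a0.
have := scales_comp (scales_dil (n + n.+1) (invr_neq0 a0) (invr_neq0 r0)) (scales_shear (- s)).
by rewrite mulr1 !normfV exprVn -invfM invrK.
Qed.

Lemma scales_coshear a s : a != 0 -> scales nu (coshear a s) (jac a)^-1.
Proof.
move=> a0; have r0 := signed_root_neq0 a0.
by have := scales_comp (scales_dil (n + n.+1) a0 r0) (scales_tshear s); rewrite mulr1.
Qed.

Lemma dotv_shear a s (l x : V) : a != 0 -> dotv l x = dotv (coshear a s l) (unshear a s x).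
Proof. by move=> a0; exact: dot_dil_shear (signed_root_neq0 a0). Qed.

Definition amplitude a : R := `|a| `^ ((4 * N)^-1 - 1).

(** The normalisation of shearlets preserves the L2 norm. *)
Lemma amplitude_jac a : a != 0 -> amplitude a ^+ 2 * jac a = 1.
Proof.
move=> a0; have b0 : 0 < `|a| by rewrite normr_gt0.
have bn : `|a| != 0 by rewrite gt_eqF.
have E x y : `|a| `^ x * `|a| `^ y = `|a| `^ (x + y) by rewrite powRD// bn implybT.
rewrite /jac normr_signed_root// /amplitude -!powR_mulrn ?powR_ge0// -!powRrM.
rewrite -[X in _ * (X * _)](powRr1 (ltW b0)) !E -[RHS](powRr0 `|a|); congr (_ `^ _).
have -> : (n + n.+1)%:R = 2 * N - 1 :> R by rewrite natrD -natr1; ring.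
have : N != 0 by rewrite pnatr_eq0.
by move: (n.+1%:R : R) => y y0; field.
Qed.

Lemma shearletE psi a s t x :
  shearlet psi a s t x = amplitude a *: psi (unshear a s (x - t)).
Proof. by rewrite /shearlet unshearE. Qed.

Lemma measurable_normR d (T : measurableType d) (u : T -> R) :
  measurable_fun setT u -> measurable_fun setT (fun x => `|u x|).
Proof. by move=> mu; exact: measurableT_comp. Qed.

Lemma measurable_powRr d (T : measurableType d) (u : T -> R) (p : R) :
  measurable_fun setT u -> measurable_fun setT (fun x => u x `^ p).
Proof. by move=> mu; apply: (measurableT_comp (measurable_powR p)). Qed.

Lemma measurable_signed_root d (T : measurableType d) (u : T -> R) :
  measurable_fun setT u -> measurable_fun setT (fun x => signed_root (u x)).
Proof.
move=> mu.
rewrite (_ : (fun x => _) = (fun x => u x * `|u x|^-1 * `|u x| `^ (2 * N)^-1)).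
  apply: measurable_funM; last exact/measurable_powRr/measurable_normR.
  by apply: measurable_funM => //; exact/measurable_invR/measurable_normR.
apply/funext => x; congr (_ * _).
have [->|u0] := eqVneq (u x) 0; first by rewrite sgr0 mul0r.
by rewrite {2}(numEsg (u x)) -mulrA divff ?mulr1// normr_eq0.
Qed.

Lemma measurable_dil m d (T : measurableType d) (u v : T -> R) (g : T -> 'cV[R]_m.+1) :
  measurable_fun setT u -> measurable_fun setT v -> measurable_fun setT g ->
  measurable_fun setT (fun x => dil (u x) (v x) (g x)).
Proof.
move=> mu mv mg; apply: (measurableT_comp (@measurable_vcons R m)).
apply: measurable_fun_pair.
  by apply: measurable_funM => //; exact: (measurableT_comp (@measurable_vhead R m) mg).
by apply: measurable_scalev => //; exact: (measurableT_comp (@measurable_vtail R m) mg).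
Qed.

Lemma measurable_shear_comp m d (T : measurableType d) (s : T -> 'cV[R]_m)
    (g : T -> 'cV[R]_m.+1) : measurable_fun setT s -> measurable_fun setT g ->
  measurable_fun setT (fun x => shear (- s x) (g x)) /\
  measurable_fun setT (fun x => tshear (s x) (g x)).
Proof.
move=> ms mg.
have m0 := measurableT_comp (@measurable_vhead R m) mg.
have m1 := measurableT_comp (@measurable_vtail R m) mg.
split; apply: (measurableT_comp (@measurable_vcons R m)); apply: measurable_fun_pair => //.
  apply: measurable_funD => //; apply: measurable_dotv => //.
  rewrite (_ : (fun x => _) = (fun x => (-1) *: s x)).
    by apply: measurable_scalev => //; exact: measurable_cst.
  by apply/funext => x; rewrite scaleN1r.
by apply: measurable_addv => //; apply: measurable_scalev.
Qed.

Lemma measurable_unshear d (T : measurableType d) (u : T -> R) (s : T -> W) (g : T -> V) :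
  measurable_fun setT u -> measurable_fun setT s -> measurable_fun setT g ->
  measurable_fun setT (fun x => unshear (u x) (s x) (g x)).
Proof.
move=> mu ms mg; have [m1 _] := measurable_shear_comp ms mg.
apply: measurable_dil => //; first exact: measurable_invR.
exact/measurable_invR/measurable_signed_root.
Qed.

Lemma measurable_coshear d (T : measurableType d) (u : T -> R) (s : T -> W) (g : T -> V) :
  measurable_fun setT u -> measurable_fun setT s -> measurable_fun setT g ->
  measurable_fun setT (fun x => coshear (u x) (s x) (g x)).
Proof.
move=> mu ms mg; have [_ m1] := measurable_shear_comp ms mg.
by apply: measurable_dil => //; exact: measurable_signed_root.
Qed.

Lemma measurable_SH psi f : quat_measurable psi -> quat_measurable f ->
  quat_measurable (SH psi f).
Proof.
move=> mpsi mf.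
suff mF : quat_measurable (fun z : P * V =>
    f z.2 * qconj (shearlet psi z.1.1.1 z.1.1.2 z.1.2 z.2)).
  exact: (quat_measurable_integral nu mF).
apply: quat_measurableM; first exact: quat_measurable_comp mf measurable_snd.
apply: quat_measurable_conj.
rewrite (_ : (fun z : P * V => _) = fun z : P * V =>
  amplitude z.1.1.1 *: psi (unshear z.1.1.1 z.1.1.2 (z.2 - z.1.2))); last first.
  by apply/funext => z; rewrite shearletE.
have ma : measurable_fun setT (fun z : P * V => z.1.1.1 : R).
  exact: (measurableT_comp measurable_fst (measurableT_comp measurable_fst measurable_fst)).
have ms : measurable_fun setT (fun z : P * V => z.1.1.2).
  exact: (measurableT_comp measurable_snd (measurableT_comp measurable_fst measurable_fst)).
have mt : measurable_fun setT (fun z : P * V => z.1.2).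
  exact: (measurableT_comp measurable_snd measurable_fst).
apply: quat_measurableZ; first exact/measurable_powRr/measurable_normR.
apply: (quat_measurable_comp mpsi).
by apply: measurable_unshear => //; apply: measurable_subv.
Qed.

Lemma measurable_star psi : quat_measurable psi -> quat_measurable (star psi).
Proof.
move=> mpsi; apply: quat_measurable_conj; apply: (quat_measurable_comp mpsi).
have [m _ _] := @scales_subl R (n.+1 + n.+1) 0.
by move: m; congr measurable_fun; apply/funext => x; rewrite sub0r.
Qed.

Lemma nq2_star psi : quat_measurable psi -> nq2 nu (star psi) = nq2 nu psi.
Proof.
move=> mpsi; have := scales_nq2 (@scales_subl R (n.+1 + n.+1) 0) mpsi.
rewrite mul1e => <-; apply: eq_integral => x _.
by rewrite /star /= nq_conj sub0r.
Qed.

Section fixed_parameters.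
Variables (psi f : V -> quat R) (a : R) (s : W).
Hypotheses (mpsi : quat_measurable psi) (ipsi : (nq2 nu psi < +oo)%E)
  (mf : quat_measurable f) (if2 : (nq2 nu f < +oo)%E) (a0 : a != 0).

Let k : V -> quat R := star psi \o unshear a s.

Lemma star_unshear : quat_measurable k /\ (nq2 nu k < +oo)%E.
Proof.
have sc := scales_unshear s a0; have [m1 c0 _] := sc.
have mst := measurable_star mpsi.
split; first exact: quat_measurable_comp mst m1.
by rewrite (scales_nq2 sc mst) nq2_star// lte_mul_pinfty// lee_fin ltW.
Qed.

(** As [star psi] is the conjugate of the reflection of [psi], the integrand is
[f x * k (t - x)]; then [x] is replaced by [t - y]. *)
Lemma SH_qconv t : SH psi f (a : measurableTypeR R, s, t) = amplitude a *: qconv f k t.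
Proof.
have [mk ik] := star_unshear.
have scl := @scales_subl R (n.+1 + n.+1) t; have [ml _ _] := scl.
have mkt : quat_measurable (fun x : V => k (t - x)) by exact: quat_measurable_comp mk ml.
have ikt : (nq2 nu (fun x : V => k (t - x)%R) < +oo)%E.
  by have := scales_nq2 scl mk; rewrite mul1e => ->.
have iF := quat_integrableM mf mkt if2 ikt.
transitivity (amplitude a *: quat_integral nu (fun x => f x * k (t - x))).
  rewrite -quat_integralZ//; apply: eq_quat_integral => x /=.
  by rewrite shearletE mulq_conjZ /k /star /= -unshearN opprB.
have -> // : quat_integral nu (fun x : V => f x * k (t - x)) = qconv f k t.
have := scales_quat_integral scl iF.1; rewrite scale1r => <-.
by apply: eq_quat_integral => x; rewrite /comp subKr.
Qed.

End fixed_parameters.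

Lemma shearlet_L2 psi a (s : W) (t : V) : quat_measurable psi ->
  quat_measurable (shearlet psi a s t) /\
  (nq2 nu (shearlet psi a s t) <= nq2 nu psi)%E.
Proof.
move=> mpsi.
have E : shearlet psi a s t =
    fun x => amplitude a *: psi (unshear a s (x - t)).
  by apply/funext => x; exact: shearletE.
have scl := @scales_addr R (n.+1 + n.+1) (- t); have [mt _ _] := scl.
have mu : measurable_fun setT (unshear a s).
  by apply: measurable_unshear; [exact: measurable_cst|exact: measurable_cst|exact: measurable_id].
have mk : quat_measurable (fun x : V => psi (unshear a s (x - t))).
  exact: quat_measurable_comp (quat_measurable_comp mpsi mu) mt.
have mS : quat_measurable (shearlet psi a s t).
  by rewrite E; apply: quat_measurableZ => //; exact: measurable_cst.
split => //; rewrite E (nq2Z nu _ mk).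
have [->|a0] := eqVneq a 0.
  rewrite /amplitude normr0 powR0 ?expr0n ?mul0e ?nq2_ge0//.
  by rewrite subr_eq0 invr_eq1 -natrM pnatr_eq1 mulnS.
have := scales_nq2 scl (quat_measurable_comp mpsi mu).
rewrite /comp mul1e => ->.
rewrite (scales_nq2 (scales_unshear s a0) mpsi) muleA -EFinM.
by rewrite amplitude_jac// mul1e lexx.
Qed.

Section transform_bounds.
Variable psi : V -> quat R.
Hypotheses (mpsi : quat_measurable psi) (ipsi : (nq2 nu psi < +oo)%E).

Let conj_L2 (z : P) : quat_measurable (fun x => qconj (shearlet psi z.1.1 z.1.2 z.2 x)) /\
  (nq2 nu (fun x => qconj (shearlet psi z.1.1 z.1.2 z.2 x)) <= nq2 nu psi)%E.
Proof.
have [m1 i1] := shearlet_L2 z.1.1 z.1.2 z.2 mpsi.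
split; first exact: quat_measurable_conj.
by apply: le_trans i1; rewrite /nq2; under eq_integral do rewrite nq_conj.
Qed.

(** No shearlet has a larger norm than [psi] ([shearlet_L2]), so this is the
Cauchy-Schwarz inequality. *)
Lemma nq_SH_le f z : quat_measurable f -> (nq2 nu f < +oo)%E ->
  nq (SH psi f z) <= fine (nq2 nu f) * fine (nq2 nu psi).
Proof.
move=> mf if2; have [m1 i1] := conj_L2 z; have i2 := le_lt_trans i1 ipsi.
apply: le_trans (cauchy_schwarz mf m1 if2 i2) _.
apply: ler_wpM2l; first by apply: fine_ge0; exact: nq2_ge0.
by apply: fine_le => //; exact: nq2_fin.
Qed.

Lemma SHB f h z : quat_measurable f -> (nq2 nu f < +oo)%E ->
  quat_measurable h -> (nq2 nu h < +oo)%E ->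
  SH psi (fun x => f x - h x) z = SH psi f z - SH psi h z.
Proof.
move=> mf if2 mh ih2; have [m1 i1] := conj_L2 z; have i2 := le_lt_trans i1 ipsi.
rewrite /SH -quat_integralB; [|exact: quat_integrableM..].
by apply: eq_quat_integral => x; rewrite mulrBl.
Qed.

End transform_bounds.
End shearlet_transform.

(** * Integration over the shearlet parameters *)

Section tonelli3.
Context {R : realType} d1 d2 d3 (T1 : measurableType d1) (T2 : measurableType d2)
  (T3 : measurableType d3).
Variables (m1 : {sigma_finite_measure set T1 -> \bar R})
  (m2 : {sigma_finite_measure set T2 -> \bar R})
  (m3 : {sigma_finite_measure set T3 -> \bar R}).
Variable F : (T1 * T2 * T3)%type -> \bar R.
Hypotheses (mF : measurable_fun setT F) (F0 : forall z, (0 <= F z)%E).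
Local Open Scope ereal_scope.

Let mG : measurable_fun setT (fun z : T1 * T2 => \int[m3]_c F (z, c)).
Proof. exact: measurable_fun_fubini_tonelli_F. Qed.

Let G0 (z : T1 * T2) : 0 <= \int[m3]_c F (z, c).
Proof. exact: integral_ge0. Qed.

Lemma tonelli3_measurable :
  measurable_fun setT (fun a => \int[m2]_b \int[m3]_c F (a, b, c)).
Proof.
exact: (measurable_fun_fubini_tonelli_F (fun z => \int[m3]_c F (z, c)) mG G0).
Qed.

Lemma tonelli3 : \int[m1 \x m2 \x m3]_z F z =
  \int[m1]_a \int[m2]_b \int[m3]_c F (a, b, c).
Proof.
rewrite (fubini_tonelli1 (m1 := prodm m1 m2) F mF F0).
exact: (fubini_tonelli1 (fun z => \int[m3]_c F (z, c)) mG G0).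
Qed.

Lemma tonelli3_rotate_measurable :
  measurable_fun setT (fun c => \int[m1]_a \int[m2]_b F (a, b, c)).
Proof.
have := measurable_fun_fubini_tonelli_G (m1 := prodm m1 m2) F mF F0.
congr measurable_fun; apply/funext => c.
apply: (fubini_tonelli1 (fun z => F (z, c))) => //.
exact: measurableT_comp mF (pair2_measurable _).
Qed.

Lemma tonelli3_rotate : \int[m1]_a \int[m2]_b \int[m3]_c F (a, b, c) =
  \int[m3]_c \int[m1]_a \int[m2]_b F (a, b, c).
Proof.
rewrite -(fubini_tonelli1 (fun z => \int[m3]_c F (z, c)) mG G0).
rewrite (fubini_tonelli (m1 := prodm m1 m2) F mF F0).
apply: eq_integral => c _.
apply: (fubini_tonelli1 (fun z => F (z, c))) => //.
exact: measurableT_comp mF (pair2_measurable _).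
Qed.

End tonelli3.

Section off_zero.
Context {R : realType}.
Local Notation mu := (@lebesgue_measure R).

Lemma eq_integral_neq0 (F G : measurableTypeR R -> \bar R) :
  measurable_fun setT F -> measurable_fun setT G ->
  (forall a : R, a != 0 -> F a = G a) -> (\int[mu]_a F a = \int[mu]_a G a)%E.
Proof.
move=> mF mG FG; apply: ae_eq_integral => //.
exists [set 0%R]; split; [exact: measurable_set1|exact: lebesgue_measure_set1|].
by move=> a /= h; apply/eqP/negPn/negP => a0; apply: h => _; exact: FG.
Qed.

(** The hyperplane where the first coordinate vanishes is negligible. *)
Lemma eq_integral_head n (F G : 'cV[R]_n.+1 -> \bar R) :
  measurable_fun setT F -> measurable_fun setT G ->
  (forall x, 0 <= F x)%E -> (forall x, 0 <= G x)%E ->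
  (forall x : 'cV[R]_n.+1, x ord0 0 != 0 -> F x = G x) ->
  (\int[lebesgue_cV n.+1]_x F x = \int[lebesgue_cV n.+1]_x G x)%E.
Proof.
move=> mF mG F0 G0 FG; rewrite (ge0_integral_cVS mF F0) (ge0_integral_cVS mG G0).
apply: eq_integral_neq0.
- exact: measurable_ge0_integral_vconsl.
- exact: measurable_ge0_integral_vconsl.
- by move=> a a0; apply: eq_integral => x _; apply: FG; rewrite vcons0.
Qed.

Lemma ge0_integral_opp (G : measurableTypeR R -> \bar R) :
  measurable_fun setT G -> (forall a, 0 <= G a)%E ->
  (\int[mu]_a G (- a)%R = \int[mu]_a G a)%E.
Proof.
move=> mG G0; have n1 : -1 != 0 :> R by rewrite oppr_eq0 oner_eq0.
have := ge0_integral_affine 0 n1 mG G0.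
rewrite normrN normr1 invr1 mul1e => <-.
by apply: eq_integral => a _; rewrite mulN1r addr0.
Qed.

Lemma mule2 (x : \bar R) : (2%:E * x = x + x)%E.
Proof. by rewrite -mule2n mule_natl. Qed.

Lemma mule2I (x y : \bar R) : (2%:E * x = 2%:E * y)%E -> x = y.
Proof.
move=> /(congr1 (fun z => (2^-1)%:E * z)%E).
by rewrite !muleA -!EFinM mulVf ?pnatr_eq0// !mul1e.
Qed.

End off_zero.

Section energy.
Context {R : realType} (n : nat).
Local Notation V := 'cV[R]_(n.+1 + n.+1).
Local Notation W := 'cV[R]_(n + n.+1).
Local Notation mu := (@lebesgue_measure R).
Local Notation nuW := (@lebesgue_cV R (n + n.+1)).
Local Notation nu := (@lebesgue_cV R (n.+1 + n.+1)).
Local Notation P := (measurableTypeR R * W * V)%type.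
Variables (psi f g : V -> quat R) (m : V -> R).
Hypotheses (mpsi : quat_measurable psi) (ipsi : (nq2 nu psi < +oo)%E)
  (psig : is_QFT (star psi) g).
Hypotheses (fm : bochner f m) (iF : quat_integrable nu f)
  (bF : exists2 C, 0 <= C & forall x, qabs (f x) <= C).

Let mf : quat_measurable f := iF.1.
Let if2 : (nq2 nu f < +oo)%E. Proof. exact: bounded_integrable_L2. Qed.
Let mg : quat_measurable g. Proof. by have [[]] := psig. Qed.

Let cancel_weight (A J M E : R) : A * J = 1 -> A * (M * (J ^+ 2 * E)) = M * (J * E).
Proof. by move=> AJ; rewrite -[RHS]mul1r -AJ; ring. Qed.

(** The parameters [a] and [-a] together give the convolution and the correlation
with the same kernel, hence [conv_energy_limit] applies; one of the two factors [jac]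
cancels the squared amplitude. *)
Lemma fiber_energy (a : R) (s : W) : a != 0 ->
  (nq2 nu (fun t => SH psi f (a : measurableTypeR R, s, t)) +
   nq2 nu (fun t => SH psi f ((- a)%R : measurableTypeR R, s, t)) =
   2%:E * \int[nu]_l (m l * (jac n a * penergy g (coshear a s l)))%:E)%E.
Proof.
move=> a0; have na0 : - a != 0 by rewrite oppr_eq0.
have [mk ik] := star_unshear s mpsi ipsi a0.
set k := _ \o _ in mk ik.
have E1 : (fun t => SH psi f (a : measurableTypeR R, s, t)) =
    fun t => amplitude n a *: qconv f k t.
  by apply/funext => t; exact: SH_qconv.
have E2 : (fun t => SH psi f ((- a)%R : measurableTypeR R, s, t)) =
    fun t => amplitude n a *: qcorr f k t.
  have Ek : star psi \o unshear (- a) s = fun y => k (0 - y).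
    by apply/funext => y; rewrite /k /comp unshear_opp sub0r unshearN.
  apply/funext => t; rewrite (SH_qconv s mpsi ipsi mf if2 na0) Ek -(corr_conv mf mk).
  by rewrite /amplitude normrN.
have mc1 : quat_measurable (qconv f k) by exact: measurable_conv.
have mc2 : quat_measurable (qcorr f k).
  have [ms _ _] := @scales_subl R (n.+1 + n.+1) 0.
  rewrite (corr_conv mf mk); exact: (measurable_conv mf (quat_measurable_comp mk ms)).
have H1 : (nq2 nu (fun t => SH psi f (a : measurableTypeR R, s, t)) =
    (amplitude n a ^+ 2)%:E * nq2 nu (qconv f k))%E by rewrite E1; exact: nq2Z.
have H2 : (nq2 nu (fun t => SH psi f ((- a)%R : measurableTypeR R, s, t)) =
    (amplitude n a ^+ 2)%:E * nq2 nu (qcorr f k))%E by rewrite E2; exact: nq2Z.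
apply: etrans (congr2 (fun x y => x + y)%E H1 H2) _; cbv beta.
have ist : (nq2 nu (star psi) < +oo)%E by rewrite (nq2_star mpsi).
have := conv_energy_limit (scales_unshear s a0) (scales_coshear s a0)
  (fun l y => dotv_shear s l y a0) fm iF bF (measurable_star mpsi) ist psig.
rewrite -/k => H.
rewrite -ge0_muleDr ?nq2_ge0// H [LHS]muleCA; congr (_ * _)%E.
have [mc _ _] := scales_coshear s a0.
have [m1 m0 _ _ _] := fm.
have mK : measurable_fun setT
    (fun l => (m l * (jac n a ^+ 2 * penergy g (coshear a s l)))%:E).
  apply/measurable_EFinP; apply: measurable_funM => //; apply: measurable_funM => //.
  exact: (measurableT_comp (measurable_penergy mg) mc).
have K0 l : (0 <= (m l * (jac n a ^+ 2 * penergy g (coshear a s l)))%:E)%E.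
  by rewrite lee_fin !mulr_ge0 ?sqr_ge0 ?penergy_ge0.
have A0 : (0 <= (amplitude n a ^+ 2)%:E)%E by rewrite lee_fin sqr_ge0.
rewrite -(@ge0_integralZl _ _ _ nu _ measurableT _ mK _ (fun l _ => K0 l) A0).
apply: eq_integral => l _; rewrite -EFinM; congr (_%:E).
exact: (cancel_weight _ _ (amplitude_jac n a0)).
Qed.

Definition energy (F : V -> quat R) : \bar R :=
  (\int[@shear_measure R n]_z (nq (SH psi F z))%:E)%E.

Let d := (2 * n.+1)%N.

Let dens (a : R) : R := `|a| ^- d.+1.

Let mdens : measurable_fun setT (dens : measurableTypeR R -> R).
Proof.
apply: measurable_invR; apply: measurable_funX; exact: measurable_normR.
Qed.

Let dens_ge0 a : 0 <= dens a. Proof. by rewrite invr_ge0 exprn_ge0. Qed.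
Let densN a : dens (- a) = dens a. Proof. by rewrite /dens normrN. Qed.
Let dens0 : dens 0 = 0. Proof. by rewrite /dens normr0 expr0n invr0. Qed.

Let F (z : P) : \bar R := ((nq (SH psi f z))%:E * (dens z.1.1)%:E)%E.

Let mF : measurable_fun setT F.
Proof.
apply: emeasurable_funM; apply/measurable_EFinP.
  by apply: measurable_nq; exact: measurable_SH.
by apply: (measurableT_comp mdens); exact: (measurableT_comp measurable_fst measurable_fst).
Qed.

Let F0 z : (0 <= F z)%E. Proof. by rewrite mule_ge0 ?lee_fin ?nq_ge0. Qed.

Let energy_iterated : energy f = (\int[mu]_a \int[nuW]_s \int[nu]_t F (a, s, t))%E.
Proof.
rewrite -tonelli3//.
apply: (@ge0_integral_density _ _ _ (lebesgue_params n) (@shear_measure R n) (@shear_density R n)).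
- by apply/measurable_EFinP; exact: (@density_measurable R n).
- by move=> z; rewrite -lee_fin; exact: (@density_ge0 R n).
- by [].
- by apply/measurable_EFinP; apply: measurable_nq; exact: measurable_SH.
- by move=> z; rewrite lee_fin nq_ge0.
Qed.

Let fiber a s : (\int[nu]_t F (a, s, t) =
  nq2 nu (fun t => SH psi f (a : measurableTypeR R, s, t)) * (dens a)%:E)%E.
Proof.
rewrite /F/= /nq2.
apply: (@ge0_integralZr _ _ _ nu _ measurableT (fun t => (nq (SH psi f (a, s, t)))%:E)).
- apply/measurable_EFinP; apply: measurable_nq.
  exact: (quat_measurable_comp (measurable_SH mpsi mf) (pair1_measurable (a, s))).
- by move=> t _; rewrite lee_fin nq_ge0.
- by rewrite lee_fin.
Qed.

(** The weight at scale [a] of the spectral side, once the amplitudes are cancelled. *)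
Let w (a : R) : R := dens a * jac n a.

Let K (z : P) : \bar R := (m z.2 * (w z.1.1 * penergy g (coshear z.1.1 z.1.2 z.2)))%:E.

Let mK : measurable_fun setT K.
Proof.
have m1 : measurable_fun setT (fst \o fst : P -> measurableTypeR R).
  exact: (measurableT_comp measurable_fst measurable_fst).
have m2 : measurable_fun setT (snd \o fst : P -> W).
  exact: (measurableT_comp measurable_snd measurable_fst).
have mm : measurable_fun setT m by have [] := fm.
apply/measurable_EFinP; apply: measurable_funM.
  exact: (measurableT_comp mm measurable_snd).
apply: measurable_funM.
  apply: measurable_funM; first exact: (measurableT_comp mdens m1).
  apply: measurable_funM; first exact: measurable_normR.
  by apply: measurable_funX; apply: measurable_normR; exact: measurable_signed_root.
apply: (measurableT_comp (measurable_penergy mg)).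
by apply: measurable_coshear => //; exact: measurable_snd.
Qed.

Let m_ge0 l : 0 <= m l. Proof. by have [_ + _ _ _] := fm; apply. Qed.
Let jac_ge0 (a : R) : 0 <= jac n a. Proof. by apply: mulr_ge0; [exact: normr_ge0|apply: exprn_ge0; exact: normr_ge0]. Qed.
Let w_ge0 (a : R) : 0 <= w a. Proof. exact: mulr_ge0 (dens_ge0 a) (jac_ge0 a). Qed.

Let K0 z : (0 <= K z)%E.
Proof. by rewrite lee_fin !mulr_ge0// penergy_ge0. Qed.

Let fiber_sum (a : R) s : (\int[nu]_t F (a, s, t) + \int[nu]_t F ((- a)%R, s, t) =
  2%:E * \int[nu]_l K (a, s, l))%E.
Proof.
have [->|a0] := eqVneq a 0.
  have K00 l : K (0 : measurableTypeR R, s, l) = 0%E.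
    by rewrite /K/= /w dens0 !mul0r mulr0.
  have -> : (\int[nu]_l K (0%R : measurableTypeR R, s, l) = 0)%E.
    by apply: integral0_eq => l _; exact: K00.
  have F00 : (\int[nu]_t F (0%R : measurableTypeR R, s, t) = 0)%E.
    by apply: integral0_eq => t _; rewrite /F [X in (_ * X%:E)%E]dens0 mule0.
  by rewrite oppr0 F00 adde0 mule0.
rewrite (fiber a s) (fiber (- a) s) (densN a) -ge0_muleDl; [|exact: nq2_ge0|exact: nq2_ge0].
rewrite (fiber_energy s a0) -muleA; congr (_ * _)%E.
have [mc _ _] := scales_coshear s a0.
have [m1 m0 _ _ _] := fm.
have mH : measurable_fun setT (fun l => (m l * (jac n a * penergy g (coshear a s l)))%:E).
  apply/measurable_EFinP; apply: measurable_funM => //; apply: measurable_funM => //.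
  exact: (measurableT_comp (measurable_penergy mg) mc).
have H0 l : (0 <= (m l * (jac n a * penergy g (coshear a s l)))%:E)%E.
  by rewrite lee_fin !mulr_ge0 ?penergy_ge0.
have D0 : (0 <= (dens a)%:E)%E by rewrite lee_fin.
rewrite -(@ge0_integralZr _ _ _ nu _ measurableT _ mH _ (fun l _ => H0 l) D0).
apply: eq_integral => l _; rewrite /K /w /= -EFinM; congr (_%:E).
by rewrite -[LHS]mulrA -[X in _ = _ * X]mulrA [in RHS]mulrC [X in m l * X]mulrC; ring.
Qed.

Let G a : \bar R := (\int[nuW]_s \int[nu]_t F (a, s, t))%E.
Let mG : measurable_fun setT (G : measurableTypeR R -> _).
Proof. exact: tonelli3_measurable. Qed.
Let G0 a : (0 <= G a)%E.
Proof. by apply: integral_ge0 => s _; apply: integral_ge0. Qed.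

(** The measure in [a] is even, so doubling the energy adds the contributions of
[a] and [-a]; then the frequency is integrated last. *)
Let symmetrised : (2%:E * energy f =
  2%:E * \int[nu]_l \int[mu]_a \int[nuW]_s K (a, s, l))%E.
Proof.
have mGN : measurable_fun setT (fun a : measurableTypeR R => G (- a)%R).
  by apply: (measurableT_comp mG); exact: measurable_funN.
have EN := ge0_integral_opp mG G0.
rewrite mule2 energy_iterated -{2}EN.
rewrite -(ge0_integralD mu measurableT (fun a _ => G0 a) mG (fun a _ => G0 _) mGN).
have mFs (a : measurableTypeR R) : measurable_fun setT (fun s : W => \int[nu]_t F (a, s, t))%E.
  have m1 : measurable_fun setT (fun z : W * V => F (a, z.1, z.2)).
    apply: (measurableT_comp mF); apply: measurable_fun_pair; last exact: measurable_snd.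
    by apply: measurable_fun_pair; [exact: measurable_cst|exact: measurable_fst].
  exact: (measurable_fun_fubini_tonelli_F (m2 := nu) (fun z : W * V => F (a, z.1, z.2)) m1 (fun z => F0 _)).
have mKs (a : measurableTypeR R) : measurable_fun setT (fun s : W => \int[nu]_l K (a, s, l))%E.
  have m1 : measurable_fun setT (fun z : W * V => K (a, z.1, z.2)).
    apply: (measurableT_comp mK); apply: measurable_fun_pair; last exact: measurable_snd.
    by apply: measurable_fun_pair; [exact: measurable_cst|exact: measurable_fst].
  exact: (measurable_fun_fubini_tonelli_F (m2 := nu) (fun z : W * V => K (a, z.1, z.2)) m1 (fun z => K0 _)).
have Fs0 (a : R) s : (0 <= \int[nu]_t F (a, s, t))%E by exact: integral_ge0.
have Ks0 (a : R) s : (0 <= \int[nu]_l K (a, s, l))%E by exact: integral_ge0.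
have two0 : (0 <= 2%:E :> \bar R)%E by rewrite lee_fin.
have inner (a : R) : (G a + G (- a)%R = 2%:E * \int[nuW]_s \int[nu]_l K (a, s, l))%E.
  rewrite /G -(ge0_integralD nuW measurableT (fun s _ => Fs0 a s) (mFs a) (fun s _ => Fs0 _ s) (mFs _)).
  rewrite -(@ge0_integralZl _ _ _ nuW _ measurableT _ (mKs a) _ (fun s _ => Ks0 a s) two0).
  by apply: eq_integral => s _; exact: fiber_sum.
rewrite (eq_integral (fun a => 2%:E * \int[nuW]_s \int[nu]_l K (a, s, l))%E); last first.
  by move=> a _; exact: inner.
have mKa : measurable_fun setT
    (fun a : measurableTypeR R => \int[nuW]_s \int[nu]_l K (a, s, l))%E.
  exact: tonelli3_measurable.
have Ka0 (a : measurableTypeR R) : (0 <= \int[nuW]_s \int[nu]_l K (a, s, l))%E.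
  by apply: integral_ge0.
rewrite (@ge0_integralZl _ _ _ mu _ measurableT _ mKa _ (fun a _ => Ka0 a) two0).
by rewrite (tonelli3_rotate mu nuW nu mK K0).
Qed.

(** The energy of the Fourier transform on the hyperplane of first coordinate [b]. *)
Let slice (b : R) : \bar R := (\int[nuW]_x (penergy g (vcons (b : measurableTypeR R, x)))%:E)%E.

Let mpen : measurable_fun setT (fun x => (penergy g x)%:E).
Proof. by apply/measurable_EFinP; exact: measurable_penergy. Qed.

Let pen0 x : (0 <= (penergy g x)%:E)%E. Proof. by rewrite lee_fin penergy_ge0. Qed.

Let mslice : measurable_fun setT (slice : measurableTypeR R -> _).
Proof. exact: (measurable_ge0_integral_vconsl mpen pen0). Qed.

Let slice0 b : (0 <= slice b)%E. Proof. by apply: integral_ge0 => x _; exact: pen0. Qed.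

Local Notation hd l := ((l : 'cV[R]_(n + n.+1).+1) ord0 0%R).

(** For [l] fixed, [s |-> coshear a s l] sweeps affinely the hyperplane of first coordinate
[a * l_1], with Jacobian a power of [|r l_1|]; the powers of the signed root [r] cancel. *)
Let shear_integral (a : R) (l : V) : hd l != 0 -> (\int[nuW]_s K (a, s, l) =
  (m l * (`|a| ^- d * `|hd l| ^- (n + n.+1)))%:E * slice (a * hd l)%R)%E.
Proof.
move=> l0; have [->|a0] := eqVneq a 0.
  rewrite normr0 expr0n/= invr0 mul0r mulr0 mul0e.
  by apply: integral0_eq => s _; rewrite /K/= /w dens0 !mul0r mulr0.
have r0 := signed_root_neq0 n a0.
pose c : W := const_mx (signed_root n a * hd l).
pose t : W := signed_root n a *: (vuncons (l : 'cV_(n + n.+1).+1)).2.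
have Eco s : coshear a s l = vcons (a * hd l : measurableTypeR R, aff c t s).
  rewrite /coshear /dil /tshear vuncons_tail vcons0; congr (vcons (_, _)).
  by apply: cV_ext => i; rewrite !mxE; ring.
have c0 i : c i 0 != 0 by rewrite mxE mulf_neq0.
have mv := measurable_vconsr (a * hd l) mpen.
pose U x : \bar R := (penergy g (vcons ((a * hd l)%R : measurableTypeR R, x)))%:E.
have H : (\int[nuW]_s U (aff c t s) = (\prod_i `|c i 0%R|)^-1%:E * slice (a * hd l)%R)%E.
  exact: (ge0_integral_aff t c0 mv (fun x => pen0 _)).
transitivity (\int[nuW]_s ((m l * w a)%:E * U (aff c t s)))%E.
  by apply: eq_integral => s _; rewrite /K/= Eco mulrA EFinM.
have k0 : (0 <= (m l * w a)%:E)%E by rewrite lee_fin mulr_ge0.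
rewrite (@ge0_integralZl _ _ _ nuW _ measurableT _ (measurableT_comp mv (measurable_aff c t) : measurable_fun setT (U \o aff c t)) _ (fun x _ => pen0 _) k0).
rewrite H muleA -EFinM; congr (_%:E * _)%E.
rewrite -mulrA; congr (_ * _).
have -> : \prod_i `|c i 0| = `|signed_root n a| ^+ (n + n.+1) * `|hd l| ^+ (n + n.+1).
  under eq_bigr do rewrite mxE normrM.
  by rewrite prodr_const card_ord exprMn.
rewrite /w /dens /jac.
have A0 : `|a| != 0 by rewrite normr_eq0.
have B0 : `|signed_root n a| ^+ (n + n.+1) != 0 by rewrite expf_neq0// normr_eq0.
have C0 : `|hd l| ^+ (n + n.+1) != 0 by rewrite expf_neq0// normr_eq0.
move: A0 B0 C0; rewrite exprS.
move: (`|a|) (`|signed_root n a| ^+ _) (`|hd l| ^+ _) => A B C A0 B0 C0.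
have D0 : A ^+ d != 0 by rewrite expf_neq0.
move: (A ^+ d) D0 => D D0.
by field; rewrite A0 B0 C0 D0.
Qed.

Let om (x : V) : R := (`|fst_coord x| ^+ d)^-1.

Let C : \bar R := (\int[nu]_x (nq (g x) * om x)%:E)%E.

Let mom : measurable_fun setT om.
Proof.
apply: measurable_invR; apply: measurable_funX; apply: measurable_normR.
exact: measurable_vcoord.
Qed.

Let om_ge0 x : 0 <= om x. Proof. by rewrite invr_ge0 exprn_ge0. Qed.

Let fst_vcons (b : R) (x : W) : fst_coord (vcons (b : measurableTypeR R, x) : V) = b.
Proof.
rewrite /fst_coord -[RHS](vcons0 b x); congr (vcons _ _ 0).
exact: val_inj.
Qed.

(** The admissibility constant, integrated hyperplane by hyperplane. *)
Let sliceE : (C = \int[mu]_b ((`|b| ^- d)%:E * slice b))%E.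
Proof.
rewrite /C -(integral_penergy mg mom om_ge0); last first.
  move=> e e' x e1; rewrite /om /fst_coord /refl col_mxEu !mxE normrM e1 mul1r.
  by [].
have mI : measurable_fun setT (fun x => (penergy g x * om x)%:E).
  by apply/measurable_EFinP; apply: measurable_funM => //; exact: measurable_penergy.
have I0 x : (0 <= (penergy g x * om x)%:E)%E by rewrite lee_fin mulr_ge0 ?penergy_ge0.
rewrite (ge0_integral_cVS mI I0); apply: eq_integral => b _.
under eq_integral do rewrite /om fst_vcons mulrC EFinM.
apply: (@ge0_integralZl _ _ _ nuW _ measurableT _ (measurable_vconsr b mpen) _ (fun x _ => pen0 _)).
by rewrite lee_fin invr_ge0 exprn_ge0.
Qed.

Let C0 : (0 <= C)%E.
Proof. by apply: integral_ge0 => x _; rewrite lee_fin mulr_ge0 ?nq_ge0. Qed.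

(** The substitution of [b] for [a * l_1]: the powers of [|l_1|] cancel, so that the
result depends on [l] through [m l] only. *)
Let dilation_integral (l : V) : hd l != 0 ->
  (\int[mu]_a \int[nuW]_s K (a, s, l) = C * (m l)%:E)%E.
Proof.
move=> l0; have n0 : `|hd l| != 0 by rewrite normr_eq0.
have n1 : `|hd l| ^+ (n + n.+1) != 0 by rewrite expf_neq0.
pose H b : \bar R := ((`|b| ^- d)%:E * slice b)%E.
have mH : measurable_fun setT (H : measurableTypeR R -> _).
  apply: emeasurable_funM => //; apply/measurable_EFinP; apply: measurable_invR.
  by apply: measurable_funX; exact: measurable_normR.
have H0 b : (0 <= H b)%E by rewrite mule_ge0// lee_fin invr_ge0 exprn_ge0.
have E a : (\int[nuW]_s K (a, s, l) =
    (m l * `|hd l|)%:E * H (hd l * a + 0)%R)%E.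
  rewrite shear_integral// /H muleA -EFinM addr0 [(a * _)%R]mulrC; congr (_%:E * _)%E.
  rewrite -mulrA; congr (_ * _); rewrite normrM exprMn.
  have -> : `|hd l| ^+ d = `|hd l| ^+ (n + n.+1) * `|hd l|.
    by rewrite -exprSr; congr (_ ^+ _); rewrite /d mul2n -addnn.
  have [->|a0] := eqVneq a 0; first by rewrite normr0 expr0n/= invr0 !(mul0r, mulr0, invr0).
  have a1 : `|a| ^+ d != 0 by rewrite expf_neq0// normr_eq0.
  by field; rewrite n0 n1 a1.
under eq_integral do rewrite E.
have k0 : (0 <= (m l * `|hd l|)%:E)%E by rewrite lee_fin mulr_ge0.
have mHa : measurable_fun setT (fun a : measurableTypeR R => H (hd l * a + 0)%R).
  exact: (measurableT_comp mH (measurable_affine _ _)).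
rewrite (@ge0_integralZl _ _ _ mu _ measurableT _ mHa _ (fun x _ => H0 _) k0).
rewrite (ge0_integral_affine 0 l0 mH H0) muleA -EFinM -mulrA divff// mulr1.
by rewrite muleC -sliceE.
Qed.

(** [bochner] at [z = 0]. *)
Let integral_density : (\int[nu]_l (m l)%:E = nq2 nu f)%E.
Proof.
have [mm _ _ im /(_ 0) H] := fm.
have -> : (\int[nu]_l (m l)%:E = (\int[nu]_l m l)%:E)%E.
  by rewrite /Rintegral fineK//; exact: (integrable_fin_num _ im).
rewrite -(fineK (nq2_fin if2)); congr (_%:E).
transitivity (\int[nu]_l (m l * cos (2 * pi * dotv l 0))).
  apply: eq_Rintegral => l _; rewrite /dotv big1 ?mulr0 ?cos0 ?mulr1// => i _.
  by rewrite mxE mulr0.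
rewrite -H /nq2 /Rintegral; congr fine; apply: eq_integral => t _.
by rewrite addr0.
Qed.

(** Every frequency [l] off a hyperplane contributes [C * m l], and the integral of
[m] is the energy of [f]. *)
Theorem energy_bochner : (energy f = C * nq2 nu f)%E.
Proof.
apply: mule2I; rewrite symmetrised; congr (_ * _)%E.
have [mm _ _ im _] := fm.
have mmE : measurable_fun setT (fun l => (m l)%:E) by exact/measurable_EFinP.
have m0E l : (0 <= (m l)%:E)%E by rewrite lee_fin.
rewrite -integral_density.
rewrite -(@ge0_integralZl _ _ _ nu _ measurableT _ mmE _ (fun x _ => m0E x) C0).
apply: (@eq_integral_head R (n + n.+1) (fun l => \int[mu]_a \int[nuW]_s K (a, s, l))%E (fun l => C * (m l)%:E)%E).
- exact: (tonelli3_rotate_measurable mu nuW mK K0).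
- exact: measurable_funeM.
- by move=> l; apply: integral_ge0 => a _; apply: integral_ge0 => s _.
- by move=> l; exact: mule_ge0.
- exact: dilation_integral.
Qed.

End energy.

(** * Boxes generate the Borel sets *)

Lemma itv_oc_setI {R : realType} (a b u v x : R) :
  (Num.max a b < x) &&
    (x <= Num.max a b + `|Num.max 0 (Num.min u v - Num.max a b)|) =
  ((a < x) && (x <= u)) && ((b < x) && (x <= v)).
Proof.
set c := Num.max a b; set m := Num.min u v.
rewrite ger0_norm ?le_max ?lexx// addr_maxr addr0 [c + (m - c)]addrC subrK.
rewrite /c gt_max andbACA -le_min -/m; case: (boolP ((a < x) && (b < x))) => //= /andP[ax bx].
by rewrite le_max -/c [x <= c]leNgt /c gt_max ax bx.
Qed.

Section boxes.
Context {R : realType} (n : nat).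
Local Notation V := 'cV[R]_n.
Local Notation nu := (@lebesgue_cV R n).
Implicit Types (a p x : V).

Definition in_box a p x := [forall i, (a i 0 < x i 0) && (x i 0 <= a i 0 + `|p i 0|)].

Lemma boxfE a p x : boxf a p x = (in_box a p x)%:R.
Proof.
rewrite /boxf /in_box; case: forallP => [h|h].
  by rewrite big1// => i _; rewrite /ind1 h.
have [i hi] : exists i, ~~ ((a i 0 < x i 0) && (x i 0 <= a i 0 + `|p i 0|)).
  by apply/existsP; rewrite -negb_forall; apply/forallP.
by rewrite (bigD1 i)//= {1}/ind1 (negbTE hi) mul0r.
Qed.

Definition boxes : set (set V) :=
  [set B | exists a p, forall x, (\1_B x : R) = boxf a p x].

Lemma boxes_in_box a p : boxes [set x | in_box a p x].
Proof. by exists a, p => x; rewrite indicE boxfE; congr (_ %:R); rewrite mem_setE. Qed.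

Lemma measurable_boxes : boxes `<=` @measurable _ V.
Proof.
move=> B [a [p Bap]].
rewrite (_ : B = boxf a p @^-1` [set 1]).
  by rewrite -[X in measurable X]setTI; apply: measurable_boxf => //; exact: measurable_set1.
apply/seteqP; split => x /=; rewrite -Bap indicE.
  by move=> /mem_set ->.
by case: (boolP (x \in B)) => [/set_mem//|_] /esym/eqP; rewrite oner_eq0.
Qed.

Lemma boxes_setI : setI_closed boxes.
Proof.
move=> A B [a [p Aap]] [b [q Bbq]].
pose c : V := \col_i Num.max (a i 0) (b i 0).
pose r : V := \col_i Num.max 0 (Num.min (a i 0 + `|p i 0|) (b i 0 + `|q i 0|) - c i 0).
exists c, r => x; rewrite indicI /= Aap Bbq !boxfE -natrM mulnb; congr (_ %:R).
congr nat_of_bool; apply/andP/forallP => [[/forallP h1 /forallP h2] i|h].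
  by rewrite !mxE itv_oc_setI h1 h2.
by split; apply/forallP => i; have := h i; rewrite !mxE itv_oc_setI => /andP[].
Qed.

Let slab i u v (k : nat) : V * V :=
  (\col_j (if j == i then u else - k%:R), \col_j (if j == i then v - u else k%:R + k%:R)).

Lemma slab_cover i u v : u <= v -> (fun x : V => x i 0) @^-1` [set` `]u, v]%R] =
  \bigcup_k [set x | in_box (slab i u v k).1 (slab i u v k).2 x].
Proof.
move=> uv; apply/seteqP; split => x /=.
  rewrite in_itv/= => /andP[ux xv].
  exists (Num.truncn (\sum_j `|x j 0|)).+1 => //=; apply/forallP => j; rewrite !mxE.
  case: eqVneq => [->|ji]; first by rewrite ger0_norm ?subr_ge0// ux/= addrC subrK.
  rewrite ger0_norm ?addr_ge0// addKr.
  have : `|x j 0| < (Num.truncn (\sum_j `|x j 0|)).+1%:R.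
    apply: le_lt_trans (truncnS_gt _).
    by rewrite (bigD1 j)//= lerDl sumr_ge0.
  by rewrite ltr_norml => /andP[-> /ltW].
move=> [k _ /= /forallP/(_ i)]; rewrite !mxE eqxx.
by rewrite ger0_norm ?subr_ge0// in_itv/= addrC subrK.
Qed.

(** The Borel sets of each coordinate are generated by half-open intervals, the
preimages of which are countable unions of boxes. *)
Lemma measurable_cVE : @measurable _ V = <<s boxes >>.
Proof.
apply/seteqP; split; last first.
  by apply: smallest_sub; [exact: sigma_algebra_measurable|exact: measurable_boxes].
apply: smallest_sub; first exact: smallest_sigma_algebra.
move=> A; rewrite -bigcup_seq/= => -[i _ [B mB <-]]; rewrite setTI.
pose H : set (set R) := [set B | <<s boxes >> ((fun x : V => x i 0) @^-1` B)].
suff : @measurable _ (measurableTypeR R) `<=` H by apply.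
have [S0 SC SU] := smallest_sigma_algebra setT boxes.
apply: smallest_sub.
  split; rewrite /H /=.
  - by rewrite preimage_set0.
  - by move=> X SX; rewrite setTD -preimage_setC -setTD; exact: SC.
  - by move=> X SX; rewrite preimage_bigcup; exact: SU.
move=> _ [[u v] _ <-] /=; rewrite /H /=.
have [uv|vu] := leP u v; last by rewrite set_itv_ge ?preimage_set0// bnd_simp -leNgt ltW.
by rewrite slab_cover//; apply: SU => k; apply: sub_gen_smallest; exact: boxes_in_box.
Qed.

End boxes.

(** * Density of step functions *)

Section step_density.
Import HBNNSimple.
Context {R : realType} (n : nat).
Local Notation V := 'cV[R]_n.
Local Notation nu := (@lebesgue_cV R n).
Implicit Types (f g : V -> quat R) (u : V -> R) (q : quat R).

Definition approximable f := [/\ quat_measurable f, (nq2 nu f < +oo)%E &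
  forall e : R, 0 < e -> exists s, (nq2 nu (fun x => f x - stepf s x)%R <= e%:E)%E].

Lemma approximable_step s : approximable (stepf s).
Proof.
split; [exact: stepf_measurable|exact: stepf_L2|move=> e e0; exists s].
rewrite /nq2; under eq_integral do rewrite subrr nq0.
by rewrite integral0 lee_fin ltW.
Qed.

Lemma approximable_closure f : quat_measurable f -> (nq2 nu f < +oo)%E ->
  (forall e : R, 0 < e -> exists2 g, approximable g &
    (nq2 nu (fun x => f x - g x)%R <= e%:E)%E) -> approximable f.
Proof.
move=> mf if2 H; split => // e e0; have e4 : 0 < e / 4 by rewrite divr_gt0.
have [g [mg _ /(_ _ e4) [s hs]] hg] := H _ e4; exists s.
have ms := stepf_measurable s.
rewrite (_ : (fun x => _) = fun x => (f x - g x) + (g x - stepf s x)); last first.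
  by apply/funext => x; rewrite addrA subrK.
apply: le_trans (nq2D nu (quat_measurableB mf mg) (quat_measurableB mg ms)) _.
have two0 : (0 <= 2%:E :> \bar R)%E by rewrite lee_fin.
apply: le_trans (leeD (lee_wpmul2l two0 hg) (lee_wpmul2l two0 hs)) _.
by rewrite -!EFinM -EFinD lee_fin; lra.
Qed.

Lemma approximableD f g : approximable f -> approximable g ->
  approximable (fun x => f x + g x).
Proof.
move=> [mf if2 af] [mg ig ag]; split; first exact: quat_measurableD.
  apply: le_lt_trans (nq2D nu mf mg) _.
  by rewrite lte_add_pinfty// lte_mul_pinfty// lee_fin.
move=> e e0; have e4 : 0 < e / 4 by rewrite divr_gt0.
have [s hs] := af _ e4; have [t ht] := ag _ e4; exists (s ++ t).
have ms := stepf_measurable s; have mt := stepf_measurable t.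
rewrite (_ : (fun x => _) = fun x => (f x - stepf s x) + (g x - stepf t x)); last first.
  by apply/funext => x; rewrite stepf_cat opprD addrACA.
apply: le_trans (nq2D nu (quat_measurableB mf ms) (quat_measurableB mg mt)) _.
have two0 : (0 <= 2%:E :> \bar R)%E by rewrite lee_fin.
apply: le_trans (leeD (lee_wpmul2l two0 hs) (lee_wpmul2l two0 ht)) _.
by rewrite -!EFinM -EFinD lee_fin; lra.
Qed.

Lemma approximableN f : approximable f -> approximable (fun x => - f x).
Proof.
move=> [mf if2 af]; split; first exact: quat_measurableN.
  by rewrite nq2N.
move=> e e0; have [s hs] := af _ e0; exists (negs s).
rewrite (_ : (fun x => _) = fun x => - (f x - stepf s x)); last first.
  by apply/funext => x; rewrite stepf_neg opprB opprK addrC.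
by rewrite nq2N.
Qed.

Lemma approximable0 : approximable (fun=> 0).
Proof. by rewrite -stepf_nil; exact: approximable_step. Qed.

Lemma approximable_sum (I : Type) (r : seq I) (F : I -> V -> quat R) :
  (forall i, approximable (F i)) -> approximable (fun x => \sum_(i <- r) F i x).
Proof.
move=> aF; elim: r => [|i r IH].
  rewrite (_ : (fun x => _) = fun=> 0); first exact: approximable0.
  by apply/funext => x; rewrite big_nil.
rewrite (_ : (fun x => _) = fun x => F i x + \sum_(j <- r) F j x).
  exact: approximableD.
by apply/funext => x; rewrite big_cons.
Qed.

(** Dominated convergence, [u_ k] lying between 0 and [u]. *)
Lemma approximable_limit u (u_ : nat -> V -> R) q :
  measurable_fun setT u -> (\int[nu]_x (u x ^+ 2)%:E < +oo)%E ->
  (forall x, 0 <= u x) -> (forall k x, 0 <= u_ k x <= u x) ->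
  (forall x, u_ k x @[k --> \oo] --> u x) ->
  (forall k, measurable_fun setT (u_ k)) ->
  (forall k, approximable (fun x => u_ k x *: q)) ->
  approximable (fun x => u x *: q).
Proof.
move=> mu iu u0 ub cu mu_ au.
have muq : quat_measurable (fun x => u x *: q).
  by apply: quat_measurableZ => //; exact: quat_measurable_cst.
have mu2 : measurable_fun setT (fun x => u x ^+ 2) by exact: measurable_funX.
have E (v : V -> R) : measurable_fun setT v ->
    (nq2 nu (fun x => v x *: q)%R = (nq q)%:E * \int[nu]_x (v x ^+ 2)%:E)%E.
  move=> mv; rewrite -ge0_integralZl//; last 3 first.
  - by apply/measurable_EFinP; exact: measurable_funX.
  - by move=> x _; rewrite lee_fin sqr_ge0.
  - by rewrite lee_fin nq_ge0.
  by apply: eq_integral => x _; rewrite nqZ mulrC EFinM.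
apply: approximable_closure => //.
  by rewrite E// lte_mul_pinfty// lee_fin nq_ge0.
move=> e e0.
have iu2 : nu.-integrable setT (fun x => (u x ^+ 2)%:E).
  apply/integrable_EFinP; split => //.
  by under eq_integral do rewrite ger0_norm ?sqr_ge0//.
have md k : measurable_fun setT (fun x => u x - u_ k x) by exact: measurable_funB.
have H := @dominated_cvg _ _ _ nu setT measurableT
  (fun k x => ((u x - u_ k x) ^+ 2)%:E) (fun=> 0%E) (fun x => (u x ^+ 2)%:E).
have cI : (\int[nu]_x ((u x - u_ k x)%R ^+ 2)%:E)%E @[k --> \oo] --> 0%E.
  have := H _ _ _ iu2 _; rewrite integral0; apply.
  - by move=> k; apply/measurable_EFinP; exact: measurable_funX.
  - move=> x _; apply: cvg_EFin; first exact: nearW.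
    have : (u x - u_ k x) ^+ 2 @[k --> \oo] --> (u x - u x) ^+ 2.
      apply: (@cvg_comp _ _ _ (fun k => u x - u_ k x) (fun z => z ^+ 2)); last exact: exprn_continuous.
      by apply: cvgB => //; exact: cvg_cst.
    by rewrite subrr expr0n.
  - by [].
  - move=> k x _; rewrite abse_EFin lee_fin ger0_norm ?sqr_ge0//.
    have /andP[h1 h2] := ub k x.
    by rewrite ler_pXn2r ?nnegrE ?subr_ge0// lerBlDr lerDl.
have q1 : 0 < nq q + 1 by rewrite ltr_wpDl// nq_ge0.
have e1 : 0 < e / (nq q + 1) by rewrite divr_gt0.
have [k _ Hk] : \forall k \near \oo, (\int[nu]_x ((u x - u_ k x)%R ^+ 2)%:E < (e / (nq q + 1))%:E)%E.
  have e1E : (0 < (e / (nq q + 1))%:E :> \bar R)%E by rewrite lte_fin.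
  exact: (cI _ (open_ereal_lt' e1E)).
exists (fun x => u_ k x *: q) => //.
rewrite (_ : (fun x => _) = fun x => (u x - u_ k x) *: q); last first.
  by apply/funext => x; rewrite scalerBl.
rewrite E//.
apply: le_trans (lee_wpmul2l _ (ltW (Hk k (leqnn k)))) _; first by rewrite lee_fin nq_ge0.
rewrite -EFinM lee_fin mulrCA ler_piMr ?(ltW e0)// ler_pdivrMr// mul1r lerDl//.
Qed.

Definition cube (M : nat) : V * V := (const_mx (- M%:R), const_mx (M%:R + M%:R)).

Local Notation cubef M := (boxf (cube M).1 (cube M).2).

Let in_cube M x : in_box (cube M).1 (cube M).2 x =
  [forall i, (- M%:R < x i 0) && (x i 0 <= M%:R)].
Proof.
by apply: eq_forallb => i; rewrite !mxE ger0_norm ?addr_ge0// addKr.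
Qed.

Lemma cvg_cube (x : V) : \forall M \near \oo, cubef M x = 1.
Proof.
exists (Num.truncn (\sum_j `|x j 0|)).+1 => // M /= hM.
rewrite boxfE in_cube (_ : [forall _, _] = true)//; apply/forallP => j.
have : `|x j 0| < M%:R.
  apply: le_lt_trans (lt_le_trans (truncnS_gt (\sum_j `|x j 0|)) _).
    by rewrite (bigD1 j)//= lerDl sumr_ge0.
  by rewrite ler_nat.
by rewrite ltr_norml => /andP[-> /ltW].
Qed.

Lemma boxf_L2 (A : set V) (a p : V) : measurable A ->
  [/\ measurable_fun setT (fun x => (\1_A x : R) * boxf a p x),
     (\int[nu]_x (((\1_A x : R) * boxf a p x) ^+ 2)%:E < +oo)%E &
     forall x, 0 <= (\1_A x : R) * boxf a p x <= boxf a p x].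
Proof.
move=> mA.
have b x : 0 <= (\1_A x : R) * boxf a p x <= boxf a p x.
  have /andP[b0 b1] := boxf_bound a p x; rewrite indicE.
  by case: (_ \in _); rewrite ?mul1r ?mul0r ?lexx ?b0.
have m1 : measurable_fun setT (fun x => (\1_A x : R) * boxf a p x).
  by apply: measurable_funM; [exact: measurable_indic|exact: measurable_boxf].
split => //.
have /integrable_EFinP[_] := integrable_boxf a p.
apply: le_lt_trans; apply: ge0_le_integral => //.
- by move=> x _; rewrite lee_fin sqr_ge0.
- by apply/measurable_EFinP; exact: measurable_funX.
- by apply/measurable_EFinP; apply: measurableT_comp => //; exact: measurable_boxf.
- move=> x _; rewrite lee_fin; have /andP[h0 h1] := b x.
  have /andP[b0 b1] := boxf_bound a p x.
  by rewrite ger0_norm// expr2 -[leRHS]mul1r ler_pM// (le_trans h1).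
Qed.

(** Inside a fixed box, the sets with approximable indicators form a Dynkin system
that contains the boxes.  The restriction to a box keeps complements integrable. *)
Lemma approximable_box (a p : V) (A : set V) q : measurable A ->
  approximable (fun x => ((\1_A x : R) * boxf a p x) *: q).
Proof.
move=> mA; move: A mA q.
have box1 (b r : V) q : approximable (fun x => boxf b r x *: q).
  rewrite (_ : (fun x => _) = stepf [:: (q, (b, r))]); first exact: approximable_step.
  by apply/funext => x; rewrite stepf_cons stepf_nil addr0.
pose P (A : set V) := forall q, approximable (fun x => ((\1_A x : R) * boxf a p x) *: q).
have PT : P setT.
  by move=> q; rewrite (_ : (fun x => _) = fun x => boxf a p x *: q)//;
    apply/funext => x; rewrite indicT mul1r.
suff : forall A, <<s @boxes R n >> A -> P A.
  by move=> H A mA; apply: H; rewrite -measurable_cVE.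
apply: dynkin_induction => //.
- exact: measurable_cVE.
- exact: boxes_setI.
- move=> B HB q.
  have [c [r Hcr]] := boxes_setI HB (boxes_in_box a p).
  rewrite (_ : (fun x => _) = fun x => boxf c r x *: q)//.
  apply/funext => x; rewrite -Hcr indicI /=; congr ((_ * _) *: _).
  by rewrite boxfE indicE; congr (_ %:R); rewrite mem_setE.
- move=> S mS PS q.
  rewrite (_ : (fun x => _) = fun x => ((\1_setT x : R) * boxf a p x) *: q +
      - (((\1_S x : R) * boxf a p x) *: q)).
    by apply: approximableD; [exact: PT|exact/approximableN/PS].
  apply/funext => x; rewrite -scalerBl -mulrBl !indicE in_setC in_setT.
  by case: (_ \in _); rewrite ?subrr ?subr0.
- move=> F mF tF PF q.
  pose u_ N x := \sum_(k < N) (\1_(F k) x : R) * boxf a p x.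
  have mU : measurable (\bigcup_k F k) by exact: bigcupT_measurable.
  have [m1 i1 b1] := boxf_L2 a p mU.
  (* At a point of the union, the partial sums are 0 up to the index of the one set that
   contains it. *)
  have uE N x : u_ N x = (if pselect (exists k, F k x) is left h
      then (xget 0%N [set k | F k x] < N)%:R else 0) * boxf a p x.
    rewrite /u_ -mulr_suml; congr (_ * _); case: pselect => [h|h]; last first.
      by rewrite big1// => k _; rewrite indicE memNset// => hk; apply: h; exists k.
    have Fk0 := xgetPex 0%N h.
    set k0 := xget _ _ in Fk0 *.
    rewrite (eq_bigr (fun k : 'I_N => (val k == k0)%:R)); last first.
      move=> k _; rewrite indicE; case: eqVneq => [->|ne]; first by rewrite mem_set.
      rewrite memNset// => hk; move/eqP: ne; apply.
      by apply: (tF _ _ I I); exists x.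
    case: ltnP => [lt|ge]; last first.
      by rewrite big1// => k _; rewrite ltn_eqF// (leq_trans (ltn_ord k) ge).
    rewrite (bigD1 (Ordinal lt))//= eqxx big1 ?addr0// => k ne.
    by case: eqP => // e; case/eqP: ne; exact: val_inj.
  have UE x : (\1_(\bigcup_k F k) x : R) =
      if pselect (exists k, F k x) is left _ then 1 else 0.
    rewrite indicE; case: pselect => [[k hk]|h]; first by rewrite mem_set//; exists k.
    by rewrite memNset// => -[k _ hk]; apply: h; exists k.
  apply: (approximable_limit m1 i1 (u_ := u_)).
  - by move=> x; case/andP: (b1 x).
  - move=> k x; rewrite uE UE; have /andP[b0 _] := boxf_bound a p x.
    case: pselect => h; last by rewrite mul0r lexx.
    by case: (_ < _)%N; rewrite ?mul1r ?mul0r ?b0 lexx.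
  - move=> x; rewrite UE; apply: cvg_near_cst.
    case: (pselect (exists k, F k x)) => h; last first.
      by apply: nearW => k; rewrite uE; case: pselect.
    exists (xget 0%N [set k | F k x]).+1 => // N /= hN; rewrite uE.
    by case: pselect => // h'; rewrite hN.
  - move=> k; apply: measurable_sum => i.
    by have [] := boxf_L2 a p (mF i).
  - move=> N; rewrite (_ : (fun x => _) =
        fun x => \sum_(k < N) ((\1_(F k) x : R) * boxf a p x) *: q).
      by apply: approximable_sum => k; exact: PF.
    by apply/funext => x; rewrite scaler_suml.
Qed.

(** [u] is the limit of simple functions truncated to growing cubes, and each
level set is handled by [approximable_box]. *)
Lemma approximable_scaled u q : measurable_fun setT u -> (forall x, 0 <= u x) ->
  (\int[nu]_x (u x ^+ 2)%:E < +oo)%E -> approximable (fun x => u x *: q).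
Proof.
move=> mu u0 iu.
have muE : measurable_fun setT (EFin \o u) by exact/measurable_EFinP.
pose f_ := nnsfun_approx measurableT muE.
have cf (x : V) : f_ k x @[k --> \oo] --> u x.
  have : (f_ k x)%:E @[k --> \oo] --> (u x)%:E.
    by apply: (cvg_nnsfun_approx measurableT muE) => // y _; rewrite lee_fin.
  by move/fine_cvgP => [].
have fu k (x : V) : 0 <= f_ k x <= u x.
  rewrite fun_ge0 /=.
  have nd : nondecreasing_seq (fun k => f_ k x).
    by move=> i j ij; exact/lefP/nd_nnsfun_approx.
  have := nondecreasing_cvgn_le nd (cvgP _ (cf x)) k.
  by rewrite (cvg_lim _ (cf x)).
apply: (approximable_limit mu iu u0 (u_ := fun k (x : V) => f_ k x * cubef k x)).
- move=> k x; have /andP[f0 fl] := fu k x.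
  have /andP[b0 b1] := boxf_bound (cube k).1 (cube k).2 x.
  by rewrite mulr_ge0//= (le_trans _ fl)// ler_piMr.
- move=> x; rewrite -[u x]mulr1; apply: cvgM => //.
  by apply: cvg_near_cst; exact: cvg_cube.
- by move=> k; apply: measurable_funM => //; exact: measurable_boxf.
- move=> k; rewrite (_ : (fun x => _) = fun x =>
    \sum_(y <- finmap.enum_fset (fset_set (range (f_ k))))
      ((\1_(f_ k @^-1` [set y]) x : R) * cubef k x) *: (y *: q)).
    by apply: approximable_sum => y; exact: approximable_box.
  apply/funext => x; rewrite {1}(fimfunE (f_ k) x) fsbig_finite// mulr_suml scaler_suml.
  by apply: eq_bigr => y _; rewrite scalerA; congr (_ *: q); ring.
Qed.

Theorem step_functions_dense f : quat_measurable f -> (nq2 nu f < +oo)%E -> approximable f.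
Proof.
move=> mf if2; have [f1 f2 f3 f4] := mf.
have part (c : quat R -> R) q : measurable_fun setT (c \o f) ->
    (forall x, (c x) ^+ 2 <= nq x) -> approximable (fun x => c (f x) *: q).
  move=> mc cn.
  have H (v : V -> R) : measurable_fun setT v -> (forall x, 0 <= v x) ->
      (forall x, v x <= `|c (f x)|) -> approximable (fun x => v x *: q).
    move=> mv v0 vc; apply: approximable_scaled => //.
    apply: le_lt_trans if2; apply: ge0_le_integral => //.
    - by move=> x _; rewrite lee_fin sqr_ge0.
    - by apply/measurable_EFinP; exact: measurable_funX.
    - by apply/measurable_EFinP; exact: measurable_nq.
    - move=> x _; rewrite lee_fin; apply: le_trans (cn _).
      by rewrite -[leRHS]real_normK ?num_real// ler_pXn2r ?nnegrE.
  rewrite (_ : (fun x => _) = fun x => Num.max (c (f x)) 0 *: q +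
      - (Num.max (- c (f x)) 0 *: q)).
    apply: approximableD; last apply: approximableN; apply: H.
    - by apply: measurable_maxr => //; exact: measurable_cst.
    - by move=> x; rewrite le_max lexx orbT.
    - by move=> x; rewrite ge_max ler_norm normr_ge0.
    - by apply: measurable_maxr; [exact: measurable_funN|exact: measurable_cst].
    - by move=> x; rewrite le_max lexx orbT.
    - by move=> x; rewrite ge_max -normrN ler_norm normr_ge0.
  apply/funext => x; rewrite -scalerBl; congr (_ *: q).
  have [h|h] := leP 0 (c (f x)).
    by rewrite (_ : Num.max _ _ = 0) ?subr0//; apply: max_r; rewrite oppr_le0.
  by rewrite (max_l _) ?sub0r ?opprK// oppr_ge0 ltW.
rewrite (_ : f = fun x => q_re (f x) *: (1 : quat R) + q_i (f x) *: Quat 0 1 0 0 +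
    q_j (f x) *: Quat 0 0 1 0 + q_k (f x) *: Quat 0 0 0 1).
  have bnd (y1 y2 y3 y4 y : R) : y1 ^+ 2 + y2 ^+ 2 + y3 ^+ 2 + y4 ^+ 2 = y ->
      [/\ y1 ^+ 2 <= y, y2 ^+ 2 <= y, y3 ^+ 2 <= y & y4 ^+ 2 <= y].
    have := sqr_ge0 y1; have := sqr_ge0 y2; have := sqr_ge0 y3; have := sqr_ge0 y4.
    by move=> *; split; lra.
  apply: approximableD; first apply: approximableD; first apply: approximableD.
  - by apply: part => // x; have [] := bnd _ _ _ _ _ (erefl (nq x)).
  - by apply: part => // x; have [] := bnd _ _ _ _ _ (erefl (nq x)).
  - by apply: part => // x; have [] := bnd _ _ _ _ _ (erefl (nq x)).
  - by apply: part => // x; have [] := bnd _ _ _ _ _ (erefl (nq x)).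
by apply/funext => x; apply: quat_eqP; rewrite !quatE /=; ring.
Qed.

End step_density.

(** * The energy identity *)

Lemma fatou_le {R : realType} d (T : measurableType d) (mu : {measure set T -> \bar R})
    (f_ : nat -> T -> R) (f : T -> R) (B : \bar R) :
  (forall k, measurable_fun setT (f_ k)) -> (forall k x, 0 <= f_ k x) ->
  (forall x, f_ k x @[k --> \oo] --> f x) ->
  (forall k, \int[mu]_x (f_ k x)%:E <= B)%E -> (\int[mu]_x (f x)%:E <= B)%E.
Proof.
move=> mf f0 cf fB.
have -> : (\int[mu]_x (f x)%:E = \int[mu]_x limn_einf (fun k => (f_ k x)%:E))%E.
  apply: eq_integral => x _.
  have c : (f_ k x)%:E @[k --> \oo] --> (f x)%:E by apply/fine_cvgP; split; [exact: nearW|exact: cf].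
  by rewrite (cvg_limn_einf_sup c).1.
apply: le_trans (fatou mu measurableT (f := fun k x => (f_ k x)%:E) _ _) _.
- by move=> k; apply/measurable_EFinP.
- by move=> k x _; rewrite lee_fin.
- rewrite limn_einf_lim; apply: lime_le; first exact: is_cvg_einfs.
  apply: nearW => k; apply: le_trans (fB k).
  by apply: ereal_inf_lbound; exists k => /=.
Qed.

Section energy_identity.
Context {R : realType} (n : nat).
Local Notation V := 'cV[R]_(n.+1 + n.+1).
Local Notation W := 'cV[R]_(n + n.+1).
Local Notation nu := (@lebesgue_cV R (n.+1 + n.+1)).
Local Notation P := (measurableTypeR R * W * V)%type.
Variables (psi g : V -> quat R).
Hypotheses (mpsi : quat_measurable psi) (ipsi : (nq2 nu psi < +oo)%E)
  (psig : is_QFT (star psi) g).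

Let C : \bar R :=
  (\int[nu]_x (nq (g x) * (`|fst_coord x| ^+ (2 * n.+1))^-1)%:E)%E.
Hypothesis finC : (C < +oo)%E.

Let sm := @shear_measure R n.

Let C0 : (0 <= C)%E.
Proof.
by apply: integral_ge0 => x _; rewrite lee_fin mulr_ge0 ?nq_ge0// invr_ge0 exprn_ge0.
Qed.

Let c := fine C.
Let c0 : 0 <= c. Proof. exact: fine_ge0. Qed.
Let cE : C = c%:E. Proof. by rewrite fineK// ge0_fin_numE. Qed.

Let energy_step s : nq2 sm (SH psi (stepf s)) = (c%:E * nq2 nu (stepf s))%E.
Proof.
rewrite -cE.
exact: (energy_bochner mpsi ipsi psig (stepf_bochner s) (stepf_integrable s) (stepf_bound s)).
Qed.

(** The energy of [h] is bounded by approximating [h] by step functions [s_ k]: the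
transforms converge pointwise by [nq_SH_le], and Fatou's lemma applies.  Errors
decrease like [(k + 1)^-2], so that in [nq_dist_le] a weight [(k + 1)^-1] can be used. *)
Let energy_bound h : quat_measurable h -> (nq2 nu h < +oo)%E ->
  (nq2 sm (SH psi h) <= (2 * c)%:E * nq2 nu h)%E.
Proof.
move=> mh ih; have [_ _ dense] := step_functions_dense mh ih.
set M := fine (nq2 nu psi).
have M0 : 0 <= M by apply: fine_ge0; exact: nq2_ge0.
have hE : nq2 nu h = (fine (nq2 nu h))%:E by rewrite fineK// nq2_fin.
apply/lee_addgt0Pr => e e0.
(* The first bound keeps the energies of the approximations below the target, the
   second one makes their transforms converge. *)
pose ek (k : nat) : R := Num.min (e / (2 * c + 1)) (k.+1%:R^-1 ^+ 2).
have cp : 0 < 2 * c + 1 by rewrite ltr_wpDl// mulr_ge0.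
have ek0 k : 0 < ek k by rewrite lt_min divr_gt0//= exprn_gt0// invr_gt0.
have [s_ hs] := boolp.choice (fun k => dense (ek k) (ek0 k)).
have iB k : (nq2 nu (fun x => h x - stepf (s_ k) x)%R < +oo)%E.
  by apply: le_lt_trans (hs k) _; rewrite ltry.
have mB k : quat_measurable (fun x => h x - stepf (s_ k) x).
  by apply: quat_measurableB => //; exact: stepf_measurable.
apply: (fatou_le (f_ := fun k z => nq (SH psi (stepf (s_ k)) z))).
- by move=> k; apply: measurable_nq; apply: measurable_SH => //; exact: stepf_measurable.
- by move=> k z; exact: nq_ge0.
- move=> z; set q := SH psi h z.
  have dist k : `|nq q - nq (SH psi (stepf (s_ k)) z)| <= (nq q + 2 * M) * k.+1%:R^-1.
    have d0 : 0 < k.+1%:R^-1 :> R by rewrite invr_gt0.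
    rewrite distrC; apply: le_trans (nq_dist_le _ _ d0) _.
    rewrite -[nq (_ - q)]nqN opprB -(SHB mpsi ipsi z mh ih (stepf_measurable _) (stepf_L2 _)).
    have := nq_SH_le mpsi ipsi z (mB k) (iB k); rewrite -/M.
    have : fine (nq2 nu (fun x => h x - stepf (s_ k) x)) <= k.+1%:R^-1 ^+ 2.
      rewrite -lee_fin fineK; last exact: nq2_fin.
      by apply: le_trans (hs k) _; rewrite lee_fin ge_min lexx orbT.
    set a := fine _; set b := nq _; rewrite invrK => h1 h2.
    have h3 : b <= k.+1%:R^-1 ^+ 2 * M by apply: le_trans h2 _; rewrite ler_wpM2r.
    have k0 : (k.+1%:R : R) != 0 by rewrite pnatr_eq0.
    have k1 : 1 <= k.+1%:R :> R by rewrite ler1n.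
    move: (k.+1%:R : R) k0 k1 d0 h1 h3 => K K0 K1 d0 h1 h3.
    have h4 : (1 + K) * b <= (K + K) * (K^-1 ^+ 2 * M).
      apply: ler_pM => //; [lra|exact: nq_ge0|lra].
    have h5 : (K + K) * (K^-1 ^+ 2 * M) = 2 * M * K^-1 by field.
    by rewrite h5 in h4; rewrite [leRHS]mulrDl [nq q * _]mulrC lerD2l.
  apply/cvgrPdist_le => d d0.
  have : (nq q + 2 * M) * harmonic k @[k --> \oo] --> (nq q + 2 * M) * 0.
    by apply: cvgMr; exact: cvg_harmonic.
  rewrite mulr0 => /cvgrPdist_le /(_ _ d0); apply: filterS => k.
  rewrite sub0r normrN /harmonic /= => H; apply: le_trans (dist k) _.
  exact: le_trans (ler_norm _) H.
- move=> k; rewrite -/(nq2 sm (SH psi (stepf (s_ k)))) energy_step.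
  have ms := stepf_measurable (s_ k).
  have b1 : (nq2 nu (stepf (s_ k)) <= 2%:E * nq2 nu h + 2%:E * (ek k)%:E)%E.
    rewrite (_ : stepf (s_ k) = fun x => h x + - (h x - stepf (s_ k) x)); last first.
      by apply/funext => x; rewrite opprB addrC subrK.
    apply: le_trans (nq2D nu mh (quat_measurableN (mB k))) _.
    by rewrite leeD2l// nq2N; apply: lee_wpmul2l; [rewrite lee_fin|exact: hs].
  have c0E : (0 <= c%:E)%E by rewrite lee_fin.
  apply: le_trans (lee_wpmul2l c0E b1) _.
  rewrite hE -!EFinM -!EFinD lee_fin mulrDr.
  have h1 : ek k <= e / (2 * c + 1) by rewrite ge_min lexx.
  have h2 : (2 * c) * ek k <= e.
    apply: le_trans (ler_wpM2l _ h1) _; first by rewrite mulr_ge0.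
    by rewrite mulrA ler_pdivrMr// [leRHS]mulrC ler_wpM2r ?(ltW e0)// lerDl.
  by rewrite !mulrA [c * 2]mulrC lerD2l.
Qed.

Let split_error (x y ns nf k : R) : y = k * ns -> x - k * nf = k * (ns - nf) - (y - x).
Proof. by move=> ->; ring. Qed.

(** A step function close to [f] satisfies the identity; [nq2_dist] on both sides, with
[energy_bound] for the difference, transfers it to [f]. *)
Theorem energy_identity f : quat_measurable f -> (nq2 nu f < +oo)%E ->
  nq2 sm (SH psi f) = (C * nq2 nu f)%E.
Proof.
move=> mf if2; have [_ _ dense] := step_functions_dense mf if2.
have N0 h : 0 <= fine (nq2 nu h) by rewrite fine_ge0// nq2_ge0.
have E0 h : 0 <= fine (nq2 sm h) by rewrite fine_ge0// nq2_ge0.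
have fe h : (nq2 nu h < +oo)%E -> nq2 nu h = (fine (nq2 nu h))%:E.
  by move=> ?; rewrite fineK// nq2_fin.
have iE h : quat_measurable h -> (nq2 nu h < +oo)%E -> (nq2 sm (SH psi h) < +oo)%E.
  move=> mh ih; apply: le_lt_trans (energy_bound mh ih) _.
  by rewrite lte_mul_pinfty// lee_fin mulr_ge0.
have iEf := iE f mf if2.
rewrite cE (fe f if2) -EFinM -(fineK (nq2_fin iEf)); congr (_%:E).
apply: (approx_eq (S := fine (nq2 sm (SH psi f)) + c * fine (nq2 nu f)) (K := 3 * c)).
- by rewrite addr_ge0// mulr_ge0.
- by rewrite mulr_ge0.
move=> d e d0 e0; have [s hs] := dense e e0.
have ms := stepf_measurable s; have iS := stepf_L2 s.
have mD : quat_measurable (fun x => stepf s x - f x) by exact: quat_measurableB.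
have nD : nq2 nu (fun x => stepf s x - f x)%R = nq2 nu (fun x => f x - stepf s x)%R.
  by rewrite -nq2N; apply: eq_integral => x _; rewrite opprB.
have iD : (nq2 nu (fun x => stepf s x - f x)%R < +oo)%E.
  by rewrite nD; apply: le_lt_trans hs _; rewrite ltry.
have [_ h1] := nq2_dist d0 mf ms if2 iD.
have SB : (fun z => SH psi (stepf s) z - SH psi f z) = SH psi (fun x => stepf s x - f x).
  by apply/funext => z; rewrite SHB.
have iSD : (nq2 sm (fun z => SH psi (stepf s) z - SH psi f z)%R < +oo)%E.
  by rewrite SB; exact: iE.
have [_ h2] := nq2_dist d0 (measurable_SH mpsi mf) (measurable_SH mpsi ms) iEf iSD.
have h3 : fine (nq2 nu (fun x => stepf s x - f x)) <= e.
  by rewrite -lee_fin fineK ?nD//; rewrite -nD; exact: nq2_fin.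
have h4 : fine (nq2 sm (fun z => SH psi (stepf s) z - SH psi f z)) <= 2 * c * e.
  rewrite -lee_fin fineK ?nq2_fin// SB; apply: le_trans (energy_bound mD iD) _.
  by rewrite fe// -EFinM lee_fin ler_wpM2l// mulr_ge0.
have h5 : fine (nq2 sm (SH psi (stepf s))) = c * fine (nq2 nu (stepf s)).
  by rewrite energy_step fe.
have i0 : 0 <= 1 + d^-1 by rewrite addr_ge0// invr_ge0 ltW.
have j1 := ler_wpM2l i0 h3; have j2 := ler_wpM2l i0 h4.
have k1 := le_trans h1 (lerD (lexx _) j1); have k2 := le_trans h2 (lerD (lexx _) j2).
have k3 := ler_wpM2l c0 k1.
rewrite -[X in X * `|_|](ger0_norm c0) -normrM in k3.
have -> : fine (nq2 sm (SH psi f)) - c * fine (nq2 nu f) =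
   c * (fine (nq2 nu (stepf s)) - fine (nq2 nu f)) -
   (fine (nq2 sm (SH psi (stepf s))) - fine (nq2 sm (SH psi f))).
  exact: split_error h5.
apply: le_trans (ler_normB _ _) _; apply: le_trans (lerD k3 k2) _.
by rewrite le_eqVlt; apply/orP; left; apply/eqP; ring.
Qed.

End energy_identity.

(** * Concentration *)

Lemma powR_ge1_le {R : realType} (a r : R) : 0 <= a <= 1 -> 1 <= r -> a `^ r <= a.
Proof.
move=> /andP[a0 a1] r1; have [->|an] := eqVneq a 0.
  by rewrite powR0// gt_eqF// (lt_le_trans ltr01).
have ap : 0 < a by rewrite lt_neqAle eq_sym an.
by rewrite -[leRHS]powRr1// ger_powR// ap.
Qed.

Lemma sqrte_EFin {R : realType} (x : R) : sqrte x%:E = (Num.sqrt x)%:E.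
Proof. by []. Qed.

Lemma conjugate_exponent_ge1 {R : realType} (p : R) : 2 < p -> 1 <= p / (p - 2).
Proof. by move=> p2; rewrite ler_pdivlMr ?subr_gt0// mul1r gerBl. Qed.

(** The inequality between energies, divided by [nf * np]: [x] and [y] are the energy off
[Sigma] and the total one, [c] the admissibility constant and [s] the measure of [Sigma]. *)
Lemma concentration_real {R : realType} (m xi x y c nf np s : R) :
  0 <= x -> 0 <= xi -> 0 <= c -> 0 < nf -> 0 < np -> 0 <= s ->
  Num.sqrt x <= xi * Num.sqrt y -> y = c * nf -> y - x <= nf * np * s ->
  0 <= m <= Num.max 0 (1 - xi ^+ 2) -> m * (c / np) <= s.
Proof.
move=> x0 xi0 c0 nf0 np0 s0 hx yE hs /andP[m0 mM].
have y0 : 0 <= y by rewrite yE mulr_ge0// ltW.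
have hx2 : x <= xi ^+ 2 * y.
  rewrite -(sqr_sqrtr x0) -(sqr_sqrtr y0) -exprMn.
  by rewrite ler_pXn2r ?nnegrE ?mulr_ge0 ?sqrtr_ge0.
rewrite mulrA ler_pdivrMr//.
have [h|h] := leP (1 - xi ^+ 2) 0.
  (* For [xi >= 1] the power is 0. *)
  have -> : m = 0 by apply/le_anti; rewrite m0 (le_trans mM)// ge_max lexx h.
  by rewrite mul0r mulr_ge0// ltW.
have mM' : m <= 1 - xi ^+ 2 by apply: le_trans mM _; rewrite ge_max (ltW h) lexx.
have : (1 - xi ^+ 2) * (c * nf) <= nf * np * s.
  by apply: le_trans hs; rewrite -yE; lra.
rewrite [_ * (c * nf)]mulrCA mulrA [c * _]mulrC [_ * nf]mulrC -mulrA ler_pM2l// [np * s]mulrC.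
by apply: le_trans; apply: ler_wpM2r.
Qed.

Lemma nq2_gt0 {R : realType} n (f : 'cV[R]_n -> quat R) :
  quat_measurable f -> ~ ae_zero f -> (0 < nq2 (lebesgue_cV n) f)%E.
Proof.
move=> mf nz; rewrite lt_neqAle nq2_ge0 andbT eq_sym; apply/eqP => H; apply: nz.
have mN : measurable_fun setT (fun x => (nq (f x))%:E).
  by apply/measurable_EFinP; exact: measurable_nq.
have : (\int[lebesgue_cV n]_x `|(nq (f x))%:E| = 0)%E.
  by rewrite -[RHS]H; apply: eq_integral => x _; rewrite abse_EFin ger0_norm ?nq_ge0.
move=> /(ae_eq_integral_abs _ measurableT mN).1; apply: filterS => x /(_ I) /=.
by move=> [] /nq_eq0.
Qed.

Section concentration.
Context {R : realType} (n : nat).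
Local Notation V := 'cV[R]_(n.+1 + n.+1).
Local Notation W := 'cV[R]_(n + n.+1).
Local Notation nu := (@lebesgue_cV R (n.+1 + n.+1)).
Local Notation P := (measurableTypeR R * W * V)%type.
Local Notation sm := (@shear_measure R n).
Variables (psi f : V -> quat R).
Hypotheses (mpsi : quat_measurable psi) (ipsi : (nq2 nu psi < +oo)%E)
  (mf : quat_measurable f) (if2 : (nq2 nu f < +oo)%E).

Let F z : \bar R := (nq (SH psi f z))%:E.

Let mF : measurable_fun setT F.
Proof. by apply/measurable_EFinP; apply: measurable_nq; exact: measurable_SH. Qed.

Let F0 z : (0 <= F z)%E. Proof. by rewrite lee_fin nq_ge0. Qed.

Lemma SH_energy_le (A : set P) : measurable A ->
  (\int[sm]_(z in A) F z <= (fine (nq2 nu f) * fine (nq2 nu psi))%:E * sm A)%E.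
Proof.
move=> mA; rewrite -integral_cst//; apply: ge0_le_integral => //.
- exact: measurable_funTS.
- by move=> z _; rewrite lee_fin nq_SH_le.
Qed.

Lemma measurable_shear_dom : measurable (@shear_dom R n).
Proof.
have m1 : measurable_fun setT (fun z : P => z.1.1).
  exact: (measurableT_comp measurable_fst measurable_fst).
rewrite (_ : @shear_dom R n = (fun z : P => z.1.1) @^-1` (~` [set 0%R])); last first.
  by apply/seteqP; split => z /= /eqP.
by rewrite -[X in measurable X]setTI; apply: m1 => //; apply: measurableC; exact: measurable_set1.
Qed.

(** The density vanishes at [a = 0], where an inverse power of 0 reads 0. *)
Lemma shear_measure_dom : sm (~` @shear_dom R n) = 0%E.
Proof.
apply: integral0_eq => z /= /negP; rewrite negbK => /eqP z0.
by rewrite /shear_density z0 normr0 expr0n invr0.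
Qed.

Lemma SH_energy_dom : (\int[sm]_(z in @shear_dom R n) F z = nq2 sm (SH psi f))%E.
Proof.
have mD := measurable_shear_dom.
have mDc := measurableC mD.
have dj : [disjoint @shear_dom R n & ~` @shear_dom R n] by apply/disj_setPCl.
transitivity (\int[sm]_(z in @shear_dom R n `|` ~` @shear_dom R n) F z)%E; last first.
  by rewrite setUv.
rewrite (ge0_integral_setU _ mD mDc (measurable_funTS mF) (fun z _ => F0 z) dj).
have : (\int[sm]_(z in ~` @shear_dom R n) F z <= 0)%E.
  by apply: le_trans (SH_energy_le (measurableC mD)) _; rewrite shear_measure_dom mule0.
have : (0 <= \int[sm]_(z in ~` @shear_dom R n) F z)%E by exact: integral_ge0.
by move=> h1 h2; rewrite [X in (_ + X)%E](_ : _ = 0%E) ?adde0//; apply/le_anti; rewrite h1 h2.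
Qed.

(** The energy on [Sigma] is the total energy, known by [energy_identity], minus the part
off [Sigma], which concentration bounds; on the other hand it is at most
[|f|^2 |psi|^2] times the measure of [Sigma]. *)
Lemma concentration (g : V -> quat R) (Sigma : set P) (xi m : R) :
  is_QFT (star psi) g ->
  let C := (\int[nu]_x (nq (g x) * (`|fst_coord x| ^+ (2 * n.+1))^-1)%:E)%E in
  (C < +oo)%E -> ~ ae_zero psi -> ~ ae_zero f ->
  measurable Sigma -> Sigma `<=` @shear_dom R n -> 0 <= xi ->
  concentrated xi Sigma (SH psi f) -> 0 <= m <= Num.max 0 (1 - xi ^+ 2) ->
  (m%:E * (C / nq2 nu psi) <= sm Sigma)%E.
Proof.
move=> Qg C finC npsi nf mS SD xi0 conc mb.
have C0 : (0 <= C)%E.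
  by apply: integral_ge0 => x _; rewrite lee_fin mulr_ge0 ?nq_ge0// invr_ge0 exprn_ge0.
have fp := nq2_gt0 mpsi npsi; have ff := nq2_gt0 mf nf.
have pE : nq2 nu psi = (fine (nq2 nu psi))%:E by rewrite fineK// nq2_fin.
have fE : nq2 nu f = (fine (nq2 nu f))%:E by rewrite fineK// nq2_fin.
have cE : C = (fine C)%:E by rewrite fineK// ge0_fin_numE.
have np0 : 0 < fine (nq2 nu psi) by rewrite -lte_fin -pE.
have nf0 : 0 < fine (nq2 nu f) by rewrite -lte_fin -fE.
have c0 : 0 <= fine C by exact: fine_ge0.
have mD := measurable_shear_dom.
have mDS : measurable (@shear_dom R n `\` Sigma) by exact: measurableD.
set X := (\int[sm]_(z in @shear_dom R n `\` Sigma) F z)%E.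
set Z := (\int[sm]_(z in Sigma) F z)%E.
have X0 : (0 <= X)%E by exact: integral_ge0.
have Z0 : (0 <= Z)%E by exact: integral_ge0.
have YE : (X + Z = (fine C * fine (nq2 nu f))%:E)%E.
  rewrite EFinM -cE -fE -(energy_identity mpsi ipsi Qg finC mf if2) -SH_energy_dom.
  rewrite -[in RHS](setDUK SD) setUC ge0_integral_setU//.
  - exact: measurable_funTS.
  - by apply/disj_setPS => z [[]].
have Xfin : X \is a fin_num.
  by rewrite ge0_fin_numE// (le_lt_trans _ (ltry (fine C * fine (nq2 nu f))))// -YE leeDl.
have Zfin : Z \is a fin_num.
  by rewrite ge0_fin_numE// (le_lt_trans _ (ltry (fine C * fine (nq2 nu f))))// -YE leeDr.
have SL := SH_energy_le mS.
have [-> |Sfin] := eqVneq (sm Sigma) +oo%E; first exact: leey.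
have sE : sm Sigma = (fine (sm Sigma))%:E.
  by rewrite fineK// ge0_fin_numE// ltey.
move: conc; rewrite /concentrated !norm2_nq2 SH_energy_dom.
rewrite (energy_identity mpsi ipsi Qg finC mf if2) -/C cE fE -EFinM -/X -(fineK Xfin).
rewrite sqrte_EFin lee_fin => hx.
rewrite pE inver gt_eqF// -!EFinM sE lee_fin.
apply: (concentration_real (fine_ge0 X0) xi0 c0 nf0 np0 _ hx erefl _ mb).
  by rewrite fine_ge0.
move: YE SL; rewrite -/Z -(fineK Xfin) -(fineK Zfin) sE -EFinD -EFinM lee_fin => -[<-].
by rewrite addrAC subrr add0r.
Qed.

End concentration.

(* n.+1 is the integer n >= 1 of the text. The real power (1 - xi^2)^(p/(p-2)) is
   meaningful for xi <= 1, where Num.max 0 (1 - xi^2) = 1 - xi^2; for xi > 1 its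
   value is read as 0. *)
Theorem theorem8 (R : realType) (n : nat)
    (psi f : 'cV[R]_(n.+1 + n.+1) -> quat R)
    (Sigma : set (measurableTypeR R * 'cV[R]_(n + n.+1) * 'cV[R]_(n.+1 + n.+1)))
    (xi : R) :
  admissible psi -> ~ ae_zero psi ->
  L2 f -> ~ ae_zero f ->
  measurable Sigma -> Sigma `<=` @shear_dom R n ->
  0 <= xi ->
  concentrated xi Sigma (SH psi f) ->
  forall p : R, 2 < p ->
    ((Num.max 0 (1 - xi ^+ 2) `^ (p / (p - 2)))%:E *
       (Cpsi psi / L2norm psi ^+ 2) <= shear_measure Sigma)%E.
Proof.
move=> [[mpsi /L2norm_lty ipsi] finC] npsi [mf /L2norm_lty if2] nf mS SD xi0 conc p p2.
have CE : Cpsi psi = (\int[lebesgue_cV (n.+1 + n.+1)]_w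
    (nq (QFT (star psi) w) * (`|fst_coord w| ^+ (2 * n.+1))^-1)%:E)%E.
  by apply: eq_integral => w _; rewrite sqr_qabs.
rewrite L2norm_sqr.
have [Q|Q] := pselect (exists g, is_QFT (star psi) g); last first.
  have Q0 : QFT (star psi) = fun=> 0 by apply: xgetPN => g Qg; apply: Q; exists g.
  have -> : Cpsi psi = 0%E.
    by rewrite CE Q0; apply: integral0_eq => w _; rewrite nq0 mul0r.
  by rewrite mul0e mule0 measure_ge0.
have Qg : is_QFT (star psi) (QFT (star psi)) := xgetPex _ Q.
rewrite CE in finC *; apply: (concentration mpsi ipsi mf if2 Qg finC npsi nf mS SD xi0 conc).
rewrite powR_ge0 /=; apply: powR_ge1_le; last exact: conjugate_exponent_ge1.
by rewrite le_max lexx ge_max ler01 gerBl sqr_ge0.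
Qed.
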